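(* Let $\nu>0$, and let the force be given by a sufficiently smooth divergence-free vector field of form (A) or (B) (see context), with associated bound $G$: - in case (A), suppose that there exists a divergence-free vector field $H(x,s)$, independent of $\Omega$, satisfying $\partial_t\big[\frac1\Omega H(x,\Omega t)\big]=F(x_1+\Omega t,x')$ and $\sup_t\|H(\cdot,\Omega t)\|_{C^1(\mathbb{T}^3)}\le G$; - in case (B), $G$ is a number with $\|f\|_{C^1(\mathbb{T}^3)}\le G$. Let $\Omega$ be sufficiently large (depending on $\nu$ and $G$), and let $v_{per}$ be the time periodic solution, of period $T_{per}=2\pi/\Omega$, of $$v_t+v\cdot\nabla v-\nu\Delta v+\nabla p=F_\Omega,\qquad \mathrm{div}\,v=0,\qquad \int_{\mathbb{T}^3}v\,dx=0, \qquad ( * )$$ satisfying $\|v_{per}\|_{L_\infty(\mathbb{T}^3\times T_{per}\mathbb{S}^1)}\le \frac{C^*(1+\nu)G}{\Omega}$ (see context). Let $v_0\in L_2(\mathbb{T}^3)$ be a divergence-free vector field with $\int_{\mathbb{T}^3}v_0\,dx=0$, and let $v(t)$ be a Leray–Hopf weak solution of $( * )$ with initial datum $v_0$. Then $$\|v(t)-v_{per}(t)\|_{L_2(\mathbb{T}^3)}\to 0\qquad\text{as } t\to\infty .$$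
   Context: $\mathbb{T}^3=[0,2\pi]^3$ with periodic boundary conditions, $x=(x_1,x')$ with $x'=(x_2,x_3)$. $T_{per}\mathbb{S}^1$ denotes the circle of length $T_{per}$, so functions on $\mathbb{T}^3\times T_{per}\mathbb{S}^1$ are $T_{per}$-periodic in time. The force $F_\Omega(x,t)$, $\Omega>0$, has one of the following two forms. (A) $F_\Omega(x,t)=F(x_1+\Omega t,x')$, where $F:\mathbb{T}^3\to\mathbb{R}^3$ is a time-independent divergence-free vector field with $\int_{\mathbb{T}^3}F\,dx=0$ whose Fourier coefficients satisfy $\hat F_k=0$ for all $k=(0,k_2,k_3)$. (This is the system for the perturbation $v-\Omega\hat e_1$ of a constant background flow $\Omega\hat e_1$, after the Galilean change of variables.) (B) $F_\Omega(x,t)=f(x)\sin\Omega t$, where $f:\mathbb{T}^3\to\mathbb{R}^3$ is a divergence-free vector field with $\int_{\mathbb{T}^3}f\,dx=0$. ''Sufficiently smooth'' means: there is an absolute integer $m$ such that the result holds for all $F$ (respectively $f$) of class $C^m$. Under these hypotheses there are $\Omega_0(\nu,G)$ and a constant $C^*$ depending only on $\nu$ such that, for $\Omega\ge\Omega_0$, a time periodic solution $v_{per}$ of $( * )$ with the stated bound exists; it is a regular solution (the equation holds in $L_2(\mathbb{T}^3\times T_{per}\mathbb{S}^1)$ and the energy equality holds). A Leray–Hopf weak solution of $( * )$ with initial datum $v_0$ is a divergence-free, zero-mean $v\in L_\infty(0,T;L_2(\mathbb{T}^3))\cap L_2(0,T;H^1(\mathbb{T}^3))$ for all $T>0$, weakly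 continuous in time with values in $L_2(\mathbb{T}^3)$, with $v(0)=v_0$, satisfying the equations in the weak (distributional) sense and the strong energy inequality $$\|v(t)\|^2_{L_2}+2\nu\int_s^t\|\nabla v(\tau)\|^2_{L_2}\,d\tau\le\|v(s)\|^2_{L_2}+2\int_s^t(F_\Omega,v)\,d\tau$$ for $s=0$ and a.e. $s>0$, and all $t>s$, where $(\cdot,\cdot)$ is the $L_2(\mathbb{T}^3)$ inner product. *)

(* Defs.v *)
From HB Require Import structures.
From mathcomp Require Import all_boot all_order all_algebra.
From mathcomp Require Import all_classical all_reals all_analysis.
From mathcomp Require Import complex.

Set Implicit Arguments.
Unset Strict Implicit.
Unset Printing Implicit Defensive.
Import Order.TTheory GRing.Theory Num.Theory.
Import numFieldNormedType.Exports.
Local Open Scope classical_set_scope.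
Local Open Scope ring_scope.

(* m1 \x m2, with an inferable sigma-finite structure: the instance of the
   library is shadowed by the one for sub-probabilities. *)
Section SigmaFiniteProduct.
Context d1 d2 (T1 : measurableType d1) (T2 : measurableType d2) (R : realType).
Variable m1 : {sigma_finite_measure set T1 -> \bar R}.
Variable m2 : {sigma_finite_measure set T2 -> \bar R}.

Definition sprod : set (T1 * T2) -> \bar R := (m1 \x m2)%E.

HB.instance Definition _ := Measure.copy sprod (m1 \x m2)%E.

Let sprod_sigma_finite : sigma_finite setT sprod.
Proof.
have /sigma_finiteP[F [TF ndF Foo]] := sigma_finiteT m1.
have /sigma_finiteP[G [TG ndG Goo]] := sigma_finiteT m2.
exists (fun n => F n `*` G n).
  rewrite -setXTT TF TG predeqE => -[x y]; split.
    move=> [/= [n _ Fnx] [k _ Gky]]; exists (maxn n k) => //; split.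
    - by move: x Fnx; exact/subsetPset/ndF/leq_maxl.
    - by move: y Gky; exact/subsetPset/ndG/leq_maxr.
  by move=> [n _ []/= ? ?]; split; exists n.
move=> k; have [? ?] := Foo k; have [? ?] := Goo k.
split; first exact: measurableX.
by rewrite /sprod product_measure1E// lte_mul_pinfty// ge0_fin_numE.
Qed.

HB.instance Definition _ := Measure_isSigmaFinite.Build _ _ _ sprod
  sprod_sigma_finite.
End SigmaFiniteProduct.

(* Points of R^3.  The torus T^3 is R^3 modulo (2 pi Z)^3: a function on T^3 is
   a function on R^3 which is 2 pi-periodic in each coordinate, and integrals
   over T^3 are integrals over the cube [0, 2 pi]^3.  Space-time points are
   pairs (t, x).  A field with components indexed by I is a family
   I -> (points -> R). *)
Notation pt R := (prod (prod R R) R).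
Notation st R := (prod R (pt R)).

(* The same types, seen as measurable spaces: lebesgue_measure lives on
   measurableTypeR R, which is R with its Borel sigma-algebra. *)
Notation mpt R := (pt (measurableTypeR R)).
Notation mst R := (st (measurableTypeR R)).

Section Geometry.
Context {R : realType}.

Definition basis3 (i : 'I_3) : pt R :=
  ((i == 0 :> nat)%:R, (i == 1%N :> nat)%:R, (i == 2%N :> nat)%:R).

Definition coord3 (i : 'I_3) (x : pt R) : R :=
  match val i with 0%N => x.1.1 | 1%N => x.1.2 | _ => x.2 end.

Definition dt : st R := (1, 0).
Definition dx (i : 'I_3) : st R := (0, basis3 i).

Definition T3 : set (pt R) :=
  [set x | forall i, 0 <= coord3 i x <= 2 * pi].

Definition leb3 : {sigma_finite_measure set (mpt R) -> \bar R} :=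
  sprod (sprod (@lebesgue_measure R) (@lebesgue_measure R)) (@lebesgue_measure R).

Definition leb4 : {sigma_finite_measure set (mst R) -> \bar R} :=
  sprod (@lebesgue_measure R) leb3.

Definition periodic3 (u : pt R -> R) : Prop :=
  forall i x, u (x + (2 * pi) *: basis3 i) = u x.

Definition slice (I : Type) (u : I -> st R -> R) (t : R) : I -> pt R -> R :=
  fun i x => u i (t, x).

Definition enorm (I : finType) (a : I -> R) : R := Num.sqrt (\sum_i a i ^+ 2).

End Geometry.

Section Smoothness.
Context {R : realType} {V : normedModType R}.

(* In finite dimension, asking for the derivatives in all directions is the
   same as asking for the partial derivatives. *)
Fixpoint Ck (m : nat) (f : V -> R) : Prop :=
  continuous f /\
  if m is m'.+1 then
    forall v, (forall x, derivable f x v) /\ Ck m' (fun x => 'D_v f x)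
  else True.

Definition smooth (f : V -> R) : Prop := forall m, Ck m f.

End Smoothness.

Section TorusFields.
Context {R : realType}.
Local Notation mu1 := (@lebesgue_measure R).
Local Notation mu3 := (@leb3 R).

Definition L2sq (I : finType) (u : I -> pt R -> R) : \bar R :=
  (\int[mu3]_(x in T3) (\sum_i u i x ^+ 2)%:E)%E.

Definition L2norm (I : finType) (u : I -> pt R -> R) : \bar R :=
  (L2sq u `^ (2^-1))%E.

Definition inL2 (I : finType) (u : I -> pt R -> R) : Prop :=
  (forall i, periodic3 (u i) /\ measurable_fun [set: mpt R] (u i)) /\
  (L2sq u < +oo)%E.

Definition dotL2 (I : finType) (u w : I -> pt R -> R) : R :=
  \int[mu3]_(x in T3) (\sum_i u i x * w i x).

Definition zero_mean (u : 'I_3 -> pt R -> R) : Prop :=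
  forall i, \int[mu3]_(x in T3) u i x = 0.

Definition solenoidal (u : 'I_3 -> pt R -> R) : Prop :=
  forall psi, smooth psi -> periodic3 psi ->
  \int[mu3]_(x in T3) (\sum_i u i x * 'D_(basis3 i) psi x) = 0.

Definition weak_gradient (u : 'I_3 -> pt R -> R)
    (Du : 'I_3 * 'I_3 -> pt R -> R) : Prop :=
  forall i j psi, smooth psi -> periodic3 psi ->
  \int[mu3]_(x in T3) (u i x * 'D_(basis3 j) psi x) =
  - \int[mu3]_(x in T3) (Du (i, j) x * psi x).

Definition divergence_free (u : 'I_3 -> pt R -> R) : Prop :=
  forall x, \sum_i 'D_(basis3 i) (u i) x = 0.

Definition smooth_field (m : nat) (u : 'I_3 -> pt R -> R) : Prop :=
  forall i, periodic3 (u i) /\ Ck m (u i).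

(* sup |u| + sup |grad u|, with Euclidean norms. *)
Definition C1norm (u : 'I_3 -> pt R -> R) : \bar R :=
  (ereal_sup (range (fun x => (enorm (fun i => u i x))%:E)) +
   ereal_sup (range (fun x =>
     (enorm (fun ij : 'I_3 * 'I_3 => 'D_(basis3 ij.2) (u ij.1) x))%:E)))%E.

Definition fourier_coef (f : pt R -> R) (k : 'I_3 -> int) : complex R :=
  let phase x := \sum_i (k i)%:~R * coord3 i x in
  Complex ((2 * pi) ^- 3 * \int[mu3]_(x in T3) (f x * cos (phase x)))
          (- ((2 * pi) ^- 3 * \int[mu3]_(x in T3) (f x * sin (phase x)))).

(* Fields on T^3 x J, J a set of times. *)
Definition evolution (J : set R) (I : Type) (u : I -> st R -> R) : Prop :=
  forall i, measurable_fun (J `*` setT : set (mst R)) (u i) /\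
            forall t, J t -> periodic3 (slice u t i).

End TorusFields.

Section Forces.
Context {R : realType}.
Local Notation vfield := ('I_3 -> pt R -> R).

Definition force_A (F : vfield) (Om : R) : 'I_3 -> st R -> R :=
  fun i z => F i (z.2 + (Om * z.1) *: basis3 ord0).

Definition force_B (f : vfield) (Om : R) : 'I_3 -> st R -> R :=
  fun i z => f i z.2 * sin (Om * z.1).

(* H is a field on T^3 x R with first argument the scalar variable s. *)
Definition oscillating_primitive (F : vfield) (G : R)
    (H : 'I_3 -> st R -> R) : Prop :=
  [/\ forall s, smooth_field 1 (slice H s),
      forall s, divergence_free (slice H s),
      forall Om, 0 < Om -> forall i t x,
        is_derive t (1 : R) (fun r => Om^-1 * H i (Om * r, x))
          (force_A F Om i (t, x))
    & forall Om, 0 < Om ->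
        (ereal_sup (range (fun t : R => C1norm (slice H (Om * t)))) <= G%:E)%E].

Definition admissible_A (m : nat) (G : R) (F : vfield) : Prop :=
  [/\ smooth_field m F, divergence_free F, zero_mean F,
      forall i (k : 'I_3 -> int), k ord0 = 0 -> fourier_coef (F i) k = 0
    & exists H, oscillating_primitive F G H].

Definition admissible_B (m : nat) (G : R) (f : vfield) : Prop :=
  [/\ smooth_field m f, divergence_free f, zero_mean f
    & (C1norm f <= G%:E)%E].

(* FF is the family Om |-> F_Om. *)
Definition admissible_force (m : nat) (G : R)
    (FF : R -> 'I_3 -> st R -> R) : Prop :=
  (exists F, admissible_A m G F /\ FF = force_A F) \/
  (exists f, admissible_B m G f /\ FF = force_B f).

End Forces.

Section NavierStokes.
Context {R : realType}.
Local Notation mu1 := (@lebesgue_measure R).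
Local Notation mu3 := (@leb3 R).
Local Notation mu4 := (@leb4 R).
Local Notation stfield := ('I_3 -> st R -> R).

(* The equation in the sense of distributions on T^3 x ]0, +oo[; the pressure
   is eliminated by taking divergence-free test fields. *)
Definition weak_NS (nu : R) (F v : stfield) : Prop :=
  forall phi : stfield,
  (forall i, smooth (phi i)) ->
  (forall i t, periodic3 (slice phi t i)) ->
  (forall t, divergence_free (slice phi t)) ->
  (exists a b : R, 0 < a /\
     forall i t x, ~~ (a <= t <= b) -> phi i (t, x) = 0) ->
  \int[mu1]_(t in `]0, +oo[) \int[mu3]_(x in T3)
    (\sum_i (v i (t, x) * 'D_dt (phi i) (t, x)
       + \sum_j v j (t, x) * v i (t, x) * 'D_(dx j) (phi i) (t, x)
       + nu * v i (t, x) *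
           (\sum_j 'D_(dx j) (fun z => 'D_(dx j) (phi i) z) (t, x))
       + F i (t, x) * phi i (t, x))) = 0.

(* rel is eq for the energy equality, <= for the energy inequality. *)
Definition energy_balance (rel : \bar R -> \bar R -> Prop) (nu : R)
    (F v : stfield) (Dv : 'I_3 * 'I_3 -> st R -> R) (s t : R) : Prop :=
  rel (L2sq (slice v t) +
         (2 * nu)%:E * \int[mu1]_(r in `[s, t]) L2sq (slice Dv r))%E
      (L2sq (slice v s) +
         (2 * \int[mu1]_(r in `[s, t]) dotL2 (slice F r) (slice v r))%:E)%E.

(* Dv (i, j) is the weak derivative of v_i in x_j.  Since v is weakly continuous
   in L_2(T^3), it is given by a jointly measurable function whose time slices
   represent v(t) for every t >= 0. *)
Definition leray_hopf (nu : R) (F : stfield) (v0 : 'I_3 -> pt R -> R)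
    (v : stfield) : Prop :=
  [/\ evolution `[0, +oo[ v,
      (forall t, 0 <= t ->
         [/\ inL2 (slice v t), solenoidal (slice v t) & zero_mean (slice v t)])
      /\ (forall i, {ae mu3, forall x, v i (0, x) = v0 i x}),
      (forall g : 'I_3 -> pt R -> R, inL2 g ->
         {within `[0, +oo[, continuous (fun t => dotL2 (slice v t) g)}),
      (forall T, 0 < T -> exists M : R,
         {ae mu1, forall t, 0 < t < T -> (L2norm (slice v t) <= M%:E)%E})
    & weak_NS nu F v /\
      exists Dv : 'I_3 * 'I_3 -> st R -> R,
        [/\ evolution `[0, +oo[ Dv,
            {ae mu1, forall t, 0 < t -> weak_gradient (slice v t) (slice Dv t)},
            forall T, 0 < T ->
              (\int[mu1]_(t in `[0%R, T]) L2sq (slice Dv t) < +oo)%E,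
            forall t, 0 < t ->
              energy_balance (fun a b => (a <= b)%E) nu F v Dv 0 t
          & {ae mu1, forall s, 0 < s -> forall t, s < t ->
              energy_balance (fun a b => (a <= b)%E) nu F v Dv s t}]].

(* L_2(T^3 x T S^1), with functions extended periodically to all times. *)
Definition L2_periodic (T : R) (I : finType) (u : I -> st R -> R) : Prop :=
  [/\ evolution setT u, forall i t x, u i (t + T, x) = u i (t, x)
    & (\int[mu1]_(t in `[0%R, T]) L2sq (slice u t) < +oo)%E].

Definition test_periodic (T : R) (phi : st R -> R) : Prop :=
  [/\ smooth phi, forall t, periodic3 (fun x => phi (t, x))
    & forall t x, phi (t + T, x) = phi (t, x)].

Definition int_periodic (T : R) (f : st R -> R) : R :=
  \int[mu1]_(t in `[0, T]) \int[mu3]_(x in T3) f (t, x).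

(* g is the weak derivative of u in the space-time direction d. *)
Definition weak_deriv (T : R) (d : st R) (u g : st R -> R) : Prop :=
  forall phi, test_periodic T phi ->
  int_periodic T (fun z => u z * 'D_d phi z) =
  - int_periodic T (fun z => g z * phi z).

(* Regular T-periodic solution: every term of the equation is in
   L_2(T^3 x T S^1), with the weak derivatives vt = v_t, Dv = grad v,
   Lv = Lap v (the weak divergence of Dv) and gp = grad p.
   The field v is the representative which is continuous in time with values
   in L_2(T^3), so that v(t) makes sense for every t. *)
Definition regular_periodic_solution (nu T : R) (F v : stfield) : Prop :=
  [/\ L2_periodic T v,
      (forall t,
         [/\ inL2 (slice v t), solenoidal (slice v t) & zero_mean (slice v t)]),
      (forall s : R,
         L2norm (fun i x => v i (t, x) - v i (s, x)) @[t --> s] --> 0%E)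
    & exists (vt Lv gp : stfield) (Dv : 'I_3 * 'I_3 -> st R -> R)
             (p : st R -> R),
      [/\ L2_periodic T vt /\ (forall i, weak_deriv T dt (v i) (vt i)),
          L2_periodic T Dv /\
            (forall i j, weak_deriv T (dx j) (v i) (Dv (i, j))),
          L2_periodic T Lv /\
            (forall i phi, test_periodic T phi ->
               int_periodic T (fun z => \sum_j Dv (i, j) z * 'D_(dx j) phi z) =
               - int_periodic T (fun z => Lv i z * phi z)),
          [/\ L2_periodic T (fun _ : unit => p), L2_periodic T gp &
            forall i, weak_deriv T (dx i) p (gp i)]
        & [/\ L2_periodic T (fun i z => \sum_j v j z * Dv (i, j) z),
            forall i, {ae mu4, forall z,
              vt i z + \sum_j v j z * Dv (i, j) z - nu * Lv i z + gp i z
              = F i z}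
            & forall s t, s <= t -> energy_balance eq nu F v Dv s t]]].

(* The norm of L_oo(T^3 x T S^1); for a periodic field the essential supremum
   over a period is the one over the whole space-time. *)
Definition Linfnorm (v : stfield) : \bar R :=
  Lnorm mu4 +oo%E (fun z => (enorm (fun i => v i z))%:E).

End NavierStokes.

(* Main.v *)
Require Import Defs.
From mathcomp Require Import all_boot all_order all_algebra.
From mathcomp Require Import all_classical all_reals all_analysis.
From mathcomp Require Import measurable_realfun ess_sup_inf.
From mathcomp Require Import ring lra.
Import Order.TTheory GRing.Theory Num.Theory.
Import numFieldNormedType.Exports.
Local Open Scope classical_set_scope.
Local Open Scope ring_scope.
Set Implicit Arguments.
Unset Strict Implicit.
Unset Printing Implicit Defensive.

(** Write [U] for the periodic solution and w = v - U. Formally, subtracting the two equations and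
    testing with w gives (1/2) d/dt |w|^2 + nu |grad w|^2 = int (w . grad w) . U, where the right
    side is at most sup|U| |w| |grad w|. The fields have zero mean, so Poincaré's inequality bounds
    |w| by |grad w|. Since sup|U| is at most a constant over Omega, for Omega large the right side
    is absorbed by the viscosity and y = |w|^2 satisfies y' + c y <= 0.

    A Leray-Hopf solution cannot be tested with itself, so the inequality is obtained in integrated
    form, y t + c int_s^t y <= y s, for almost every s > 0 and all t > s. It is the sum of the
    strong energy inequality of v and the energy equality of [U], minus twice the identity for the
    increment of the pairing (v, U) ([pairing_increment]). The resulting integrand is bounded below
    by c y on almost every time slice ([energy_rate]), and [decay] deduces the convergence to 0.

    The identity for (v, U) is the technical core ([duality]). [U] has weak derivatives only, so the
    weak equation of v is tested with chi(t) times a mollification of [U], and the mollification is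
    removed by a limit. The outcome is a weak differential equation for t |-> (v(t), U(t)). This
    function is continuous, because v is weakly and [U] strongly continuous in L_2, so the equation
    can be integrated ([weak_ode]).

    The mollifier on a circle of length L has the kernel (1 + cos(2 pi (x - y)/L))^N divided by its
    integral. As 1 + cos(a - b) = 1 + cos a cos b + sin a sin b, the kernel expands into a finite
    sum of e_a(x) e_a(y) with smooth periodic e_a. A mollified function is therefore a finite
    combination of test functions, and no derivative has to pass under an integral. Translation
    invariance makes mollification commute with weak derivatives ([kfun_derive], [ker_swap]);
    positivity and unit mass make it a contraction and an approximate identity ([circle_approx],
    [approx_id_prod]). Products of such kernels serve the torus and space-time. The same tool yields
    the weak Leibniz rule ([sol3_leibniz]), the passage from space-time identities to almost every
    time slice ([slice_weak]), and Poincaré's inequality ([poincare_wderiv]), whose one-dimensional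
    form is tensorised by [variance_tensor]. *)

Section SmoothFunctions.

(** * Calculus of functions of class C^m *)

Context {R : realType}.
Implicit Types (V W : normedModType R) (m : nat).

(** The two difference quotients are the same function of h. Directional derivatives thereby inherit
    the one-variable chain rule. *)
Lemma is_derive_line V (f : V -> R) x v (d : R) :
  is_derive (0 : R) (1 : R) (fun h : R => f (h *: v + x)) d <-> is_derive x v f d.
Proof.
pose g := fun h : R => f (h *: v + x); rewrite -/g.
have E : (fun h : R => h^-1 *: ((g \o shift 0) (h *: 1) - g 0))
       = (fun h => h^-1 *: ((f \o shift x) (h *: v) - f x)).
  by apply/funext => h; rewrite /g /= addr0 scale0r add0r /GRing.scale /= mulr1.
have E1 : derivable g 0 1 = derivable f x v.
  exact: (congr1 (fun F : R -> R^o => cvg (F @ 0^')) E).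
have E2 : 'D_1 g 0 = 'D_v f x.
  exact: (congr1 (fun F : R -> R^o => lim (F @ 0^')) E).
by split => -[H1 H2]; split; rewrite -?H2 ?E1 ?E2 // -?E1.
Qed.

Lemma is_derive_ext V (g f : V -> R) x v (d : R) :
  (forall y, f y = g y) -> is_derive x v g d -> is_derive x v f d.
Proof. by move=> fg; rewrite (funext fg). Qed.

Lemma Ck_ext V m (g f : V -> R) : (forall x, f x = g x) -> Ck m g -> Ck m f.
Proof. by move=> fg; rewrite (funext fg). Qed.

Lemma CkS V m (f : V -> R) : Ck m.+1 f -> Ck m f.
Proof.
elim: m f => [|m IH] f /=; first by case.
move=> [cf H]; split=> // v; have [d c] := H v; split=> //; exact: IH.
Qed.

Lemma smoothD V (f : V -> R) v : smooth f -> smooth (fun x => 'D_v f x).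
Proof. by move=> sf m; have [_ /(_ v)[]] := sf m.+1. Qed.

Lemma smooth_derivable V (f : V -> R) x v : smooth f -> derivable f x v.
Proof. by move=> /(_ 1%N)[_ /(_ v)[]]. Qed.

Lemma smooth_continuous V (f : V -> R) : smooth f -> continuous f.
Proof. by move=> /(_ 0%N)[]. Qed.

Lemma smooth_is_derive V (f : V -> R) x v : smooth f -> is_derive x v f ('D_v f x).
Proof. by move=> sf; apply/derivableP/smooth_derivable. Qed.

Lemma Ck_cst V m (c : R) : Ck m (fun _ : V => c).
Proof.
elim: m c => [|m IH] c /=; first by split=> // x; exact: cvg_cst.
split; first by move=> x; exact: cvg_cst.
move=> v; split => [x|]; first exact: derivable_cst.
by apply: (@Ck_ext _ _ (fun=> 0)) => // x; exact: derive_cst.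
Qed.

Lemma Ck_add V m (f g : V -> R) : Ck m f -> Ck m g -> Ck m (fun x => f x + g x).
Proof.
elim: m f g => [|m IH] f g /= [cf Hf] [cg Hg].
  by split=> // x; exact: (cvgD (cf x) (cg x)).
split; first by move=> x; exact: (cvgD (cf x) (cg x)).
move=> v; have [df kf] := Hf v; have [dg kg] := Hg v; split=> [x|].
  exact: (@derivableD _ _ R^o f g).
apply: (@Ck_ext _ _ (fun x => 'D_v f x + 'D_v g x)); last exact: IH.
by move=> x; rewrite -(@deriveD _ _ R^o f g).
Qed.

Lemma Ck_mul V m (f g : V -> R) : Ck m f -> Ck m g -> Ck m (fun x => f x * g x).
Proof.
elim: m f g => [|m IH] f g /=.
  by move=> [cf _] [cg _]; split=> // x; exact: (cvgM (cf x) (cg x)).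
move=> kf kg; have kf' := CkS kf; have kg' := CkS kg.
move: kf kg => [cf Hf] [cg Hg].
split; first by move=> x; exact: (cvgM (cf x) (cg x)).
move=> v; have [df kf] := Hf v; have [dg kg] := Hg v; split=> [x|].
  exact: (@derivableM _ _ f g).
apply: (@Ck_ext _ _ (fun x => f x * 'D_v g x + g x * 'D_v f x)); last first.
  by apply: Ck_add; exact: IH.
by move=> x; rewrite -[LHS]/('D_v (f * g) x) deriveM.
Qed.

Lemma Ck_sum V m (I : Type) (r : seq I) (f : I -> V -> R) :
  (forall i, Ck m (f i)) -> Ck m (fun x => \sum_(i <- r) f i x).
Proof.
move=> kf; elim: r => [|i r IH].
  by apply: (@Ck_ext _ _ (fun=> 0)) => [x|]; [rewrite big_nil|exact: Ck_cst].
apply: (@Ck_ext _ _ (fun x => f i x + \sum_(i <- r) f i x)); last exact: Ck_add.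
by move=> x; rewrite big_cons.
Qed.

(** [M] is the linear part of [L]: the derivative of the composite along v is that of f along [M v],
    composed again with [L], so the induction goes through. *)
Lemma Ck_comp_affine V W m (f : W -> R) (L : V -> W) (M : V -> W) :
  continuous L -> (forall x h v, L (h *: v + x) = h *: M v + L x) ->
  Ck m f -> Ck m (fun x => f (L x)).
Proof.
move=> cL LE; elim: m f => [|m IH] f /=.
  by move=> [cf _]; split=> // x; exact: (cvg_comp _ _ (cL x) (cf (L x))).
move=> [cf Hf]; split; first by move=> x; exact: (cvg_comp _ _ (cL x) (cf (L x))).
move=> v; have [df kf] := Hf (M v).
have D x : is_derive x v (fun x => f (L x)) ('D_(M v) f (L x)).
  apply/is_derive_line.
  apply: (@is_derive_ext _ (fun h : R => f (h *: M v + L x))) => [h|]; first by rewrite LE.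
  exact/is_derive_line/derivableP.
split=> [x|]; first by case: (D x).
apply: (@Ck_ext _ _ (fun x => (fun y => 'D_(M v) f y) (L x))); last exact: (IH _ kf).
by move=> x; have [_ ->] := D x.
Qed.

Lemma is_derive_comp1 V (p : R -> R) (f : V -> R) x v (dp df : R) :
  is_derive (f x) (1 : R) p dp -> is_derive x v f df ->
  is_derive x v (fun x => p (f x)) (dp * df).
Proof.
move=> Hp /is_derive_line Hf; apply/is_derive_line.
have Hp' : is_derive (f (0 *: v + x)) (1 : R) p dp by rewrite scale0r add0r.
by have := @is_derive1_comp _ p (fun h : R => f (h *: v + x)) (0 : R) _ _ Hp' Hf.
Qed.

Lemma Ck_comp V m (p : R -> R) (f : V -> R) :
  Ck m p -> Ck m f -> Ck m (fun x => p (f x)).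
Proof.
elim: m p f => [|m IH] p f /=.
  by move=> [cp _] [cf _]; split=> // x; exact: (cvg_comp _ _ (cf x) (cp (f x))).
move=> kp kf; have kp' := CkS kp; have kf' := CkS kf.
move: kp kf => [cp Hp] [cf Hf]; split; first by move=> x; exact: (cvg_comp _ _ (cf x) (cp (f x))).
move=> v; have [dp kp] := Hp 1; have [df kf] := Hf v.
have D x : is_derive x v (fun x => p (f x)) ('D_1 p (f x) * 'D_v f x).
  by apply: is_derive_comp1; exact: derivableP.
split=> [x|]; first by case: (D x).
apply: (@Ck_ext _ _ (fun x => 'D_1 p (f x) * 'D_v f x)); last first.
  by apply: Ck_mul => //; exact: (IH _ _ kp kf').
by move=> x; have [_ ->] := D x.
Qed.

Lemma Ck_inv V m (f : V -> R) : (forall x, f x != 0) ->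
  Ck m f -> Ck m (fun x => (f x)^-1).
Proof.
move=> f0; elim: m f f0 => [|m IH] f f0.
  by move=> [cf _]; split=> // x; apply: (@continuousV _ _ f) => //; exact: cf.
move=> kf; have kf' := CkS kf; move: kf => /= [cf Hf].
split; first by move=> x; apply: (@continuousV _ _ f) => //; exact: cf.
move=> v; have [df kf] := Hf v.
(* The derivative is written with factors (f x)^-1 so that the induction hypothesis applies to
   it. *)
have D x : is_derive x v (fun x => (f x)^-1) (- 1 * ('D_v f x * ((f x)^-1 * (f x)^-1))).
  have Hi : is_derive (f x) (1 : R) GRing.inv (- (f x) ^- 2 *: (1 : R)).
    by apply: is_deriveV.
  have H := is_derive_comp1 Hi (derivableP (df x)).
  apply: is_derive_eq => //.
  by rewrite /GRing.scale /= mulr1 expr2 invfM; ring.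
split=> [x|]; first by case: (D x).
apply: (@Ck_ext _ _ (fun x => -1 * ('D_v f x * ((f x)^-1 * (f x)^-1)))); last first.
  apply: Ck_mul; first exact: Ck_cst.
  by apply: Ck_mul => //; apply: Ck_mul; exact: (IH _ f0 kf').
by move=> x; have [_ ->] := D x.
Qed.

Lemma Ck_idR m : Ck m (fun x : R => x).
Proof.
case: m => [|m] /=; first by split=> // x; exact: cvg_id.
split; first by move=> x; exact: cvg_id.
move=> v; split=> [x|]; first exact: derivable_id.
by apply: (@Ck_ext _ _ (fun=> v)) => [x|]; [exact: derive_id|exact: Ck_cst].
Qed.

(* If every function of a family indexed by T has its derivative in the linear
   span of the family, all its members are smooth. *)
Lemma smooth_family (T : Type) (F : T -> R -> R) :
  (forall t, continuous (F t)) ->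
  (forall t, exists a t', forall x : R, is_derive x (1 : R) (F t) (a * F t' x)) ->
  forall t, smooth (F t).
Proof.
move=> cF dF t m; elim: m t => [|m IH] t; first by split.
split=> // v; have [a [t' H]] := dF t.
have D x : is_derive x v (F t) (v * a * F t' x).
  have /is_derive_line H1 := H x; apply/is_derive_line.
  have H2 : is_derive (0 : R) (1 : R) (fun h : R => h * v) v.
    apply: (@is_derive_ext _ (v \*: id)) => [h|]; first by rewrite /= mulrC.
    by apply: is_derive_eq; rewrite /GRing.scale /= mulr1.
  have H3 : is_derive ((0 : R) * v) (1 : R) (fun h : R => F t (h *: (1 : R) + x)) (a * F t' x).
    by rewrite mul0r.
  have := @is_derive_comp1 _ _ (fun h : R => h * v) (0 : R) 1 _ _ H3 H2; rewrite mulrC mulrA.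
  by apply: is_derive_ext => h; rewrite /GRing.scale /= mulr1.
split=> [x|]; first by case: (D x).
apply: (@Ck_ext _ _ (fun x => v * a * F t' x)); last by apply: Ck_mul => //; exact: Ck_cst.
by move=> x; have [_ ->] := D x.
Qed.

End SmoothFunctions.

(** * Real-valued integrals, square-integrable functions, Cauchy-Schwarz *)

Section RealIntegral.
Context d (X : measurableType d) (R : realType) (mu : {measure set X -> \bar R}).
Implicit Types (f g h : X -> R).

Definition intble f : Prop := mu.-integrable setT (EFin \o f).

Lemma ae_imp (P Q : X -> Prop) : {ae mu, forall x, P x} -> (forall x, P x -> Q x) ->
  {ae mu, forall x, Q x}.
Proof. by move=> H PQ; apply: filterS H. Qed.

Lemma ae_imp2 (P Q S : X -> Prop) : {ae mu, forall x, P x} -> {ae mu, forall x, Q x} ->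
  (forall x, P x -> Q x -> S x) -> {ae mu, forall x, S x}.
Proof. by move=> H1 H2 PQ; apply: filterS2 H1 H2. Qed.

Definition sqint f : Prop := measurable_fun setT f /\ intble (fun x => f x ^+ 2).

Lemma intble_meas f : intble f -> measurable_fun setT f.
Proof. by move=> /(measurable_int mu)/measurable_EFinP. Qed.

Lemma intble_ext f g : f =1 g -> intble f -> intble g.
Proof. by move=> /funext ->. Qed.

Lemma sqint_ext f g : f =1 g -> sqint f -> sqint g.
Proof. by move=> /funext ->. Qed.

Lemma Rint_ext f g : f =1 g -> \int[mu]_x f x = \int[mu]_x g x.
Proof. by move=> /funext ->. Qed.

Lemma intble_ae_le f g : measurable_fun setT f ->
  {ae mu, forall x, `|f x| <= g x} -> intble g -> intble f.
Proof.
move=> mf fg ig; have mg := intble_meas ig.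
apply/integrableP; split; first exact/measurable_EFinP.
have /integrableP[_] := ig; apply: le_lt_trans.
apply: ae_ge0_le_integral => //.
- by apply: measurableT_comp => //; exact/measurable_EFinP.
- by apply: measurableT_comp => //; exact/measurable_EFinP.
apply: filterS fg => x H _ /=; rewrite lee_fin.
by apply: le_trans H _; exact: ler_norm.
Qed.

Lemma intble_le f g : measurable_fun setT f ->
  (forall x, `|f x| <= g x) -> intble g -> intble f.
Proof. by move=> mf fg; apply: intble_ae_le => //; exact: aeW. Qed.

Lemma intble0 : intble (fun=> 0).
Proof. exact: integrable0. Qed.

Lemma intble_add f g : intble f -> intble g -> intble (fun x => f x + g x).
Proof. by move=> If Ig; apply: eq_integrable (integrableD _ If Ig). Qed.

Lemma intble_scale (c : R) f : intble f -> intble (fun x => c * f x).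
Proof. by move=> If; apply: eq_integrable (integrableZl _ c If). Qed.

Lemma intble_opp f : intble f -> intble (fun x => - f x).
Proof. by move=> If; apply: eq_integrable (integrableN If). Qed.

Lemma intble_sub f g : intble f -> intble g -> intble (fun x => f x - g x).
Proof. by move=> If Ig; apply: intble_add => //; exact: intble_opp. Qed.

Lemma intble_abs f : intble f -> intble (fun x => `|f x|).
Proof. by move=> If; exact: integrable_norm. Qed.

Lemma intble_sum (I : Type) (r : seq I) (f : I -> X -> R) :
  (forall i, intble (f i)) -> intble (fun x => \sum_(i <- r) f i x).
Proof.
move=> If; elim: r => [|i r IH].
  by apply: (intble_ext (f := fun=> 0)) => [x|]; [rewrite big_nil|exact: intble0].
apply: (intble_ext (f := fun x => f i x + \sum_(i <- r) f i x)) => [x|].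
  by rewrite big_cons.
exact: intble_add.
Qed.

Lemma Rint_add f g : intble f -> intble g ->
  \int[mu]_x (f x + g x) = \int[mu]_x f x + \int[mu]_x g x.
Proof. exact: RintegralD. Qed.

Lemma Rint_sub f g : intble f -> intble g ->
  \int[mu]_x (f x - g x) = \int[mu]_x f x - \int[mu]_x g x.
Proof. exact: RintegralB. Qed.

Lemma Rint_scale (c : R) f : intble f -> \int[mu]_x (c * f x) = c * \int[mu]_x f x.
Proof. exact: RintegralZl. Qed.

Lemma Rint_opp f : intble f -> \int[mu]_x (- f x) = - \int[mu]_x f x.
Proof.
move=> If; rewrite -mulN1r -Rint_scale //; apply: Rint_ext => x.
by rewrite mulN1r.
Qed.

Lemma Rint_sum (I : Type) (r : seq I) (f : I -> X -> R) :
  (forall i, intble (f i)) ->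
  \int[mu]_x (\sum_(i <- r) f i x) = \sum_(i <- r) \int[mu]_x f i x.
Proof.
move=> If; elim: r => [|i r IH].
  rewrite big_nil; under Rint_ext do rewrite big_nil.
  by rewrite Rintegral_cst // mul0r.
by rewrite big_cons -IH -Rint_add; [apply: Rint_ext => x; rewrite big_cons| |exact: intble_sum].
Qed.

Lemma Rint_ge0 f : (forall x, 0 <= f x) -> 0 <= \int[mu]_x f x.
Proof. by move=> f0; apply: Rintegral_ge0 => x _. Qed.

Lemma Rint_ae f g : measurable_fun setT f -> measurable_fun setT g ->
  {ae mu, forall x, f x = g x} -> \int[mu]_x f x = \int[mu]_x g x.
Proof.
move=> mf mg fg; rewrite /Rintegral; congr fine.
apply: ae_eq_integral => //; [exact/measurable_EFinP|exact/measurable_EFinP|].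
by apply: filterS fg => x /= -> _.
Qed.

Lemma Rint_le_ae f g : intble f -> intble g ->
  {ae mu, forall x, f x <= g x} -> \int[mu]_x f x <= \int[mu]_x g x.
Proof.
move=> If Ig fg.
(* Replacing g by the almost everywhere equal max(f, g) turns the inequality into a pointwise
   one. *)
have -> : \int[mu]_x g x = \int[mu]_x (Num.max (f x) (g x)).
  apply: Rint_ae; first exact: intble_meas.
    by apply: measurable_maxr; exact: intble_meas.
  by apply: filterS fg => x; rewrite maxElt leNgt => /negbTE fg; case: ltgtP fg.
apply: le_Rintegral => // [|x _]; last by rewrite le_max lexx.
apply: (@intble_le _ (fun x => `|f x| + `|g x|)).
- by apply: measurable_maxr; exact: intble_meas.
- by move=> x; rewrite maxElt; case: ifP => _; rewrite ?lerDl ?lerDr.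
- by apply: intble_add; exact: intble_abs.
Qed.

Lemma Rint_le f g : intble f -> intble g -> (forall x, f x <= g x) ->
  \int[mu]_x f x <= \int[mu]_x g x.
Proof. by move=> If Ig fg; apply: Rint_le_ae => //; exact: aeW. Qed.

Lemma Rint_abs f : intble f -> `|\int[mu]_x f x| <= \int[mu]_x `|f x|.
Proof. by move=> If; exact: le_normr_Rintegral. Qed.

Lemma intble_mul_bdd f g (M : R) : intble f -> measurable_fun setT g ->
  {ae mu, forall x, `|g x| <= M} -> intble (fun x => f x * g x).
Proof.
move=> If mg gM; apply: (@intble_ae_le _ (fun x => M * `|f x|)).
- by apply: measurable_funM => //; exact: intble_meas.
- by apply: filterS gM => x H; rewrite normrM mulrC ler_wpM2r.
- by apply: intble_scale; exact: intble_abs.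
Qed.

Lemma sqint_mul f g : sqint f -> sqint g -> intble (fun x => f x * g x).
Proof.
move=> [mf If] [mg Ig]; apply: (@intble_le _ (fun x => f x ^+ 2 + g x ^+ 2)).
- exact: measurable_funM.
- move=> x; rewrite normrM -(real_normK (num_real (f x))) -(real_normK (num_real (g x))).
  have := sqr_ge0 (`|f x| - `|g x|); nra.
- exact: intble_add.
Qed.

Lemma sqint_add f g : sqint f -> sqint g -> sqint (fun x => f x + g x).
Proof.
move=> F G; split; first by apply: measurable_funD; [case: F|case: G].
apply: (intble_ext (f := fun x => (f x ^+ 2 + g x ^+ 2) + 2 * (f x * g x))).
  by move=> x; ring.
apply: intble_add; last by apply: intble_scale; exact: sqint_mul.
by apply: intble_add; [case: F|case: G].
Qed.

Lemma sqint_scale (c : R) f : sqint f -> sqint (fun x => c * f x).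
Proof.
move=> [mf If]; split; first exact: measurable_funM.
apply: (intble_ext (f := fun x => c ^+ 2 * f x ^+ 2)); last exact: intble_scale.
by move=> x; rewrite exprMn.
Qed.

Lemma sqint_sub f g : sqint f -> sqint g -> sqint (fun x => f x - g x).
Proof.
move=> F G; apply: sqint_add => //.
by apply: (sqint_ext (f := fun x => -1 * g x)) => [x|]; [rewrite mulN1r|exact: sqint_scale].
Qed.

Lemma sqint0 : sqint (fun=> 0).
Proof.
split; first exact: measurable_cst.
by apply: (intble_ext (f := fun=> 0)) => [x|]; [rewrite expr0n|exact: intble0].
Qed.

Lemma sqint_sum (I : Type) (r : seq I) (f : I -> X -> R) :
  (forall i, sqint (f i)) -> sqint (fun x => \sum_(i <- r) f i x).
Proof.
move=> If; elim: r => [|i r IH].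
  by apply: (sqint_ext (f := fun=> 0)) => [x|]; [rewrite big_nil|exact: sqint0].
apply: (sqint_ext (f := fun x => f i x + \sum_(i <- r) f i x)) => [x|].
  by rewrite big_cons.
exact: sqint_add.
Qed.

Lemma sqint_mul_bdd f g (M : R) : sqint f -> measurable_fun setT g ->
  {ae mu, forall x, `|g x| <= M} -> sqint (fun x => f x * g x).
Proof.
move=> [mf If] mg gM; split; first exact: measurable_funM.
apply: (intble_ext (f := fun x => f x ^+ 2 * g x ^+ 2)).
  by move=> x; rewrite exprMn.
apply: (@intble_mul_bdd _ _ (M ^+ 2)) => //; first exact: measurable_funX.
by apply: filterS gM => x H; rewrite normrX; apply: lerXn2r => //; rewrite nnegrE // (le_trans _ H).
Qed.

(** The integral of (f + t g)^2 is a nonnegative quadratic in t; its value at the minimiser t = - a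
    / c is the claim. *)
Lemma cauchy_schwarz f g : sqint f -> sqint g ->
  (\int[mu]_x (f x * g x)) ^+ 2 <= (\int[mu]_x (f x ^+ 2)) * (\int[mu]_x (g x ^+ 2)).
Proof.
move=> F G; set a := \int[mu]_x _; set b := \int[mu]_x _; set c := \int[mu]_x _.
have Q (t : R) : 0 <= b + 2 * t * a + t ^+ 2 * c.
  have -> : b + 2 * t * a + t ^+ 2 * c = \int[mu]_x ((f x + t * g x) ^+ 2).
    rewrite /a /b /c -!Rint_scale; [|by case: G|exact: sqint_mul].
    rewrite -Rint_add; [|by case: F|by apply: intble_scale; exact: sqint_mul].
    rewrite -Rint_add; last 2 first.
    - by apply: intble_add; [case: F|apply: intble_scale; exact: sqint_mul].
    - by apply: intble_scale; case: G.
    by apply: Rint_ext => x; ring.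
  by apply: Rint_ge0 => x; exact: sqr_ge0.
have b0 : 0 <= b by apply: Rint_ge0 => x; exact: sqr_ge0.
have c0 : 0 <= c by apply: Rint_ge0 => x; exact: sqr_ge0.
have [c1|c1] := eqVneq c 0.
  have [a1|a1] := eqVneq a 0; first by rewrite a1 c1 mulr0 expr0n.
  (* With c = 0 the quadratic is affine in t, and this t gives it the value -1. *)
  have := Q (- (b + 1) / (2 * a)).
  have -> : 2 * (- (b + 1) / (2 * a)) * a = - (b + 1) by field.
  rewrite c1; nra.
have := Q (- a / c).
have -> : b + 2 * (- a / c) * a + (- a / c) ^+ 2 * c = (b * c - a ^+ 2) / c by field.
by rewrite pmulr_lge0 ?invr_gt0 ?lt_neqAle ?c0 1?eq_sym ?c1// subr_ge0.
Qed.

End RealIntegral.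

Section FiniteIntegral.
Context d (X : measurableType d) (R : realType) (mu : {measure set X -> \bar R}).
Hypothesis mufin : (mu setT < +oo)%E.

Lemma intble_cst (c : R) : intble mu (fun=> c).
Proof.
apply: measurable_bounded_integrable => //.
exists `|c|; split; first exact: num_real.
by move=> x cx y _ /=; exact: ltW.
Qed.

Lemma intble_bdd (f : X -> R) (M : R) : measurable_fun setT f ->
  {ae mu, forall x, `|f x| <= M} -> intble mu f.
Proof.
move=> mf fM; apply: (intble_ext (f := fun x => 1 * f x)) => [x|]; first by rewrite mul1r.
exact: (intble_mul_bdd (intble_cst 1) mf fM).
Qed.

Lemma sqint_bdd (f : X -> R) (M : R) : measurable_fun setT f ->
  {ae mu, forall x, `|f x| <= M} -> sqint mu f.
Proof.
move=> mf fM; split=> //; apply: (@intble_bdd _ (M ^+ 2)); first exact: measurable_funX.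
by apply: filterS fM => x H; rewrite normrX; apply: lerXn2r => //; rewrite nnegrE // (le_trans _ H).
Qed.

Lemma sqint_intble (f : X -> R) : sqint mu f -> intble mu f.
Proof.
move=> F; apply: (intble_ext (f := fun x => f x * 1)) => [x|]; first by rewrite mulr1.
apply: sqint_mul => //; apply: (@sqint_bdd _ 1) => //.
by apply: aeW => x; rewrite normr1.
Qed.

End FiniteIntegral.

(** * Fubini's theorem and dominated convergence for real integrals *)

Section FubiniReal.
Context d1 d2 (X : measurableType d1) (Y : measurableType d2) (R : realType).
Variables (mu : {sigma_finite_measure set X -> \bar R})
          (nu : {sigma_finite_measure set Y -> \bar R}).
Implicit Types f : X * Y -> R.

Lemma intble_fub1 f : intble (sprod mu nu) f ->
  {ae mu, forall x, intble nu (fun y => f (x, y))}.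
Proof. by move=> If; have := ae_integrable1 If. Qed.

Lemma intble_fub2 f : intble (sprod mu nu) f ->
  {ae nu, forall y, intble mu (fun x => f (x, y))}.
Proof. by move=> If; have := ae_integrable2 If. Qed.

(** Almost every section is integrable, and there the extended-real inner integral is finite, so the
    real-valued one loses nothing. *)
Let ferase1 f : intble (sprod mu nu) f ->
  {ae mu, forall x, (fubini_F nu (EFin \o f)) x = (\int[nu]_y f (x, y))%:E}.
Proof.
move=> /intble_fub1; apply: filterS => x Ix.
rewrite /fubini_F /Rintegral fineK //; exact: (integrable_fin_num _ Ix).
Qed.

Let ferase2 f : intble (sprod mu nu) f ->
  {ae nu, forall y, (fubini_G mu (EFin \o f)) y = (\int[mu]_x f (x, y))%:E}.
Proof.
move=> /intble_fub2; apply: filterS => x Ix.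
rewrite /fubini_G /Rintegral fineK //; exact: (integrable_fin_num _ Ix).
Qed.

Lemma meas_fub1 f : intble (sprod mu nu) f ->
  measurable_fun setT (fun x => \int[nu]_y f (x, y)).
Proof.
move=> If; have /= mF := measurable_fubini_F If.
exact: (measurableT_comp _ mF).
Qed.

Lemma meas_fub2 f : intble (sprod mu nu) f ->
  measurable_fun setT (fun y => \int[mu]_x f (x, y)).
Proof.
move=> If; have /= mF := measurable_fubini_G If.
exact: (measurableT_comp _ mF).
Qed.

Lemma Rint_fub1 f : intble (sprod mu nu) f ->
  intble mu (fun x => \int[nu]_y f (x, y)) /\
  \int[mu]_x \int[nu]_y f (x, y) = \int[sprod mu nu]_z f z.
Proof.
move=> If; have H := ferase1 If.
have mF := measurable_fubini_F If; have mG := meas_fub1 If.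
split.
  have /integrableP[_ I1] := integrable_fubini_F If.
  apply/integrableP; split; first exact/measurable_EFinP.
  apply: le_lt_trans I1; apply: ae_ge0_le_integral => //.
  - by apply: measurableT_comp => //; exact/measurable_EFinP.
  - exact: measurableT_comp.
  - by apply: filterS H => x -> _.
rewrite /Rintegral; congr fine.
transitivity (\int[mu]_x (fubini_F nu (EFin \o f)) x)%E.
  apply: ae_eq_integral => //; first exact/measurable_EFinP.
  by apply: filterS H => x -> _.
exact: (integral12_prod_meas1 If).
Qed.

Lemma Rint_fub2 f : intble (sprod mu nu) f ->
  intble nu (fun y => \int[mu]_x f (x, y)) /\
  \int[nu]_y \int[mu]_x f (x, y) = \int[sprod mu nu]_z f z.
Proof.
move=> If; have H := ferase2 If.
have mF := measurable_fubini_G If; have mG := meas_fub2 If.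
split.
  have mf := measurable_int _ If.
  have /(integrable21ltyP mu nu mf) I1 := If.
  apply/integrableP; split; first exact/measurable_EFinP.
  apply: le_lt_trans I1; apply: ae_ge0_le_integral => //.
  - by apply: measurableT_comp => //; exact/measurable_EFinP.
  - by move=> y _; exact: integral_ge0.
  - apply: (measurable_fun_fubini_tonelli_G (abse \o (EFin \o f))) => //.
      exact: measurableT_comp.
    by move=> z; exact: abse_ge0.
  - apply: (filterS _ H) => y Hy _; rewrite [(EFin \o _) y]/= -Hy.
    by apply: le_abse_integral => //; exact: measurableT_comp.
rewrite /Rintegral; congr fine.
transitivity (\int[nu]_x (fubini_G mu (EFin \o f)) x)%E.
  apply: ae_eq_integral => //; first exact/measurable_EFinP.
  by apply: filterS H => x -> _.
exact: (integral21_prod_meas1 If).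
Qed.

End FubiniReal.
Section DominatedReal.
Context d (X : measurableType d) (R : realType) (mu : {measure set X -> \bar R}).

Lemma ae_all_nat (P : nat -> X -> Prop) :
  (forall n, {ae mu, forall x, P n x}) -> {ae mu, forall x n, P n x}.
Proof.
move=> H; apply: (@negligibleS _ _ _ mu (\bigcup_n ~` [set x | P n x])).
  by move=> x /= /existsNP[n Hn]; exists n.
exact: negligible_bigcup.
Qed.

Lemma dominated_Rint (f_ : nat -> X -> R) (f g : X -> R) :
  (forall n, measurable_fun setT (f_ n)) -> measurable_fun setT f ->
  {ae mu, forall x, f_ n x @[n --> \oo] --> f x} ->
  intble mu g -> (forall n, {ae mu, forall x, `|f_ n x| <= g x}) ->
  \int[mu]_x f_ n x @[n --> \oo] --> \int[mu]_x f x.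
Proof.
move=> mf_ mf ff ig /ae_all_nat fg.
have H1 : {ae mu, forall x, setT x -> (f_ n x)%:E @[n --> \oo] --> (f x)%:E}.
  apply: filterS ff => x Hx _; apply: cvg_EFin => //.
  exact: nearW.
have H2 : {ae mu, forall x n, setT x -> (`|(f_ n x)%:E| <= (EFin \o g) x)%E}.
  by apply: filterS fg => x Hx n _; rewrite /= lee_fin.
have [If _ H] := dominated_convergence measurableT
  (fun n => (measurable_EFinP _ _).2 (mf_ n)) ((measurable_EFinP _ _).2 mf)
  H1 ig H2.
apply: fine_cvg; apply: cvg_trans H _; rewrite /Rintegral fineK //.
exact: integrable_fin_num If.
Qed.

End DominatedReal.

Lemma cvg0_near (R : realType) (u : nat -> R) : u N @[N --> \oo] --> (0 : R) ->
  forall eps : R, 0 < eps -> \forall N \near \oo, `|u N| <= eps.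
Proof. by move=> /cvgr0Pnorm_le. Qed.

Lemma cvg_near (R : realType) (u : nat -> R) (l : R) : u N @[N --> \oo] --> l ->
  forall eps : R, 0 < eps -> \forall N \near \oo, `|u N - l| <= eps.
Proof. by move=> /cvgrPdistC_le. Qed.

Lemma near_cvg (R : realType) (u : nat -> R) (l : R) :
  (forall eps : R, 0 < eps -> \forall N \near \oo, `|u N - l| <= eps) ->
  u N @[N --> \oo] --> l.
Proof. by move=> H; apply/cvgrPdistC_le. Qed.

(** * Mollification by symmetric Markov kernels of finite rank *)

Definition kfun (R : realType) (X : Type) (I : nat -> finType)
    (e : forall N, I N -> X -> R) N x y : R := \sum_(a : I N) e N a x * e N a y.

Section ApproximateIdentity.
Context d (X : measurableType d) (R : realType).
Variable mu : {sigma_finite_measure set X -> \bar R}.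
Variables (I : nat -> finType) (e : forall N, I N -> X -> R).

(** The integral operator with kernel [kfun e N], kept as a finite combination of the modes:
    regularity, periodicity and derivatives of [Kop N g] are read off the [e a]. *)
Definition Kop N (g : X -> R) x : R :=
  \sum_(a : I N) e a x * \int[mu]_y (e a y * g y).

Definition markov_ker : Prop :=
  [/\ forall N (a : I N), measurable_fun setT (e a) /\ exists M, forall x, `|e a x| <= M,
      forall N x y, 0 <= kfun e N x y
    & forall N x, \int[mu]_y kfun e N x y = 1].

Definition approx_id : Prop := markov_ker /\
  forall g, intble mu g -> \int[mu]_x `|Kop N g x - g x| @[N --> \oo] --> 0.

Hypothesis mufin : (mu setT < +oo)%E.
Hypothesis mk : markov_ker.
Implicit Types f g h : X -> R.

Lemma ker_meas N (a : I N) : measurable_fun setT (e a).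
Proof. by have [/(_ N a)[]] := mk. Qed.

Lemma ker_bdd N (a : I N) : exists M, forall x, `|e a x| <= M.
Proof. by have [/(_ N a)[]] := mk. Qed.

Lemma intble_ker N (a : I N) g : intble mu g -> intble mu (fun y => e a y * g y).
Proof.
move=> Ig; have [M HM] := ker_bdd a.
apply: (intble_ext (f := fun y => g y * e a y)) => [y|]; first by rewrite mulrC.
by apply: (intble_mul_bdd Ig (ker_meas a)); exact: aeW HM.
Qed.

Lemma intble_kerl N (a : I N) : intble mu (e a).
Proof.
apply: (intble_ext (f := fun y => e a y * 1)) => [y|]; first by rewrite mulr1.
exact/intble_ker/intble_cst.
Qed.

Lemma Kop_meas N g : measurable_fun setT (Kop N g).
Proof.
rewrite /Kop; apply: measurable_sum => a.
by apply: measurable_funM => //; exact: ker_meas.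
Qed.

Lemma KopE N g x : intble mu g -> Kop N g x = \int[mu]_y (kfun e N x y * g y).
Proof.
move=> Ig; rewrite /Kop /kfun.
under [RHS]Rint_ext do rewrite mulr_suml.
rewrite Rint_sum => [|a]; last first.
  apply: (intble_ext (f := fun y => e a x * (e a y * g y))) => [y|]; first by rewrite mulrA.
  exact/intble_scale/intble_ker.
apply: eq_bigr => a _; rewrite -Rint_scale; last exact: intble_ker.
by apply: Rint_ext => y; rewrite mulrA.
Qed.

Lemma intble_kmul N x g : intble mu g -> intble mu (fun y => kfun e N x y * g y).
Proof.
move=> Ig; apply: (intble_ext (f := fun y => \sum_(a : I N) e a x * (e a y * g y))).
  by move=> y; rewrite /kfun mulr_suml; apply: eq_bigr => a _; rewrite mulrA.
by apply: intble_sum => a; exact/intble_scale/intble_ker.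
Qed.

Lemma Kop_bdd N g : exists M, forall x, `|Kop N g x| <= M.
Proof.
have /choice[M HM] := @ker_bdd N.
exists (\sum_(a : I N) M a * `|\int[mu]_y (e a y * g y)|) => x.
apply: le_trans (ler_norm_sum _ _ _) _; apply: ler_sum => a _.
by rewrite normrM ler_wpM2r.
Qed.

Lemma intble_Kop N g : intble mu (Kop N g).
Proof. by have [M HM] := Kop_bdd N g; apply: (intble_bdd mufin (Kop_meas N g)); exact: aeW HM. Qed.

Lemma sqint_Kop N g : sqint mu (Kop N g).
Proof. by have [M HM] := Kop_bdd N g; apply: (sqint_bdd mufin (Kop_meas N g)); exact: aeW HM. Qed.

Lemma intble_mulKop N f g : intble mu f -> intble mu (fun x => f x * Kop N g x).
Proof. by move=> If; have [M HM] := Kop_bdd N g; apply: (intble_mul_bdd If (Kop_meas N g)); exact: aeW HM. Qed.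

Lemma Kop_self N f g : intble mu f ->
  \int[mu]_x (f x * Kop N g x) = \sum_(a : I N) (\int[mu]_x (e a x * f x)) * \int[mu]_x (e a x * g x).
Proof.
move=> If; rewrite /Kop; under Rint_ext do rewrite mulr_sumr.
rewrite Rint_sum => [|a]; last first.
  apply: (intble_ext (f := fun x => (\int[mu]_y (e a y * g y)) * (e a x * f x))) => [y|].
    by rewrite mulrCA; ring.
  exact/intble_scale/intble_ker.
apply: eq_bigr => a _; rewrite [RHS]mulrC -Rint_scale; last exact: intble_ker.
by apply: Rint_ext => x; ring.
Qed.

(** Both sides are the sum over a of the products of the coefficients of f and g on [e a]. *)
Lemma Kop_sym N f g : intble mu f -> intble mu g ->
  \int[mu]_x (f x * Kop N g x) = \int[mu]_x (Kop N f x * g x).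
Proof.
move=> If Ig; rewrite Kop_self //.
under [RHS]Rint_ext do rewrite mulrC.
by rewrite Kop_self //; apply: eq_bigr => a _; rewrite mulrC.
Qed.

Lemma Kop_sub N f g x : intble mu f -> intble mu g ->
  Kop N (fun y => f y - g y) x = Kop N f x - Kop N g x.
Proof.
move=> If Ig; rewrite /Kop -sumrB; apply: eq_bigr => a _.
rewrite -mulrBr; congr (_ * _); rewrite -Rint_sub; [|exact: intble_ker..].
by apply: Rint_ext => y; rewrite mulrBr.
Qed.

Lemma Kop1 N (c : R) x : Kop N (fun=> c) x = c.
Proof.
have [_ _ k1] := mk.
rewrite KopE; last exact: intble_cst.
under Rint_ext do rewrite mulrC.
rewrite Rint_scale; last first.
  by apply: (intble_ext (f := fun y => kfun e N x y * 1)) => [y|]; [rewrite mulr1|exact/intble_kmul/intble_cst].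
by rewrite k1 mulr1.
Qed.

Lemma Kop_le N f g x : intble mu f -> intble mu g ->
  {ae mu, forall y, f y <= g y} -> Kop N f x <= Kop N g x.
Proof.
move=> If Ig fg; have [_ k0 _] := mk.
rewrite !KopE //; apply: Rint_le_ae; [exact: intble_kmul..|].
by apply: filterS fg => y H; rewrite ler_wpM2l.
Qed.

Lemma Kop_Linf N g x (M : R) : measurable_fun setT g -> {ae mu, forall y, `|g y| <= M} ->
  `|Kop N g x| <= M.
Proof.
move=> mg gM; have Ig := intble_bdd mufin mg gM.
rewrite ler_norml -{1}(Kop1 N (- M) x) -{2}(Kop1 N M x).
apply/andP; split; apply: Kop_le => //; try exact: intble_cst.
  by apply: filterS gM => y; rewrite ler_norml => /andP[].
by apply: filterS gM => y; rewrite ler_norml => /andP[].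
Qed.

Lemma Kop_abs N g x : intble mu g -> `|Kop N g x| <= Kop N (fun y => `|g y|) x.
Proof.
move=> Ig; have Ia := intble_abs Ig.
rewrite ler_norml; apply/andP; split.
  rewrite lerNl.
  have -> : - Kop N g x = Kop N (fun y => 0 - g y) x.
    by rewrite Kop_sub ?Kop1 ?sub0r //; exact: intble0.
  apply: Kop_le => //; first by apply: intble_sub => //; exact: intble0.
  by apply: aeW => y; rewrite sub0r -normrN; exact: ler_norm.
by apply: Kop_le => //; apply: aeW => y; exact: ler_norm.
Qed.

(** By symmetry the operator moves onto the constant 1, which it fixes. *)
Lemma Rint_Kop N g : intble mu g -> \int[mu]_x Kop N g x = \int[mu]_x g x.
Proof.
move=> Ig; transitivity (\int[mu]_x (1 * Kop N g x)).
  by apply: Rint_ext => x; rewrite mul1r.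
rewrite Kop_sym //; last exact: intble_cst.
by apply: Rint_ext => x; rewrite Kop1 mul1r.
Qed.

Lemma Kop_L1 N g : intble mu g -> \int[mu]_x `|Kop N g x| <= \int[mu]_x `|g x|.
Proof.
move=> Ig; rewrite -(Rint_Kop N (intble_abs Ig)); apply: Rint_le.
- exact/intble_abs/intble_Kop.
- exact: intble_Kop.
- by move=> x; exact: Kop_abs.
Qed.

(** Jensen's inequality for the probability density [kfun e N x]: expand the nonnegative mean of (g
    - m)^2, with m the mean of g. *)
Lemma Kop_jensen N g x : sqint mu g -> Kop N g x ^+ 2 <= Kop N (fun y => g y ^+ 2) x.
Proof.
move=> G; have [mg I2] := G; have Ig := sqint_intble mufin G.
have [_ k0 _] := mk.
set m := Kop N g x.
have : 0 <= Kop N (fun y => (g y - m) ^+ 2) x.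
  rewrite -(Kop1 N 0 x); apply: Kop_le; first exact: intble0.
    have := sqint_sub G (sqint_bdd mufin (f := fun=> m) (M := `|m|) (measurable_cst _) (aeW _ (fun=> lexx _))).
    by case.
  by apply: aeW => y; exact: sqr_ge0.
have -> : (fun y => (g y - m) ^+ 2) = (fun y => g y ^+ 2 - (2 * m * g y - m ^+ 2)).
  by apply/funext => y; ring.
have Im : intble mu (fun y => 2 * m * g y - m ^+ 2).
  by apply: intble_sub; [exact: intble_scale|exact: intble_cst].
rewrite Kop_sub // Kop_sub ?Kop1; [|exact: intble_scale|exact: intble_cst].
have -> : Kop N (fun y => 2 * m * g y) x = 2 * m * m.
  transitivity (2 * m * \int[mu]_y (kfun e N x y * g y)); last by rewrite -KopE.
  rewrite KopE; last exact: intble_scale.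
  by rewrite -Rint_scale; [apply: Rint_ext => y; ring|exact: intble_kmul].
lra.
Qed.

Lemma Kop_L2 N g : sqint mu g -> \int[mu]_x (Kop N g x ^+ 2) <= \int[mu]_x (g x ^+ 2).
Proof.
move=> G; rewrite -(Rint_Kop N (proj2 G)); apply: Rint_le.
- exact: (proj2 (sqint_Kop N g)).
- exact: intble_Kop.
- by move=> x; exact: Kop_jensen.
Qed.

Hypothesis ai : approx_id.

(** Symmetry moves the operator onto h, where its L_1 convergence is paired with the bounded g. *)
Lemma Kop_weak_Linf h g (M : R) : intble mu h -> measurable_fun setT g ->
  {ae mu, forall y, `|g y| <= M} ->
  \int[mu]_x (h x * Kop N g x) @[N --> \oo] --> \int[mu]_x (h x * g x).
Proof.
move=> Ih mg gM; have [_ /(_ _ Ih) cv] := ai.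
have Ig := intble_bdd mufin mg gM.
apply: near_cvg => eps e0.
have cv' : M * \int[mu]_x `|Kop N h x - h x| @[N --> \oo] --> M * 0 by exact: (cvgM (cvg_cst _) cv).
rewrite mulr0 in cv'.
have := cvg0_near cv' e0; apply: filterS => N /=.
apply: le_trans; rewrite Kop_sym //.
have mkb f : intble mu f -> intble mu (fun x => f x * g x).
  by move=> If; exact: intble_mul_bdd If mg gM.
rewrite -Rint_sub; [|apply: mkb; exact: intble_Kop|exact: mkb].
have Id : intble mu (fun x => Kop N h x - h x) by apply: intble_sub => //; exact: intble_Kop.
have IE : intble mu (fun x => Kop N h x * g x - h x * g x).
  by apply: intble_sub; apply: mkb => //; exact: intble_Kop.
apply: le_trans (Rint_abs IE) _; apply: le_trans (ler_norm _).
rewrite -Rint_scale; last exact: intble_abs.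
apply: Rint_le_ae; [exact: intble_abs|exact/intble_scale/intble_abs|].
by apply: filterS gM => x H; rewrite -mulrBl normrM mulrC ler_wpM2r.
Qed.

Let trunc h (n : nat) x := if `|h x| <= n%:R then h x else 0.

Let trunc_cvg h : sqint mu h ->
  \int[mu]_x ((h x - trunc h n x) ^+ 2) @[n --> \oo] --> 0.
Proof.
move=> [mh Ih].
have mt n : measurable_fun setT (trunc h n).
  apply: measurable_fun_ifT => //.
  by apply: measurable_fun_ler => //; exact: measurableT_comp.
rewrite [X in _ --> X](_ : 0 = \int[mu]_x 0); last by rewrite Rintegral_cst // mul0r.
apply: (dominated_Rint (g := fun x => h x ^+ 2)) => //.
- by move=> n; apply: measurable_funX; exact: measurable_funB.
- apply: aeW => x; apply: near_cvg => eps e0.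
  near=> n; rewrite /trunc.
  suff -> : `|h x| <= n%:R by rewrite subrr expr0n subrr normr0 ltW.
  near: n; exact: nbhs_infty_ger.
- move=> n; apply: aeW => x; rewrite /trunc; case: ifP => _.
    by rewrite subrr expr0n normr0 sqr_ge0.
  by rewrite subr0 ger0_norm // sqr_ge0.
Unshelve. all: by end_near.
Qed.

(** Only L_1 convergence of [Kop N g] is given, so h is truncated: the bounded part is paired with
    that convergence, and the remainder, small in L_2, is handled by Cauchy-Schwarz and the L_2
    contraction. *)
Lemma Kop_weak_L2 h g : sqint mu h -> sqint mu g ->
  \int[mu]_x (h x * Kop N g x) @[N --> \oo] --> \int[mu]_x (h x * g x).
Proof.
move=> H G; have Ig := sqint_intble mufin G.
have [_ /(_ _ Ig) cv] := ai.
have Ih := sqint_intble mufin H.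
set B := \int[mu]_x (g x ^+ 2).
have B0 : 0 <= B by apply: Rint_ge0 => x; exact: sqr_ge0.
apply: near_cvg => eps e0.
(* The squared L_2 norm of [Kop N g - g] is at most [4 * B] (below); this tolerance on the
   truncation makes the Cauchy-Schwarz product at most (eps/2)^2. The 1 avoids dividing by 0. *)
have d0 : 0 < (eps / 2) ^+ 2 / (4 * B + 1).
  by rewrite divr_gt0 ?exprn_gt0 ?divr_gt0 // ltr_wpDl // mulr_ge0.
have [n0 _ /(_ n0 (leqnn n0))] := cvg0_near (trunc_cvg H) d0.
set h1 := trunc h n0; move=> /= hn.
have mh1 : measurable_fun setT h1.
  apply: measurable_fun_ifT => //; last by case: H.
  by apply: measurable_fun_ler => //; apply: measurableT_comp => //; case: H.
have h1M : {ae mu, forall x, `|h1 x| <= n0%:R}.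
  by apply: aeW => x; rewrite /h1 /trunc; case: ifPn => //; rewrite normr0.
have S1 : sqint mu h1 by exact: sqint_bdd h1M.
have S2 : sqint mu (fun x => h x - h1 x) by exact: sqint_sub.
have cv' : n0%:R * \int[mu]_x `|Kop N g x - g x| @[N --> \oo] --> (n0%:R * 0 : R) by exact: (cvgM (cvg_cst _) cv).
rewrite mulr0 in cv'; have e2 : 0 < eps / 2 by rewrite divr_gt0.
have := cvg0_near cv' e2; apply: filterS => N /= cN.
have SK : sqint mu (fun x => Kop N g x - g x) by apply: sqint_sub => //; exact: sqint_Kop.
have -> : \int[mu]_x (h x * Kop N g x) - \int[mu]_x (h x * g x) =
  \int[mu]_x (h1 x * (Kop N g x - g x)) + \int[mu]_x ((h x - h1 x) * (Kop N g x - g x)).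
  rewrite -Rint_sub; [|exact: intble_mulKop|exact: sqint_mul].
  rewrite -Rint_add; [|exact: sqint_mul..].
  by apply: Rint_ext => x; ring.
apply: le_trans (ler_normD _ _) _; rewrite (splitr eps); apply: lerD.
  apply: le_trans cN; apply: le_trans (Rint_abs (sqint_mul S1 SK)) _.
  apply: le_trans (ler_norm _).
  have IA : intble mu (fun x => `|Kop N g x - g x|) by apply: intble_abs; exact: sqint_intble SK.
  rewrite -Rint_scale //; apply: Rint_le_ae.
  - exact/intble_abs/sqint_mul.
  - exact: intble_scale.
  - by apply: filterS h1M => x Hx; rewrite normrM ler_wpM2r.
have B4 : \int[mu]_x ((Kop N g x - g x) ^+ 2) <= 4 * B.
  have -> : 4 * B = 2 * B + 2 * B by ring.
  apply: (@le_trans _ _ (\int[mu]_x (2 * Kop N g x ^+ 2 + 2 * g x ^+ 2))).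
    apply: Rint_le; first by case: SK.
      by apply: intble_add; apply: intble_scale; [case: (sqint_Kop N g)|case: G].
    by move=> x; have := sqr_ge0 (Kop N g x + g x); nra.
  rewrite Rint_add; [|by apply: intble_scale; case: (sqint_Kop N g)|by apply: intble_scale; case: G].
  rewrite !Rint_scale; [|by case: G|by case: (sqint_Kop N g)].
  by rewrite lerD // ler_wpM2l //; exact: Kop_L2.
have CS := cauchy_schwarz S2 SK.
have e20 := ltW e2; rewrite -(@ler_pXn2r _ 2) // ?nnegrE // real_normK ?num_real //.
apply: le_trans CS _.
have T0 : 0 <= \int[mu]_x ((h x - h1 x) ^+ 2) by apply: Rint_ge0 => x; exact: sqr_ge0.
rewrite ger0_norm // in hn.
apply: (@le_trans _ _ ((eps / 2) ^+ 2 / (4 * B + 1) * (4 * B))).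
  by apply: ler_pM => //; apply: Rint_ge0 => x; exact: sqr_ge0.
rewrite -mulrA ler_piMr ?sqr_ge0 // mulrC ler_pdivrMr; first lra.
lra.
Qed.

End ApproximateIdentity.

(** * Products of approximate identities *)

Section ProductApprox.
Context d1 d2 (X : measurableType d1) (Y : measurableType d2) (R : realType).
Variables (mu : {sigma_finite_measure set X -> \bar R})
          (nu : {sigma_finite_measure set Y -> \bar R}).
Hypotheses (mufin : (mu setT < +oo)%E) (nufin : (nu setT < +oo)%E).

Lemma sprod_fin : (sprod mu nu setT < +oo)%E.
Proof.
rewrite -setXTT /sprod product_measure1E //.
by rewrite lte_mul_pinfty // ge0_fin_numE.
Qed.

Lemma intble_fst (f : X -> R) : intble mu f -> intble (sprod mu nu) (fun z => f z.1).
Proof.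
move=> If.
have mf : measurable_fun setT (EFin \o (fun z : X * Y => f z.1)).
  by apply/measurable_EFinP; apply: measurableT_comp (intble_meas If) _; exact: measurable_fst.
apply/(integrable12ltyP mu nu mf) => /=.
have [c cE] : exists c : R, nu setT = c%:E.
  by exists (fine (nu setT)); rewrite fineK // ge0_fin_numE.
rewrite (eq_integral (fun x => `|(f x)%:E| * c%:E)%E); last first.
  by move=> x _; rewrite -cE -[RHS]integral_cst.
have := integrableZl measurableT c (integrable_abse If) => /integrableP[_].
apply: le_lt_trans; apply: ge0_le_integral => //.
- by move=> x _; rewrite mule_ge0 // -cE.
- apply: emeasurable_funM => //; apply: measurableT_comp => //.
  by have /measurable_EFinP := intble_meas If.
- apply: measurableT_comp => //; apply: measurable_funeM.
  by apply: measurableT_comp => //; have /measurable_EFinP := intble_meas If.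
- by move=> x _; rewrite muleC; exact: lee_abs.
Qed.

Lemma intble_snd (f : Y -> R) : intble nu f -> intble (sprod mu nu) (fun z => f z.2).
Proof.
move=> If.
have mf : measurable_fun setT (EFin \o (fun z : X * Y => f z.2)).
  by apply/measurable_EFinP; apply: measurableT_comp (intble_meas If) _; exact: measurable_snd.
apply/(integrable21ltyP mu nu mf) => /=.
have [c cE] : exists c : R, mu setT = c%:E.
  by exists (fine (mu setT)); rewrite fineK // ge0_fin_numE.
rewrite (eq_integral (fun x => `|(f x)%:E| * c%:E)%E); last first.
  by move=> x _; rewrite -cE -[RHS]integral_cst.
have := integrableZl measurableT c (integrable_abse If) => /integrableP[_].
apply: le_lt_trans; apply: ge0_le_integral => //.
- by move=> x _; rewrite mule_ge0 // -cE.
- apply: emeasurable_funM => //; apply: measurableT_comp => //.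
  by have /measurable_EFinP := intble_meas If.
- apply: measurableT_comp => //; apply: measurable_funeM.
  by apply: measurableT_comp => //; have /measurable_EFinP := intble_meas If.
- by move=> x _; rewrite muleC; exact: lee_abs.
Qed.

Variables (I J : nat -> finType).
Variables (e : forall N, I N -> X -> R) (e' : forall N, J N -> Y -> R).
Hypotheses (ai : approx_id mu e) (aj : approx_id nu e').
Let mi := proj1 ai.
Let mj := proj1 aj.

Lemma intble_section_fst N g (b : J N) : intble (sprod mu nu) g ->
  intble (sprod mu nu) (fun z => e' b z.2 * g z).
Proof.
move=> Ig; have [M HM] := ker_bdd mj b.
apply: (intble_ext (f := fun z => g z * e' b z.2)) => [y|]; first by rewrite mulrC.
apply: (intble_mul_bdd Ig (M := M)); last exact: aeW (fun z => HM z.2).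
exact: measurableT_comp (ker_meas mj b) measurable_snd.
Qed.

Lemma intble_section_snd N g (a : I N) : intble (sprod mu nu) g ->
  intble (sprod mu nu) (fun z => e a z.1 * g z).
Proof.
move=> Ig; have [M HM] := ker_bdd mi a.
apply: (intble_ext (f := fun z => g z * e a z.1)) => [y|]; first by rewrite mulrC.
apply: (intble_mul_bdd Ig (M := M)); last exact: aeW (fun z => HM z.1).
exact: measurableT_comp (ker_meas mi a) measurable_fst.
Qed.

Lemma intble_Kop_fst N g : intble (sprod mu nu) g ->
  intble (sprod mu nu) (fun z => Kop nu e' N (fun y => g (z.1, y)) z.2).
Proof.
move=> Ig; rewrite /Kop; apply: intble_sum => b.
have [M HM] := ker_bdd mj b.
have [I1 _] := Rint_fub1 (intble_section_fst b Ig).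
apply: (intble_ext (f := fun z => (\int[nu]_y (e' b y * g (z.1, y))) * e' b z.2)).
  by move=> z; rewrite mulrC.
apply: (intble_mul_bdd (intble_fst I1) (M := M)); last exact: aeW (fun z => HM z.2).
exact: measurableT_comp (ker_meas mj b) measurable_snd.
Qed.

Lemma intble_Kop_snd N g : intble (sprod mu nu) g ->
  intble (sprod mu nu) (fun z => Kop mu e N (fun x => g (x, z.2)) z.1).
Proof.
move=> Ig; rewrite /Kop; apply: intble_sum => b.
have [M HM] := ker_bdd mi b.
have [I1 _] := Rint_fub2 (intble_section_snd b Ig).
apply: (intble_ext (f := fun z => (\int[mu]_x (e b x * g (x, z.2))) * e b z.1)).
  by move=> z; rewrite mulrC.
apply: (intble_mul_bdd (intble_snd I1) (M := M)); last exact: aeW (fun z => HM z.1).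
exact: measurableT_comp (ker_meas mi b) measurable_fst.
Qed.

(** For almost every x the inner integral tends to 0 because the section of g is integrable; the L_1
    contraction dominates it by twice the L_1 norm of the section. *)
Lemma Kop_fst_cvg g : intble (sprod mu nu) g ->
  \int[sprod mu nu]_z `|Kop nu e' N (fun y => g (z.1, y)) z.2 - g z| @[N --> \oo] --> 0.
Proof.
move=> Ig.
have ID N := intble_abs (intble_sub (intble_Kop_fst N Ig) Ig).
have H N := Rint_fub1 (ID N).
rewrite [X in X @ _ --> _](_ : _ = fun N => \int[mu]_x \int[nu]_y
   `|Kop nu e' N (fun y => g (x, y)) y - g (x, y)|); last first.
  by apply/funext => N; rewrite -(proj2 (H N)).
rewrite [X in _ --> X](_ : 0 = \int[mu]_x 0); last by rewrite Rintegral_cst // mul0r.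
have [I1 _] := Rint_fub1 (intble_abs Ig).
apply: (dominated_Rint (g := fun x => 2 * \int[nu]_y `|g (x, y)|)) => //.
- by move=> N; exact: intble_meas (proj1 (H N)).
- have [_ cv] := aj.
  by apply: filterS (intble_fub1 Ig) => x Ix; exact: cv.
- exact: intble_scale.
- move=> N; apply: filterS (intble_fub1 Ig) => x Ix.
  have IK := intble_Kop nufin mj N (fun y => g (x, y)).
  rewrite ger0_norm; last exact: Rint_ge0.
  have -> : 2 * \int[nu]_y `|g (x, y)| = \int[nu]_y `|g (x, y)| + \int[nu]_y `|g (x, y)| by ring.
  apply: (@le_trans _ _ (\int[nu]_y (`|Kop nu e' N (fun y => g (x, y)) y| + `|g (x, y)|))).
    apply: Rint_le.
    - exact/intble_abs/intble_sub.
    - by apply: intble_add; exact: intble_abs.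
    - by move=> y; exact: ler_normB.
  rewrite Rint_add; [|exact: intble_abs..].
  by rewrite lerD2r; exact: Kop_L1.
Qed.

Lemma Kop_snd_cvg g : intble (sprod mu nu) g ->
  \int[sprod mu nu]_z `|Kop mu e N (fun x => g (x, z.2)) z.1 - g z| @[N --> \oo] --> 0.
Proof.
move=> Ig.
have ID N := intble_abs (intble_sub (intble_Kop_snd N Ig) Ig).
have H N := Rint_fub2 (ID N).
rewrite [X in X @ _ --> _](_ : _ = fun N => \int[nu]_y \int[mu]_x
   `|Kop mu e N (fun x => g (x, y)) x - g (x, y)|); last first.
  by apply/funext => N; rewrite -(proj2 (H N)).
rewrite [X in _ --> X](_ : 0 = \int[nu]_x 0); last by rewrite Rintegral_cst // mul0r.
have [I1 _] := Rint_fub2 (intble_abs Ig).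
apply: (dominated_Rint (g := fun y => 2 * \int[mu]_x `|g (x, y)|)) => //.
- by move=> N; exact: intble_meas (proj1 (H N)).
- have [_ cv] := ai.
  by apply: filterS (intble_fub2 Ig) => x Ix; exact: cv.
- exact: intble_scale.
- move=> N; apply: filterS (intble_fub2 Ig) => y Iy.
  have IK := intble_Kop mufin mi N (fun x => g (x, y)).
  rewrite ger0_norm; last exact: Rint_ge0.
  have -> : 2 * \int[mu]_x `|g (x, y)| = \int[mu]_x `|g (x, y)| + \int[mu]_x `|g (x, y)| by ring.
  apply: (@le_trans _ _ (\int[mu]_x (`|Kop mu e N (fun x => g (x, y)) x| + `|g (x, y)|))).
    apply: Rint_le.
    - exact/intble_abs/intble_sub.
    - by apply: intble_add; exact: intble_abs.
    - by move=> x; exact: ler_normB.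
  rewrite Rint_add; [|exact: intble_abs..].
  by rewrite lerD2r; exact: Kop_L1.
Qed.

Definition prodker N (p : (I N * J N)%type) (z : X * Y) : R := e p.1 z.1 * e' p.2 z.2.

Lemma prodkerE N z z' :
  kfun (I := fun N => (I N * J N)%type : finType) prodker N z z' = kfun e N z.1 z'.1 * kfun e' N z.2 z'.2.
Proof.
rewrite /kfun mulr_suml -(pair_bigA _ (fun a b => e a z.1 * e' b z.2 * (e a z'.1 * e' b z'.2))) /=.
by apply: eq_bigr => a _; rewrite mulr_sumr; apply: eq_bigr => b _; ring.
Qed.

Lemma Kop_prod N g z : intble (sprod mu nu) g ->
  Kop (I := fun N => (I N * J N)%type : finType) (sprod mu nu) prodker N g z =
  Kop mu e N (fun x => Kop nu e' N (fun y => g (x, y)) z.2) z.1.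
Proof.
move=> Ig; rewrite /Kop.
rewrite -(pair_bigA _ (fun a b => e a z.1 * e' b z.2 *
  \int[sprod mu nu]_y (e a y.1 * e' b y.2 * g y))) /=.
apply: eq_bigr => a _; under [in RHS]Rint_ext do rewrite mulr_sumr.
rewrite Rint_sum => [|b]; last first.
  have [I1 _] := Rint_fub1 (intble_section_fst b Ig).
  apply: (intble_ext (f := fun x => e' b z.2 * (e a x * \int[nu]_y (e' b y * g (x, y))))).
    by move=> x; ring.
  by apply: intble_scale; apply: intble_ker.
rewrite mulr_sumr; apply: eq_bigr => b _.
have [I1 _] := Rint_fub1 (intble_section_fst b Ig).
rewrite -mulrA; congr (_ * _).
have I2 := intble_section_snd a (intble_section_fst b Ig).
have [_ E] := Rint_fub1 I2.
transitivity (e' b z.2 * \int[mu]_x (e a x * \int[nu]_y (e' b y * g (x, y)))).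
  congr (_ * _); transitivity (\int[sprod mu nu]_y (e a y.1 * (e' b y.2 * g y))).
    by apply: Rint_ext => y; rewrite mulrA.
  rewrite -E; apply: Rint_ae.
  - exact: (meas_fub1 I2).
  - by apply: measurable_funM; [exact: (ker_meas mi)|exact: (intble_meas I1)].
  - apply: filterS (intble_fub1 (intble_section_fst b Ig)) => x Ix /=.
    by rewrite -Rint_scale.
rewrite -Rint_scale; last exact: intble_ker.
by apply: Rint_ext => x; ring.
Qed.

(** Let [T] mollify in the first variable, [G] in the second and [P] in both. Then P - g = (P - T) +
    (T - g), and on almost every section P - T is the first mollifier applied to G - g; being an L_1
    contraction, it leaves the two one-variable convergences. *)
Lemma approx_id_prod :
  approx_id (I := fun N => (I N * J N)%type : finType) (sprod mu nu) prodker.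
Proof.
have pfin := sprod_fin.
have A1 N (a : I N * J N) : measurable_fun setT (prodker a) /\ exists M, forall x, `|prodker a x| <= M.
  split.
    apply: measurable_funM.
      exact: measurableT_comp (ker_meas mi a.1) measurable_fst.
    exact: measurableT_comp (ker_meas mj a.2) measurable_snd.
  have [M1 H1] := ker_bdd mi a.1; have [M2 H2] := ker_bdd mj a.2.
  by exists (M1 * M2) => z; rewrite normrM; apply: ler_pM.
split; first split=> //.
- by move=> N z z'; rewrite prodkerE; have [_ k1 _] := mi; have [_ k2 _] := mj; exact: mulr_ge0.
- move=> N z; have [_ _ k1] := mi; have [_ _ k2] := mj.
  have Ik : intble (sprod mu nu) (fun y => kfun (I := fun N => (I N * J N)%type : finType) prodker N z y).
    rewrite /kfun; apply: intble_sum => a; apply: intble_scale.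
    by have [m1 [M HM]] := A1 _ a; apply: (intble_bdd pfin m1 (M := M)); exact: aeW.
  have [_ <-] := Rint_fub1 Ik.
  rewrite -(k1 N z.1); apply: Rint_ext => x.
  rewrite -[RHS]mulr1 -(k2 N z.2) -Rint_scale; last first.
    rewrite /kfun; apply: intble_sum => b; apply: intble_scale; exact: (intble_kerl nufin mj).
  by apply: Rint_ext => y; rewrite prodkerE.
move=> g Ig.
pose T N z := Kop mu e N (fun x => g (x, z.2)) z.1.
pose G N z := Kop nu e' N (fun y => g (z.1, y)) z.2.
pose P N := Kop (I := fun N => (I N * J N)%type : finType) (sprod mu nu) prodker N g.
have IT N : intble (sprod mu nu) (T N) by exact: intble_Kop_snd.
have IG N : intble (sprod mu nu) (G N) by exact: intble_Kop_fst.
have IP N : intble (sprod mu nu) (P N).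
  rewrite /P /Kop; apply: intble_sum => a.
  apply: (intble_ext (f := fun z => (\int[sprod mu nu]_y (prodker a y * g y)) * prodker a z)).
    by move=> z; rewrite mulrC.
  apply: intble_scale; have [m1 [M HM]] := A1 _ a.
  by apply: (intble_bdd pfin m1 (M := M)); exact: aeW.
have c1 := Kop_fst_cvg Ig; have c2 := Kop_snd_cvg Ig.
apply: near_cvg => eps e0; have e2 : 0 < eps / 2 by rewrite divr_gt0.
apply: filterS2 (cvg0_near c1 e2) (cvg0_near c2 e2) => N d1' d2'.
rewrite subr0 ger0_norm; last exact: Rint_ge0.
rewrite ger0_norm in d1'; last exact: Rint_ge0.
rewrite ger0_norm in d2'; last exact: Rint_ge0.
rewrite (splitr eps); apply: le_trans (lerD d1' d2').
rewrite -/(P N) -/(T N).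
have Ia := intble_abs (intble_sub (IP N) (IT N)).
have Ib := intble_abs (intble_sub (IT N) Ig).
have Ic := intble_abs (intble_sub (IG N) Ig).
apply: (@le_trans _ _ (\int[sprod mu nu]_z (`|P N z - T N z| + `|T N z - g z|))).
  apply: Rint_le.
  - exact: intble_abs (intble_sub (IP N) Ig).
  - exact: intble_add.
  - by move=> z; apply: le_trans (ler_normD _ _); rewrite subrKA.
rewrite Rint_add //; apply: lerD => //.
have [I1 <-] := Rint_fub2 Ia; have [I2 <-] := Rint_fub2 Ic.
apply: Rint_le_ae => //.
apply: filterS2 (intble_fub2 Ig) (intble_fub2 (IG N)) => y Iy Jy.
apply: le_trans (Kop_L1 mufin mi N (intble_sub Jy Iy)).
rewrite le_eqVlt; apply/orP; left; apply/eqP; apply: Rint_ext => x.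
by rewrite (Kop_sub mi) // /P Kop_prod.
Qed.

End ProductApprox.

(** * Trigonometric functions; derivatives of translation-invariant kernels *)

Section Trigonometric.
Context {R : realType}.

Lemma smooth_trig (w : R) :
  smooth (fun x : R => cos (w * x)) /\ smooth (fun x : R => sin (w * x)).
Proof.
pose F (b : bool) (x : R) := if b then cos (w * x) else sin (w * x).
have dw (x : R) : is_derive x 1 (fun x : R => w * x) w.
  apply: (@is_derive_ext _ _ (w \*: id)) => [y|] //.
  by apply: is_derive_eq; rewrite /GRing.scale /= mulr1.
have D b (x : R) : is_derive x 1 (F b) ((if b then - w else w) * F (~~ b) x).
  case: b => /=; rewrite /F.
    have := @is_derive_comp1 _ _ cos (fun x : R => w * x) x 1 _ _ (is_derive_cos _) (dw x).
    by move/is_derive_eq; apply; ring.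
  have := @is_derive_comp1 _ _ sin (fun x : R => w * x) x 1 _ _ (is_derive_sin _) (dw x).
  by move/is_derive_eq; apply; ring.
have S b : smooth (F b).
  apply: smooth_family => {}b.
    by move=> x; apply/differentiable_continuous/derivable1_diffP; case: (D b x).
  by exists (if b then - w else w), (~~ b) => x; exact: D.
by split; [exact: (S true)|exact: (S false)].
Qed.

End Trigonometric.

Section KernelDerivative.
Context {R : realType} (V : normedModType R).
Variables (I : nat -> finType) (e : forall N, I N -> V -> R).
Hypothesis es : forall N (a : I N), smooth (e a).
Hypothesis inv : forall N (z z' w : V), kfun e N (z + w) (z' + w) = kfun e N z z'.

(* Differentiate [kfun (z + h v) (z' + h v) = kfun z z'] in h at 0. *)
Lemma kfun_derive N (z z' v : V) :
  \sum_(a : I N) 'D_v (e a) z * e a z' = - \sum_(a : I N) e a z * 'D_v (e a) z'.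
Proof.
apply/eqP; rewrite -subr_eq0 opprK -big_split /=; apply/eqP.
have D : is_derive (0 : R) (1 : R) (\sum_(i < #|I N|) (fun h : R => e (enum_val i) (h *: v + z) * e (enum_val i) (h *: v + z')))
   (\sum_(i < #|I N|) ('D_v (e (enum_val i)) z * e (enum_val i) z' + e (enum_val i) z * 'D_v (e (enum_val i)) z')).
  apply: is_derive_sum => i.
  have H y : is_derive (0 : R) (1 : R) (fun h : R => e (enum_val i) (h *: v + y)) ('D_v (e (enum_val i)) y).
    by apply/is_derive_line/smooth_is_derive.
  have := @is_deriveM _ _ (fun h : R => e (enum_val i) (h *: v + z)) (fun h : R => e (enum_val i) (h *: v + z')) 0 1 _ _ (H z) (H z').
  move/is_derive_eq; apply; rewrite !scale0r !add0r /GRing.scale /=; ring.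
rewrite (reindex (enum_val (A := I N))) /=; last first.
  by apply: onW_bij; exact: enum_val_bij.
have [_ <-] := D.
rewrite (_ : \sum_(i < #|I N|) _ = fun _ => kfun e N z z'); first exact: derive_cst.
apply/funext => h; rewrite fct_sumE -(inv N z z' (h *: v)) /kfun.
rewrite [RHS](reindex (enum_val (A := I N))) /=; last by apply: onW_bij; exact: enum_val_bij.
by apply: eq_bigr => i _; rewrite ![_ + h *: v]addrC.
Qed.

End KernelDerivative.

(** * Lebesgue measure restricted to an interval; fundamental theorem of calculus *)

Section Interval.
Context {R : realType}.

Lemma lebesgue_itvcc_fin (a b : R) : (@lebesgue_measure R `[a, b]%classic < +oo)%E.
Proof. by rewrite lebesgue_measure_itv /=; case: ifP => _; rewrite ?ltry. Qed.

(** The domain is built into the measure: integrals run over the whole line, and products of such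
    measures are again finite measures. *)
Definition mI (a b : R) : {finite_measure set (measurableTypeR R) -> \bar R} :=
  @mfrestr _ (measurableTypeR R) _ _ (@lebesgue_measure R) (measurable_itv `[a, b]) (lebesgue_itvcc_fin a b).

Lemma mIE (a b : R) A : mI a b A = @lebesgue_measure R (A `&` `[a, b]%classic).
Proof. by []. Qed.

Lemma mI_fin (a b : R) : (mI a b setT < +oo)%E.
Proof. by rewrite mIE setTI lebesgue_itvcc_fin. Qed.

End Interval.

Section RestrictedMeasure.
Context d (X : measurableType d) (R : realType).
Variables (mu nu : {measure set X -> \bar R}) (D : set X).
Hypothesis mD : measurable D.
Hypothesis nuE : forall A, measurable A -> nu A = mu (A `&` D).

Lemma restr_integral (f : X -> \bar R) : measurable_fun setT f ->
  (\int[nu]_x f x = \int[mu]_(x in D) f x)%E.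
Proof.
move=> mf; have mC := measurableC mD.
have nz : nu (~` D) = 0%E by rewrite nuE // setICl measure0.
rewrite -[X in (\int[_]_(x in X) _)%E](setUv D).
rewrite (@integral_setU _ _ _ nu) //=; last 2 first.
- by rewrite setUv; exact: mf.
- by apply/disj_setPS; rewrite setICr.
rewrite [X in (_ + X)%E]null_set_integral // ?adde0; last exact: measurable_funTS.
apply: eq_measure_integral => A mA Aab; rewrite nuE //.
by move/setIidPl : Aab => ->.
Qed.

Lemma restr_Rint (f : X -> R) : measurable_fun setT f ->
  \int[nu]_x f x = \int[mu]_(x in D) f x.
Proof. by move=> mf; rewrite /Rintegral restr_integral //; exact/measurable_EFinP. Qed.

Lemma restr_ae (P : X -> Prop) :
  {ae nu, forall x, P x} <-> {ae mu, forall x, D x -> P x}.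
Proof.
split=> -[A [mA A0 PA]].
  exists (A `&` D); split; [exact: measurableI|by rewrite -nuE|].
  by move=> x /= /not_implyP[Dx nPx]; split=> //; exact: PA.
exists (A `|` ~` D); split; first by apply: measurableU => //; exact: measurableC.
  rewrite nuE; last by apply: measurableU => //; exact: measurableC.
  rewrite setIUl setICl setU0; apply/eqP; rewrite -measure_le0 -A0.
  by apply: le_measure; rewrite ?inE //; exact: measurableI.
move=> x /= nPx; have [Dx|Dx] := pselect (D x); last by right.
by left; apply: PA => /= /(_ Dx).
Qed.

Lemma restr_intble (f : X -> R) : measurable_fun setT f ->
  intble nu f <-> mu.-integrable D (EFin \o f).
Proof.
move=> mf; split => /integrableP[_ H]; apply/integrableP; split.
- by apply/measurable_EFinP; exact: measurable_funTS.
- by rewrite -restr_integral //; apply: measurableT_comp => //; exact/measurable_EFinP.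
- exact/measurable_EFinP.
- by rewrite restr_integral //; apply: measurableT_comp => //; exact/measurable_EFinP.
Qed.

End RestrictedMeasure.
Section CalculusOnIntervals.
Context {R : realType}.
Implicit Types (a b : R) (f : R -> R).

Lemma continuous_meas f : continuous f -> measurable_fun setT (f : measurableTypeR R -> measurableTypeR R).
Proof. by move=> cf; exact: continuous_measurable_fun. Qed.

Lemma mI_ae a b : {ae mI a b, forall x, a <= x <= b}.
Proof.
apply/(restr_ae (measurable_itv `[a, b]) (nu := mI a b) (fun A _ => mIE a b A)).
by apply: aeW => x; rewrite /= in_itv.
Qed.

Lemma mI_Rint a b f : measurable_fun setT (f : measurableTypeR R -> measurableTypeR R) ->
  \int[mI a b]_x f x = \int[@lebesgue_measure R]_(x in `[a, b]) f x.
Proof. exact: (restr_Rint (measurable_itv `[a, b]) (nu := mI a b) (fun A _ => mIE a b A)). Qed.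

Lemma mI_integral a b (f : R -> \bar R) : measurable_fun setT (f : measurableTypeR R -> \bar R) ->
  (\int[mI a b]_x f x = \int[@lebesgue_measure R]_(x in `[a, b]) f x)%E.
Proof. exact: (restr_integral (measurable_itv `[a, b]) (nu := mI a b) (fun A _ => mIE a b A)). Qed.

Lemma mI_intble a b f : measurable_fun setT (f : measurableTypeR R -> measurableTypeR R) ->
  intble (mI a b) f <-> (@lebesgue_measure R).-integrable `[a, b] (EFin \o f).
Proof. exact: (restr_intble (measurable_itv `[a, b]) (nu := mI a b) (fun A _ => mIE a b A)). Qed.

Let sub_itvcc a b c d : c <= a -> b <= d -> `[a, b]%classic `<=` `[c, d]%classic.
Proof.
move=> ca bd x /=; rewrite !in_itv /= => /andP[ax xb].
by rewrite (le_trans ca ax) (le_trans xb bd).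
Qed.

Lemma intble_mI_sub a b c d f : c <= a -> b <= d ->
  intble (mI c d) f -> intble (mI a b) f.
Proof.
move=> ca bd If; have mf := intble_meas If.
apply/mI_intble => //; move: If => /mI_intble If.
by apply: integrableS (If _) => //; exact: sub_itvcc.
Qed.

Lemma Rint_mI_sub a b c d f : c <= a -> b <= d -> (forall x, 0 <= f x) ->
  intble (mI c d) f -> \int[mI a b]_x f x <= \int[mI c d]_x f x.
Proof.
move=> ca bd f0 If; have mf := intble_meas If.
have If' := intble_mI_sub ca bd If.
apply: fine_le; [exact: (integrable_fin_num _ If')|exact: (integrable_fin_num _ If)|].
rewrite !mI_integral; try exact/measurable_EFinP.
apply: ge0_subset_integral => //=; last exact: sub_itvcc.
- by apply/measurable_EFinP; exact: measurable_funTS.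
- by move=> x _; rewrite lee_fin.
Qed.

Lemma mI_size a b (c : R) : a <= b -> \int[mI a b]_x c = c * (b - a).
Proof.
move=> ab; rewrite Rintegral_cst //; congr (_ * _).
have H : mI a b setT = (b - a)%:E; last exact: (congr1 fine H).
rewrite mIE setTI lebesgue_measure_itv /= lte_fin.
by case: ltgtP ab => //= -> _; rewrite subrr.
Qed.

Lemma FTC_smooth a b f : a <= b -> smooth f ->
  \int[mI a b]_x 'D_1 f x = f b - f a.
Proof.
move=> + sf; have sD := smoothD (1 : R) sf; have mD := continuous_meas (smooth_continuous sD).
rewrite le_eqVlt => /predU1P[->|ab].
  rewrite subrr mI_Rint ?set_itv1 ?Rintegral_set1 //.
rewrite mI_Rint //.
rewrite /Rintegral (@continuous_FTC2 _ _ f) //.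
- by apply: continuous_subspaceT; exact: smooth_continuous.
- have cf := smooth_continuous sf.
  split; [by move=> x _; exact: smooth_derivable|exact/cvg_at_right_filter/cf|exact/cvg_at_left_filter/cf].
- by move=> x _; rewrite derive1E.
Qed.

End CalculusOnIntervals.

(** * The kernel on a circle of length L *)

Section CircleKernel.
Context {R : realType} (L : R).
Hypothesis L0 : 0 < L.

Let w : R := 2 * pi / L.
Let wL : w * L = 2 * pi. Proof. by rewrite /w -mulrA mulVf ?mulr1 // gt_eqF. Qed.
Let w0 : 0 < w. Proof. by rewrite /w divr_gt0 // mulr_gt0 // pi_gt0. Qed.

(** The three modes are chosen so that the sum over c of [trig_mode c x * trig_mode c y] is 1 +
    cos(2 pi (x - y) / L). *)
Definition trig_mode (c : 'I_3) (x : R) : R :=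
  match val c with 0%N => 1 | 1%N => cos (2 * pi / L * x) | _ => sin (2 * pi / L * x) end.

Definition circle_mass N : R := \int[mI 0 L]_y (1 + cos (2 * pi / L * y)) ^+ N.

(** Distributing the N-th power of the three-term sum gives one term for each map from the N factors
    to the three modes. The square root of the normalisation appears because each mode enters the
    kernel twice. *)
Definition circle_ker N (f : {ffun 'I_N -> 'I_3}) (x : R) : R :=
  Num.sqrt (circle_mass N)^-1 * \prod_(i < N) trig_mode (f i) x.

Local Notation I := (fun N => {ffun 'I_N -> 'I_3} : finType).
Local Notation k := (kfun (I := I) circle_ker).

Lemma trig_mode_smooth c : smooth (trig_mode c).
Proof.
have [sc ss] := smooth_trig w.
rewrite /trig_mode; case: (val c) => [|[|n]] //.
by move=> m; exact: Ck_cst.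
Qed.

Lemma circle_ker_smooth N (f : I N) : smooth (circle_ker f).
Proof.
move=> m; apply: Ck_mul; first exact: Ck_cst.
elim: (index_enum _) => [|i r IH].
  by apply: (@Ck_ext _ _ _ (fun=> 1)) => [x|]; [rewrite big_nil|exact: Ck_cst].
apply: (@Ck_ext _ _ _ (fun x => trig_mode (f i) x * \prod_(j <- r) trig_mode (f j) x)).
  by move=> x; rewrite big_cons.
by apply: Ck_mul => //; exact: trig_mode_smooth.
Qed.

Lemma trig_mode_periodic c x : trig_mode c (x + L) = trig_mode c x.
Proof.
rewrite /trig_mode; case: (val c) => [|[|n]] //.
  by rewrite mulrDr -/w wL mulr_natl cosD2pi.
by rewrite mulrDr -/w wL mulr_natl sinD2pi.
Qed.

Lemma circle_ker_periodic N (f : I N) x : circle_ker f (x + L) = circle_ker f x.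
Proof. by congr (_ * _); apply: eq_bigr => i _; rewrite trig_mode_periodic. Qed.

Lemma cos1_ge0 (x : R) : 0 <= 1 + cos x.
Proof. by rewrite -lerBlDl sub0r cos_geN1. Qed.

Lemma circle_mass_ge0 N : 0 <= circle_mass N.
Proof. by apply: Rint_ge0 => y; rewrite exprn_ge0 // cos1_ge0. Qed.

Lemma circle_kfunE N x y :
  k N x y = (circle_mass N)^-1 * (1 + cos (w * (x - y))) ^+ N.
Proof.
have S : Num.sqrt (circle_mass N)^-1 * Num.sqrt (circle_mass N)^-1 = (circle_mass N)^-1.
  by rewrite -expr2 sqr_sqrtr // invr_ge0 circle_mass_ge0.
rewrite /kfun; under eq_bigr do rewrite /circle_ker mulrACA S -big_split /=.
rewrite -big_distrr /=; congr (_ * _).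
rewrite -(bigA_distr_bigA (fun (i : 'I_N) c => trig_mode c x * trig_mode c y)) /=.
rewrite (eq_bigr (fun=> 1 + cos (w * (x - y)))) => [|i _].
  by rewrite prodr_const card_ord.
rewrite !big_ord_recl big_ord0 /trig_mode /= mulrBr cosB -/w; ring.
Qed.

Lemma circle_kfun_inv N (x y z : R) : k N (x + z) (y + z) = k N x y.
Proof. by rewrite !circle_kfunE; congr (_ * (1 + cos (w * _)) ^+ _); ring. Qed.

Lemma circle_power_cont N : continuous (fun x : R => (1 + cos (w * x)) ^+ N).
Proof.
apply: smooth_continuous => m; apply: (Ck_comp (p := fun y => y ^+ N)).
  elim: N => [|N IH]; first by apply: (@Ck_ext _ _ _ (fun=> 1)) => //; exact: Ck_cst.
  apply: (@Ck_ext _ _ _ (fun x : R => x * x ^+ N)) => [x|]; first by rewrite exprS.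
  by apply: Ck_mul => //; exact: Ck_idR.
by apply: Ck_add; [exact: Ck_cst|exact: (proj1 (smooth_trig w))].
Qed.

Lemma circle_power_intble a b N : intble (mI a b) (fun x : R => (1 + cos (w * x)) ^+ N).
Proof.
apply: (intble_bdd (mI_fin _ _) (M := 2 ^+ N)).
  exact: (continuous_meas (@circle_power_cont N)).
apply: aeW => x; rewrite normrX; apply: lerXn2r; rewrite ?nnegrE //.
rewrite ger0_norm ?cos1_ge0 // (_ : 2 = 1 + 1) // lerD2l; exact: cos_le1.
Qed.

(* On [0, d] the integrand is at least its value at d. *)
Lemma circle_mass_lb N d : 0 < d -> w * d <= pi ->
  d * (1 + cos (w * d)) ^+ N <= circle_mass N.
Proof.
move=> d0 dpi.
have dL : d <= L.
  rewrite -(ler_pM2l w0) wL (le_trans dpi) // ler_peMl ?pi_ge0 //; lra.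
have -> : d * (1 + cos (w * d)) ^+ N = \int[mI 0 d]_y (1 + cos (w * d)) ^+ N.
  by rewrite mI_size ?subr0 1?mulrC // ltW.
rewrite /circle_mass -/w.
apply: (@le_trans _ _ (\int[mI 0 d]_y (1 + cos (w * y)) ^+ N)).
  apply: Rint_le_ae; [exact: intble_cst (mI_fin _ _) _|exact: circle_power_intble|].
  apply: (ae_imp (mI_ae 0 d)) => x /andP[x0 xd].
  apply: lerXn2r; rewrite ?nnegrE ?cos1_ge0 // lerD2l.
  have wx : 0 <= w * x by rewrite mulr_ge0 // ltW.
  have wxd : w * x <= w * d by rewrite ler_wpM2l // ltW.
  have wx' : w * x \in `[0, pi] by rewrite in_itv /= wx (le_trans wxd).
  have wd : w * d \in `[0, pi] by rewrite in_itv /= dpi (le_trans wx wxd).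
  by rewrite leNgt ltr_cos // -leNgt.
apply: Rint_mI_sub => //; last exact: circle_power_intble.
Qed.

Lemma cos_antitone (x y : R) : 0 <= x -> x <= y -> y <= pi -> cos y <= cos x.
Proof.
move=> x0 xy yp.
have Hx : x \in `[0, pi] by rewrite in_itv /= x0 (le_trans xy yp).
have Hy : y \in `[0, pi] by rewrite in_itv /= yp (le_trans x0 xy).
by rewrite leNgt ltr_cos // -leNgt.
Qed.

Lemma circle_mass_gt0 N : 0 < circle_mass N.
Proof.
(* This length corresponds to the angle pi/4, where the cosine is positive. *)
have d0 : 0 < L / 8 by rewrite divr_gt0.
have wd : w * (L / 8) = pi / 4 by rewrite mulrA wL; field.
have pi0 := pi_gt0 R.
have H : w * (L / 8) <= pi by rewrite wd; lra.
apply: lt_le_trans (circle_mass_lb N d0 H); rewrite mulr_gt0 // exprn_gt0 // wd.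
rewrite ltr_pwDl // ltW // cos_gt0_pihalf //; apply/andP; split; lra.
Qed.

Lemma circle_ker_meas_bdd N (f : I N) :
  measurable_fun setT (circle_ker f : measurableTypeR R -> measurableTypeR R) /\
  exists M, forall x, `|circle_ker f x| <= M.
Proof.
split; first exact: (continuous_meas (smooth_continuous (circle_ker_smooth f))).
exists (Num.sqrt (circle_mass N)^-1) => x.
rewrite normrM ger0_norm ?sqrtr_ge0 // ler_piMr ?sqrtr_ge0 // normr_prod.
apply: prodr_ile1 => i _; rewrite normr_ge0 /trig_mode /=.
case: (val (f i)) => [|[|n]]; rewrite ?normr1 // ler_norml.
  by rewrite cos_geN1 cos_le1.
by rewrite sin_geN1 sin_le1.
Qed.

(* The derivative of [x |-> \int k x y dy] is [- \int d/dy (k x y) dy], which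
   vanishes by periodicity. *)
Lemma circle_kfun_int N x : \int[mI 0 L]_y k N x y = 1.
Proof.
have If (f : I N) : intble (mI 0 L) (circle_ker f).
  have [m1 [M HM]] := circle_ker_meas_bdd f.
  by apply: (intble_bdd (mI_fin _ _) m1 (M := M)); exact: aeW.
have ID (f : I N) : \int[mI 0 L]_y 'D_1 (circle_ker f) y = 0.
  rewrite FTC_smooth ?ltW //; last exact: circle_ker_smooth.
  by rewrite -{1}(add0r L) circle_ker_periodic subrr.
have IfD (f : I N) : intble (mI 0 L) (fun y => 'D_1 (circle_ker f) y).
  have cD := smooth_continuous (smoothD (1 : R) (circle_ker_smooth f)).
  apply/mI_intble; first exact: continuous_meas.
  apply: continuous_compact_integrable; first exact: segment_compact.
  exact: continuous_subspaceT.
pose A x := \sum_(f : I N) circle_ker f x * \int[mI 0 L]_y circle_ker f y.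
have AE y : \int[mI 0 L]_z k N y z = A y.
  rewrite /kfun Rint_sum => [|f]; last exact: intble_scale.
  by apply: eq_bigr => f _; rewrite Rint_scale.
have sA : smooth A.
  move=> m; apply: Ck_sum => f; apply: Ck_mul; last exact: Ck_cst.
  exact: circle_ker_smooth.
have dA y : 'D_1 A y = 0.
  have H : is_derive y 1 A (\sum_(f : I N) 'D_1 (circle_ker f) y * \int[mI 0 L]_y circle_ker f y).
    have HD (f : I N) : is_derive y 1 (fun z => circle_ker f z * \int[mI 0 L]_y circle_ker f y)
        ('D_1 (circle_ker f) y * \int[mI 0 L]_y circle_ker f y).
      have := @is_deriveM _ _ (circle_ker f) (fun=> \int[mI 0 L]_y circle_ker f y) y 1 _ _
        (smooth_is_derive y 1 (circle_ker_smooth f)) (is_derive_cst _ _ _).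
      by move/is_derive_eq; apply; rewrite scaler0 add0r /GRing.scale /= mulrC.
    apply: (@is_derive_ext _ _ (\sum_(f : I N) (fun z => circle_ker f z * \int[mI 0 L]_y circle_ker f y))).
      by move=> z; rewrite fct_sumE.
    elim/big_ind2 : _ => [|? ? ? ? ? ?|f _]; [exact: is_derive_cst|exact: is_deriveD|exact: HD].
  have [_ ->] := H.
  transitivity (\int[mI 0 L]_z \sum_(f : I N) 'D_1 (circle_ker f) y * circle_ker f z).
    rewrite Rint_sum => [|f]; last exact: intble_scale.
    by apply: eq_bigr => f _; rewrite (Rint_scale _ (If f)).
  under Rint_ext do rewrite (kfun_derive circle_ker_smooth circle_kfun_inv).
  rewrite Rint_opp; last by apply: intble_sum => f; exact: intble_scale.
  rewrite Rint_sum => [|f]; last exact: intble_scale.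
  by rewrite big1 ?oppr0 // => f _; rewrite Rint_scale // ID mulr0.
have cA : A x = A 0.
  apply: is_derive_0_is_cst => y.
  by have := smooth_is_derive y 1 sA; rewrite dA.
(* The integral being independent of x, it is computed at x = 0, where it is the mass over
   itself. *)
rewrite AE cA -AE.
have m0 := lt0r_neq0 (circle_mass_gt0 N).
under Rint_ext do rewrite circle_kfunE sub0r mulrN cosN.
by rewrite (Rint_scale _ (@circle_power_intble 0 L N)) mulVf.
Qed.

Lemma circle_markov : markov_ker (mI 0 L) (I := I) circle_ker.
Proof.
split; [exact: circle_ker_meas_bdd| |exact: circle_kfun_int].
move=> N x y; rewrite circle_kfunE; apply: mulr_ge0; first by rewrite invr_ge0 circle_mass_ge0.
by apply: exprn_ge0; exact: cos1_ge0.
Qed.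

(** At circle distance at least d the numerator is at most (1 + cos(w d))^N, while the mass is at
    least (d/2)(1 + cos(w d / 2))^N. The quotient of the two bases is the ratio q < 1. *)
Lemma circle_kfun_far (d : R) : 0 < d -> d <= L / 2 -> exists q : R, [/\ 0 <= q, q < 1 &
  forall N x y, d <= `|x - y| -> `|x - y| <= L - d -> k N x y <= 2 / d * q ^+ N].
Proof.
move=> d0 dL.
have wd0 : 0 < w * d by rewrite mulr_gt0.
have wdpi : w * d <= pi.
  have <- : w * (L / 2) = pi by rewrite mulrA wL mulrAC mulfV ?mul1r.
  by rewrite ler_pM2l.
have wd2 : w * (d / 2) = w * d / 2 by rewrite mulrA.
have pi0 := pi_gt0 R.
(* The second case is d = L exactly in angle pi; the cosine is then 0, and 1 + cos(w d / 2) stays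
   positive in both cases. *)
have c2 : 0 < cos (w * d / 2) \/ w * d / 2 = pi / 2.
  have : w * d / 2 <= pi / 2 by rewrite ler_pM2r.
  rewrite le_eqVlt => /predU1P[->|H]; first by right.
  left; apply: cos_gt0_pihalf; rewrite H andbT; lra.
have c2' : 0 < 1 + cos (w * d / 2).
  by case: c2 => [H|->]; [lra|rewrite cos_pihalf addr0].
have clt : cos (w * d) < cos (w * d / 2).
  rewrite ltr_cos ?in_itv /=; lra.
pose q := (1 + cos (w * d)) / (1 + cos (w * d / 2)).
exists q; split.
- exact: (divr_ge0 (cos1_ge0 _) (ltW c2')).
- by rewrite ltr_pdivrMr // mul1r ltrD2l.
move=> N x y dxy xyL; rewrite circle_kfunE.
have c1 : cos (w * (x - y)) <= cos (w * d).
  have -> : cos (w * (x - y)) = cos (w * `|x - y|).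
    by case: (ler0P (x - y)) => // _; rewrite mulrN cosN.
  move: dxy xyL; set z := `|x - y| => dz zL.
  have z0 : 0 <= z by rewrite normr_ge0.
  have [zp|zp] := leP (w * z) pi.
    by apply: cos_antitone => //; [exact: ltW|rewrite ler_pM2l].
  (* Beyond half a turn, go round the other way: L - z is also at least d. *)
  have -> : cos (w * z) = cos (w * (L - z)).
    by rewrite mulrBr wL addrC mulr_natl cosD2pi cosN.
  apply: cos_antitone; [exact: ltW| |].
    by rewrite ler_pM2l //; lra.
  by rewrite mulrBr wL; lra.
have mlb : d / 2 * (1 + cos (w * d / 2)) ^+ N <= circle_mass N.
  by rewrite -wd2; apply: circle_mass_lb; [rewrite divr_gt0|rewrite wd2; lra].
have m0 := circle_mass_gt0 N.
rewrite mulrC ler_pdivrMr //.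
apply: (@le_trans _ _ ((1 + cos (w * d)) ^+ N)).
  by apply: lerXn2r; rewrite ?nnegrE ?cos1_ge0 // lerD2l.
apply: (@le_trans _ _ (2 / d * q ^+ N * (d / 2 * (1 + cos (w * d / 2)) ^+ N))).
  rewrite le_eqVlt; apply/orP; left; apply/eqP.
  have -> : 1 + cos (w * d) = q * (1 + cos (w * d / 2)) by rewrite /q divfK // gt_eqF.
  rewrite exprMn; field; exact: lt0r_neq0.
apply: ler_wpM2l mlb; apply: mulr_ge0; first exact: divr_ge0 (ltW d0).
exact/exprn_ge0/(divr_ge0 (cos1_ge0 _) (ltW c2')).
Qed.

End CircleKernel.

(** * The circle kernels form an approximate identity *)

Section CircleApproximation.
Context {R : realType} (L : R).
Hypothesis L0 : 0 < L.

Local Notation I := (fun N => {ffun 'I_N -> 'I_3} : finType).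
Local Notation ck := (@circle_ker R L).
Local Notation k := (kfun (I := I) ck).
Local Notation K := (Kop (mI 0 L) (I := I) ck).

Let mk : markov_ker (mI 0 L) (I := I) ck := circle_markov L0.

Lemma continuous_bounded_itv (a b : R) (g : R -> R) : continuous g ->
  exists2 M : R, 0 <= M & forall x, a <= x <= b -> `|g x| <= M.
Proof.
move=> cg.
have /compact_bounded [M [_ HM]] : compact (g @` `[a, b]%classic).
  by apply: continuous_compact; [exact: continuous_subspaceT|exact: segment_compact].
exists (`|M| + 1); first by rewrite addr_ge0.
move=> x xab; apply: (HM (`|M| + 1)) => /=.
  by rewrite ltr_pwDr // ler_norm.
by exists x => //=; rewrite in_itv.
Qed.

Lemma continuous_intble_mI (a b : R) (g : R -> R) : continuous g -> intble (mI a b) g.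
Proof.
move=> cg; have [M M0 HM] := continuous_bounded_itv a b cg.
apply: (intble_bdd (mI_fin _ _) (continuous_meas cg) (M := M)).
by apply: (ae_imp (mI_ae a b)) => x; exact: HM.
Qed.

(** Near x the continuity of g controls the error; far from x the kernel decays geometrically. As g
    is not assumed periodic, the end points, which are one point of the circle, are excluded. *)
Lemma circle_Kop_pointwise (g : R -> R) x : continuous g -> 0 < x < L ->
  K N g x @[N --> \oo] --> g x.
Proof.
move=> cg /andP[x0 xL]; have Ig := continuous_intble_mI 0 L cg.
have [M M0 HM] := continuous_bounded_itv 0 L cg.
apply: near_cvg => eps e0; have e2 : 0 < eps / 2 by rewrite divr_gt0.
have [d1 d10 Hd1] : exists2 d1 : R, 0 < d1 & forall y, `|x - y| < d1 -> `|g y - g x| <= eps / 2.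
  have /cvgrPdistC_le /(_ _ e2) [d1 /= d10 H] := cg x.
  by exists d1 => // y; exact: H.
(* With d below x and L - x, every y in [0, L] has |x - y| <= L - d, as the far estimate
   requires. *)
pose d := Num.min d1 (Num.min x (L - x)).
have d0 : 0 < d by rewrite !lt_min d10 x0 subr_gt0.
have [dx dLx] : d <= x /\ d <= L - x.
  by split; rewrite !ge_min lexx ?orbT.
have dL2 : d <= L / 2 by rewrite ler_pdivlMr //; lra.
have [q [q0 q1 Hq]] := circle_kfun_far L0 d0 dL2.
(* Far contribution: the difference of values of g is at most 2 M, the kernel at most (2/d) q^N, and
   the length is L. *)
pose C := 2 * M * (2 / d) * L.
have C0 : 0 <= C by rewrite /C !mulr_ge0 // ?invr_ge0 ltW.
have qc : C * q ^+ N @[N --> \oo] --> (0 : R).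
  rewrite -[X in _ --> X](mulr0 C); apply: cvgM; first exact: cvg_cst.
  by apply: cvg_expr; rewrite ger0_norm.
have := cvg0_near qc e2; apply: filterS => N HN.
have Ik : intble (mI 0 L) (k N x).
  apply: (intble_ext (f := fun y : measurableTypeR R => k N x y * 1)) => [y|]; first by rewrite mulr1.
  exact: (intble_kmul mk N x (intble_cst (mI_fin 0 L) 1)).
have Ic (c : R) : intble (mI 0 L) (fun y => k N x y * c).
  by apply: (intble_ext (f := fun y : measurableTypeR R => c * k N x y)) => [y|]; [rewrite mulrC|exact: intble_scale].
have Ikg := intble_kmul mk N x Ig.
have -> : K N g x - g x = \int[mI 0 L]_y (k N x y * g y - k N x y * g x).
  rewrite Rint_sub // -(KopE mk) //; congr (_ - _).
  by rewrite -(KopE mk) ?(Kop1 (mI_fin 0 L) mk) //; exact: (intble_cst (mI_fin 0 L)).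
apply: le_trans (Rint_abs (intble_sub Ikg (Ic _))) _.
rewrite (splitr eps).
have [_ k0 k1] := mk.
have E2 : \int[mI 0 L]_y (k N x y * (eps / 2)) = eps / 2.
  under Rint_ext do rewrite mulrC.
  by rewrite Rint_scale // k1 mulr1.
apply: (@le_trans _ _ (\int[mI 0 L]_y (k N x y * (eps / 2) + 2 * M * (2 / d * q ^+ N)))).
  apply: Rint_le_ae.
  - exact/intble_abs/intble_sub.
  - by apply: intble_add => //; exact: intble_cst (mI_fin _ _) _.
  apply: (ae_imp (mI_ae 0 L)) => y yL.
  rewrite -mulrBr normrM ger0_norm //.
  have [H|H] := ltP `|x - y| d.
    apply: (@le_trans _ _ (k N x y * (eps / 2))).
      by apply: ler_wpM2l => //; apply: Hd1; apply: lt_le_trans H _; rewrite ge_min lexx.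
    rewrite lerDl; apply: mulr_ge0; first exact: mulr_ge0.
    by apply: mulr_ge0; [exact: divr_ge0 (ltW d0)|exact: exprn_ge0].
  apply: (@le_trans _ _ (2 * M * (2 / d * q ^+ N))); last first.
    by rewrite lerDr; apply: mulr_ge0 => //; exact: ltW.
  rewrite mulrC; apply: ler_pM => //.
    apply: le_trans (ler_normB _ _) _.
    have := HM y yL; have : `|g x| <= M by apply: HM; rewrite !ltW.
    by move=> *; lra.
  apply: Hq => //; case/andP: yL => y0 yL.
  by rewrite ler_norml; apply/andP; split; lra.
rewrite Rint_add //; last exact: intble_cst (mI_fin _ _) _.
rewrite E2 lerD2l (mI_size _ (ltW L0)) subr0.
move: HN; rewrite ger0_norm; last by apply: mulr_ge0 => //; exact: exprn_ge0.
apply: le_trans.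
by rewrite le_eqVlt; apply/orP; left; apply/eqP; rewrite /C; ring.
Qed.

(** Continuous functions are dense in L_1 and mollification contracts L_1. For continuous h,
    pointwise convergence in the open interval and the constant dominant M + M give the limit. *)
Lemma circle_approx : approx_id (mI 0 L) (I := I) ck.
Proof.
split=> // g Ig.
have fin := mI_fin 0 L.
have mg := intble_meas Ig.
have [h_ [ch Ih hcv]] := approximation_continuous_integrable
  (measurable_itv `[0, L]) (lebesgue_itvcc_fin 0 L) ((mI_intble 0 L mg).1 Ig).
apply: near_cvg => eps e0; have e3 : 0 < eps / 3 by rewrite divr_gt0.
have [h [ch' hd]] : exists h : R -> R, continuous h /\ \int[mI 0 L]_x `|g x - h x| <= eps / 3.
  have /fine_cvgP[_ H] := hcv.
  have [n _ /(_ n (leqnn n)) Hn] := cvg0_near H e3.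
  exists (h_ n); split=> //; apply: le_trans Hn.
  have md : measurable_fun setT ((fun x => `|g x - h_ n x|) : measurableTypeR R -> measurableTypeR R).
    apply: measurableT_comp => //; apply: measurable_funB => //.
    exact: continuous_meas.
  by rewrite (mI_Rint 0 L md); exact: ler_norm.
have Ihh := continuous_intble_mI 0 L ch'.
have cv0 : \int[mI 0 L]_x `|K N h x - h x| @[N --> \oo] --> (0 : R).
  suff : \int[mI 0 L]_x `|K N h x - h x| @[N --> \oo] --> \int[mI 0 L]_x (0 : R).
    by rewrite Rintegral_cst // mul0r.
  have [M M0 HM] := continuous_bounded_itv 0 L ch'.
  apply: (@dominated_Rint _ _ _ (mI 0 L) (fun N (x : measurableTypeR R) => `|K N h x - h x|) (fun=> 0) (fun=> M + M)).
  - move=> N; apply: measurableT_comp => //; apply: measurable_funB; first exact: Kop_meas mk _ _.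
    exact: continuous_meas.
  - exact: measurable_cst.
  (* Pointwise convergence is known only in the interior; the two end points form a null set. *)
  - have : {ae mI 0 L, forall x, 0 < x < L}.
      apply/(restr_ae (measurable_itv `[0, L]) (nu := mI 0 L) (fun A _ => mIE 0 L A)).
      exists [set 0; L]; split.
      + exact: measurableU.
      + apply/eqP; rewrite -measure_le0.
        apply: le_trans (@measureU2 _ _ _ (@lebesgue_measure R) _ _ (measurable_set1 0) (measurable_set1 L)) _.
        have z (c : R) : @lebesgue_measure R [set c] = 0%E := lebesgue_measure_set1 c.
        by rewrite -[leRHS]adde0; apply: leeD; rewrite -[leLHS]/(@lebesgue_measure R [set _]) z.
      + move=> x /= /not_implyP[]; rewrite in_itv /= !le_eqVlt => /andP[/predU1P[<-|x0] H]; first by left.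
        by case/predU1P: H => [->|xL]; [right|rewrite x0 xL].
    move=> H; apply: (ae_imp H) => x Hx.
    apply: near_cvg => e ep.
    have := cvg_near (circle_Kop_pointwise ch' Hx) ep; apply: filterS => N.
    by rewrite subr0 normr_id.
  - exact: intble_cst (mI_fin _ _) _.
  - move=> N; apply: (ae_imp (mI_ae 0 L)) => x Hx; rewrite normr_id.
    apply: le_trans (ler_normB _ _) _; apply: lerD; last exact: HM.
    apply: (Kop_Linf fin mk); first exact: continuous_meas.
    by apply: (ae_imp (mI_ae 0 L)) => y; exact: HM.
have := cvg0_near cv0 e3; apply: filterS => N.
have IK f := intble_Kop fin mk N f.
have Igh := intble_sub Ig Ihh.
rewrite subr0 !ger0_norm; [|exact: Rint_ge0..] => HN.
have I1 := intble_abs (intble_sub (IK g) (IK h)).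
have I2 := intble_abs (intble_sub (IK h) Ihh).
have I3 := intble_abs Igh.
apply: (@le_trans _ _ (\int[mI 0 L]_x (`|K N g x - K N h x| + `|K N h x - h x| + `|g x - h x|))).
  apply: Rint_le; first exact/intble_abs/intble_sub.
    by apply: intble_add => //; exact: intble_add.
  move=> x; rewrite (distrC (g x) (h x)).
  have -> : K N g x - g x = (K N g x - K N h x) + (K N h x - h x) + (h x - g x) by ring.
  by apply: le_trans (ler_normD _ _) _; rewrite lerD2r; exact: ler_normD.
rewrite Rint_add //; last exact: intble_add.
rewrite Rint_add //.
have H1 : \int[mI 0 L]_x `|K N g x - K N h x| <= eps / 3.
  apply: le_trans hd; apply: le_trans (Kop_L1 fin mk N Igh).
  by rewrite le_eqVlt; apply/orP; left; apply/eqP; apply: Rint_ext => x; rewrite (Kop_sub mk).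
lra.
Qed.

End CircleApproximation.

(** * Measure-preserving maps and translations *)

Section MeasurePreserving.
Context d1 d2 (X : measurableType d1) (Y : measurableType d2) (R : realType).
Variables (mu : {measure set X -> \bar R}) (nu : {measure set Y -> \bar R}).
Variable phi : X -> Y.
Hypothesis mphi : measurable_fun setT phi.
Hypothesis muE : forall A, measurable A -> mu (phi @^-1` A) = nu A.

Lemma mp_ae (P : Y -> Prop) : {ae nu, forall y, P y} -> {ae mu, forall x, P (phi x)}.
Proof.
move=> [A [mA A0 PA]]; exists (phi @^-1` A); split; [|by rewrite muE|by move=> x /= H; exact: PA].
by rewrite -[X in measurable X]setTI; exact: mphi.
Qed.

Lemma mp_ge0 (f : Y -> \bar R) : measurable_fun setT f -> (forall y, 0 <= f y)%E ->
  (\int[mu]_x f (phi x) = \int[nu]_y f y)%E.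
Proof.
move=> mf f0.
have H := @ge0_integral_pushforward _ _ _ _ R phi mphi mu setT f measurableT mf (fun y _ => f0 y).
rewrite preimage_setT in H; rewrite -[LHS]H.
by apply: eq_measure_integral => A mA _; rewrite -muE.
Qed.

Lemma mp_intble (f : Y -> R) : intble nu f -> intble mu (fun x => f (phi x)).
Proof.
move=> If; have mf := intble_meas If; move: If => /integrableP[_ If].
have mfp : measurable_fun setT (fun x => f (phi x)) by exact: measurableT_comp.
apply/integrableP; split; first exact/measurable_EFinP.
rewrite (mp_ge0 (f := fun y => `|(f y)%:E|%E)) //.
by apply: measurableT_comp => //; exact/measurable_EFinP.
Qed.

Lemma mp_Rint (f : Y -> R) : intble nu f -> \int[mu]_x f (phi x) = \int[nu]_y f y.
Proof.
move=> If; have mf := intble_meas If; have Ip := mp_intble If.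
have nn (g : R) : g = Num.max g 0 - Num.max (- g) 0.
  by rewrite !maxElt; case: ltgtP => // H; [rewrite oppr_lt0|rewrite oppr_lt0|]; case: ltgtP; lra.
have step d (Z : measurableType d) (m : {measure set Z -> \bar R}) (g : Z -> R) : intble m g ->
  intble m (fun z => Num.max (g z) 0) /\ intble m (fun z => Num.max (- g z) 0).
  move=> Ig; have mg := intble_meas Ig.
  split; apply: (intble_le (g := fun z => `|g z|)) (intble_abs Ig).
  - exact: measurable_maxr.
  - by move=> z; rewrite ger0_norm ?le_max ?lexx ?orbT // ge_max normr_ge0 ler_norm.
  - by apply: measurable_maxr => //; exact: (intble_meas (intble_opp Ig)).
  - by move=> z; rewrite ger0_norm ?le_max ?lexx ?orbT // ge_max normr_ge0 -normrN ler_norm.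
have key (g : Y -> R) : measurable_fun setT g -> (forall y, 0 <= g y) -> \int[mu]_x g (phi x) = \int[nu]_y g y.
  move=> mg g0; rewrite /Rintegral (mp_ge0 (f := EFin \o g)) //; exact/measurable_EFinP.
have [a1 a2] := step _ _ _ _ If; have [b1 b2] := step _ _ _ _ Ip.
rewrite (@Rint_ext _ _ _ mu (fun x => f (phi x)) (fun x => Num.max (f (phi x)) 0 - Num.max (- f (phi x)) 0)); last first.
  by move=> x; exact: nn.
rewrite (@Rint_ext _ _ _ nu f (fun y => Num.max (f y) 0 - Num.max (- f y) 0)); last first.
  by move=> y; exact: nn.
rewrite !Rint_sub //; congr (_ - _).
  by apply: (key (fun y => Num.max (f y) 0)) => [|y]; [exact: intble_meas a1|rewrite le_max lexx orbT].
by apply: (key (fun y => Num.max (- f y) 0)) => [|y]; [exact: intble_meas a2|rewrite le_max lexx orbT].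
Qed.

End MeasurePreserving.

Section Translation.
Context {R : realType}.
Implicit Types a b h : R.

Lemma lebesgue_translation h (A : set (measurableTypeR R)) : measurable A ->
  @lebesgue_measure R ((fun x => x + h) @^-1` A) = @lebesgue_measure R A.
Proof.
move=> mA.
have mp : measurable_fun setT ((fun x => x + h) : measurableTypeR R -> measurableTypeR R).
  exact: measurable_funD.
rewrite -[LHS]/(pushforward (@lebesgue_measure R) ((fun x => x + h) : measurableTypeR R -> measurableTypeR R) A).
apply/esym/lebesgue_measure_unique => //= _ [[a b]] _ <-.
rewrite /pushforward /=.
have -> : (fun x : R => x + h) @^-1` `]a, b]%classic = `]a - h, b - h]%classic.
  by apply/seteqP; split => x /=; rewrite !in_itv /= ltrBlDr lerBrDr.
by rewrite !lebesgue_measure_itv /= !lte_fin ltrD2r; case: ifP => // _; congr (_%:E); ring.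
Qed.

Lemma mI_translation a b h A : measurable A ->
  mI a b ((fun x => x + h) @^-1` A) = mI (a + h) (b + h) A.
Proof.
move=> mA; rewrite !mIE -[RHS](lebesgue_translation h); last exact: measurableI.
congr (lebesgue_measure _); rewrite preimage_setI; congr (_ `&` _).
by apply/seteqP; split => x /=; rewrite !in_itv /= !lerD2r.
Qed.

Lemma measurable_translation h :
  measurable_fun setT ((fun x => x + h) : measurableTypeR R -> measurableTypeR R).
Proof. exact: measurable_funD. Qed.

Lemma mI_shift_ae a b h (P : R -> Prop) :
  {ae mI (a + h) (b + h), forall x, P x} -> {ae mI a b, forall x, P (x + h)}.
Proof. exact: (mp_ae (measurable_translation h) (fun A mA => mI_translation a b h mA)). Qed.

Lemma mI_shift_intble a b h (f : measurableTypeR R -> R) :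
  intble (mI (a + h) (b + h)) f -> intble (mI a b) (fun x => f (x + h)).
Proof. exact: (mp_intble (measurable_translation h) (fun A mA => mI_translation a b h mA)). Qed.

Lemma mI_shift_Rint a b h (f : measurableTypeR R -> R) :
  intble (mI (a + h) (b + h)) f -> \int[mI a b]_x f (x + h) = \int[mI (a + h) (b + h)]_x f x.
Proof. exact: (mp_Rint (measurable_translation h) (fun A mA => mI_translation a b h mA)). Qed.

End Translation.

(** * Joint measurability for product sigma-algebras *)

Section CaratheodoryMeasurability.
Context {R : realType} d (Y : measurableType d).

Let rnd (n : nat) (x : R) : R := (Num.floor (n.+1%:R * x))%:~R / n.+1%:R.

Let rnd_meas n : measurable_fun setT (rnd n : measurableTypeR R -> measurableTypeR R).
Proof.
apply: nondecreasing_measurable => // x y xy; rewrite /rnd ler_pM2r ?invr_gt0 //.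
by rewrite ler_int; apply: le_floor; rewrite ler_pM2l.
Qed.

Let rnd_rat n x : exists q : rat, rnd n x = ratr q.
Proof.
exists ((Num.floor (n.+1%:R * x))%:~R / n.+1%:R).
by rewrite rmorphM /= fmorphV /= ratr_int ratr_nat.
Qed.

Let rnd_cvg x : rnd n x @[n --> \oo] --> x.
Proof.
apply: near_cvg => e e0; near=> n.
have n0 : (0 : R) < n.+1%:R by [].
have -> : rnd n x - x = ((Num.floor (n.+1%:R * x))%:~R - n.+1%:R * x) / n.+1%:R.
  by rewrite /rnd mulrBl mulrAC mulfV ?mul1r // lt0r_neq0.
rewrite normrM [X in _ * X]ger0_norm ?invr_ge0 // ler_pdivrMr //.
apply: (@le_trans _ _ 1).
  have /andP[] := floor_itv (n.+1%:R * x).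
  by rewrite ler_norml intrD => *; apply/andP; split; lra.
rewrite -ler_pdivrMl // mulr1.
apply: (@le_trans _ _ n%:R); last by rewrite ler_nat.
near: n; exact: nbhs_infty_ger.
Unshelve. all: by end_near. Qed.

(** Rounding the first variable down to a multiple of 1/(n+1) leaves countably many rational values,
    so the preimages are countable unions of measurable rectangles. Continuity in that variable
    gives the limit. Applied one variable at a time, this makes continuous functions on products
    measurable. *)
Lemma caratheodory_meas (f : R -> Y -> R) :
  (forall y, continuous (f ^~ y)) -> (forall q, measurable_fun setT (f q)) ->
  measurable_fun setT (fun z : measurableTypeR R * Y => f z.1 z.2).
Proof.
move=> cf mf.
apply: (@measurable_fun_cvg _ _ _ setT (fun n (z : measurableTypeR R * Y) => f (rnd n z.1) z.2)).
  move=> n _ A mA; rewrite setTI.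
  have -> : (fun z : measurableTypeR R * Y => f (rnd n z.1) z.2) @^-1` A =
    \bigcup_(q : rat) ((rnd n @^-1` [set ratr q]) `*` (f (ratr q) @^-1` A)).
    apply/seteqP; split => -[x y] /=.
      by move=> Az; have [q qE] := rnd_rat n x; exists q => //; split => //=; rewrite -qE.
    by move=> [q _ [/= -> ]].
  apply: bigcupT_measurable_rat => q; apply: measurableX.
    by rewrite -[X in measurable X]setTI; exact: rnd_meas.
  by rewrite -[X in measurable X]setTI; exact: mf.
move=> z _.
have cv : f (rnd n z.1) z.2 @[n --> \oo] --> f z.1 z.2.
  have cz := cf z.2.
  exact: (cvg_comp (fun n => rnd n z.1) (f ^~ z.2) (@rnd_cvg z.1) (cz z.1)).
exact: cv.
Qed.

End CaratheodoryMeasurability.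

Section ContinuousMeasurable.
Context {R : realType}.

Lemma continuous_partl (U V W : topologicalType) (f : U * V -> W) y :
  continuous f -> continuous (fun x => f (x, y)).
Proof.
move=> cf x; apply: (@continuous_comp _ _ _ (fun x => (x, y)) f); last exact: cf.
exact: (cvg_pair cvg_id (cvg_cst y)).
Qed.

Lemma continuous_partr (U V W : topologicalType) (f : U * V -> W) x :
  continuous f -> continuous (fun y => f (x, y)).
Proof.
move=> cf y; apply: (@continuous_comp _ _ _ (fun y => (x, y)) f); last exact: cf.
exact: (cvg_pair (cvg_cst x) cvg_id).
Qed.

Lemma continuous_meas2 (f : R * R -> R) : continuous f ->
  measurable_fun setT (f : measurableTypeR R * measurableTypeR R -> R).
Proof.
move=> cf; have -> : f = fun z => f (z.1, z.2) by apply/funext => -[].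
apply: (caratheodory_meas (f := fun x y => f (x, y))) => [y|q].
  exact: continuous_partl.
by apply: continuous_meas; exact: continuous_partr.
Qed.

Lemma continuous_meas3 (f : pt R -> R) : continuous f ->
  measurable_fun setT (f : mpt R -> R).
Proof.
move=> cf.
have H : measurable_fun setT (fun z : measurableTypeR R * (measurableTypeR R * measurableTypeR R) => f (z.2, z.1)).
  apply: (caratheodory_meas (f := fun x y => f (y, x))) => [y|q].
    exact: continuous_partr.
  by apply: continuous_meas2; exact: continuous_partl.
have := measurableT_comp H (@measurable_swap _ _ (measurableTypeR R * measurableTypeR R)%type (measurableTypeR R)).
by congr measurable_fun; apply/funext => -[].
Qed.

Lemma continuous_meas4 (f : st R -> R) : continuous f ->
  measurable_fun setT (f : mst R -> R).
Proof.
move=> cf; have -> : f = fun z => f (z.1, z.2) by apply/funext => -[].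
apply: (caratheodory_meas (f := fun x (y : mpt R) => f (x, y))) => [y|q].
  exact: continuous_partl.
by apply: continuous_meas3; exact: continuous_partr.
Qed.

End ContinuousMeasurable.

(** * Finite measures for the torus and for space-time windows *)

Section RestrictedProduct.
Context d1 d2 (X : measurableType d1) (Y : measurableType d2) (R : realType).
Variables (mu mu' : {sigma_finite_measure set X -> \bar R})
          (nu nu' : {sigma_finite_measure set Y -> \bar R}).
Variables (D : set X) (E : set Y).
Hypotheses (mD : measurable D) (mE : measurable E).
Hypothesis muE : forall A, measurable A -> mu' A = mu (A `&` D).
Hypothesis nuE : forall A, measurable A -> nu' A = nu (A `&` E).

Lemma sprod_restr A : measurable A ->
  sprod mu' nu' A = sprod mu nu (A `&` (D `*` E)).
Proof.
move=> mA; have mDE := measurableX mD mE.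
have H := @product_measure_unique _ _ X Y R mu' nu' (mrestr (sprod mu nu) mDE).
apply: (H _ A mA) => B C mB mC.
transitivity (sprod mu nu ((B `&` D) `*` (C `&` E))); first by rewrite setXI.
rewrite /sprod product_measure1E; try exact: measurableI.
by rewrite muE // nuE.
Qed.

End RestrictedProduct.

Section TorusMeasure.
Context {R : realType}.

(** A finite product measure carried by the cube, so that Fubini's theorem and the product kernels
    apply without a domain of integration; [m3E] identifies it with the restriction of [leb3] to
    [T3]. *)
Definition m3 : {sigma_finite_measure set (mpt R) -> \bar R} :=
  sprod (sprod (mI 0 (2 * pi)) (mI 0 (2 * pi))) (mI 0 (2 * pi)).

Definition m4 (a b : R) : {sigma_finite_measure set (mst R) -> \bar R} :=
  sprod (mI a b) m3.

Lemma m3_fin : (m3 setT < +oo)%E.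
Proof. by apply: sprod_fin; [apply: sprod_fin|]; exact: mI_fin. Qed.

Lemma m4_fin a b : (m4 a b setT < +oo)%E.
Proof. by apply: sprod_fin; [exact: mI_fin|exact: m3_fin]. Qed.

Lemma T3E : T3 = (`[0, 2 * pi]%classic `*` `[0, 2 * pi]%classic) `*` `[0, 2 * pi]%classic :> set (pt R).
Proof.
apply/seteqP; split => -[[x y] z] /=; rewrite /T3 /= !in_itv /=.
  move=> H; split; first split.
  - exact: (H ord0).
  - exact: (H (@Ordinal 3 1 isT)).
  - exact: (H (@Ordinal 3 2 isT)).
move=> [[H1 H2] H3] [[|[|[|i]]] Hi] //=.
Qed.

Lemma measurable_T3 : measurable (T3 : set (mpt R)).
Proof. by rewrite T3E; apply: measurableX => //; exact: measurableX. Qed.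

Lemma m3E (A : set (mpt R)) : measurable A -> m3 A = leb3 (A `&` T3).
Proof.
move=> mA; rewrite T3E; apply: sprod_restr => //; first exact: measurableX.
by move=> B mB; apply: sprod_restr.
Qed.

Lemma m4E a b (A : set (mst R)) : measurable A ->
  m4 a b A = leb4 (A `&` (`[a, b]%classic `*` T3)).
Proof.
exact: (@sprod_restr _ _ _ _ R (@lebesgue_measure R) (mI a b) leb3 m3 _ _
  (measurable_itv `[a, b]) measurable_T3 (fun B _ => mIE a b B) m3E).
Qed.

Lemma m3_Rint (f : pt R -> R) : measurable_fun setT (f : mpt R -> R) ->
  \int[m3]_x f x = \int[leb3]_(x in T3) f x.
Proof. exact: (restr_Rint measurable_T3 m3E). Qed.

Lemma m3_integral (f : pt R -> \bar R) : measurable_fun setT (f : mpt R -> \bar R) ->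
  (\int[m3]_x f x = \int[leb3]_(x in T3) f x)%E.
Proof. exact: (restr_integral measurable_T3 m3E). Qed.

Lemma m3_ae (P : pt R -> Prop) : {ae @leb3 R, forall x, P x} -> {ae m3, forall x, P x}.
Proof.
move=> H; apply/(restr_ae measurable_T3 m3E).
by apply: (ae_imp H) => x Px _.
Qed.

Lemma m4_ae a b (P : st R -> Prop) : {ae @leb4 R, forall x, P x} -> {ae m4 a b, forall x, P x}.
Proof.
move=> H; apply/(@restr_ae _ _ R leb4 (m4 a b) _
  (measurableX (measurable_itv `[a, b]) measurable_T3) (@m4E a b)).
by apply: (ae_imp H) => x Px _.
Qed.

Lemma m3_in : {ae m3, forall x : pt R, T3 x}.
Proof.
apply/(restr_ae measurable_T3 m3E).
exact: aeW.
Qed.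

End TorusMeasure.

(** * Smooth product kernels on the torus and in space-time *)

Section SmoothSums.
Context {R : realType} (V W : normedModType R).

Lemma smooth_cst (c : R) : smooth (fun _ : V => c).
Proof. by move=> m; exact: Ck_cst. Qed.

Lemma smooth_add (f g : V -> R) : smooth f -> smooth g -> smooth (fun z => f z + g z).
Proof. by move=> sf sg m; exact: Ck_add. Qed.

Lemma smooth_mul (f g : V -> R) : smooth f -> smooth g -> smooth (fun z => f z * g z).
Proof. by move=> sf sg m; exact: Ck_mul. Qed.

Lemma smooth_sum (J : Type) (r : seq J) (f : J -> V -> R) :
  (forall a, smooth (f a)) -> smooth (fun z => \sum_(a <- r) f a z).
Proof. by move=> sf m; apply: Ck_sum => a; exact: sf. Qed.

Lemma derive_add (f g : V -> R) v z : smooth f -> smooth g ->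
  'D_v (fun z => f z + g z) z = 'D_v f z + 'D_v g z.
Proof.
move=> sf sg.
by have [_ <-] := is_deriveD (smooth_is_derive z v sf) (smooth_is_derive z v sg).
Qed.

Lemma derive_mul (f g : V -> R) v z : smooth f -> smooth g ->
  'D_v (fun z => f z * g z) z = f z * 'D_v g z + g z * 'D_v f z.
Proof.
move=> sf sg.
by have [_ <-] := is_deriveM (smooth_is_derive z v sf) (smooth_is_derive z v sg).
Qed.

Lemma derive_sum (J : Type) (r : seq J) (f : J -> V -> R) v z : (forall a, smooth (f a)) ->
  'D_v (fun z => \sum_(a <- r) f a z) z = \sum_(a <- r) 'D_v (f a) z.
Proof.
move=> sf; elim: r => [|a r IH].
  rewrite big_nil (_ : (fun z => _) = fun=> 0); first exact: derive_cst.
  by apply/funext => y; rewrite big_nil.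
rewrite big_cons -IH -derive_add //; last exact: smooth_sum.
by congr (derive _ _ _); apply/funext => y; rewrite big_cons.
Qed.

Lemma smooth_lincomb (J : Type) (r : seq J) (f : J -> V -> R) (c : J -> R) :
  (forall a, smooth (f a)) -> smooth (fun z => \sum_(a <- r) f a z * c a).
Proof. by move=> sf; apply: smooth_sum => a; apply: smooth_mul => //; exact: smooth_cst. Qed.

Lemma derive_lincomb (J : Type) (r : seq J) (f : J -> V -> R) (c : J -> R) v z :
  (forall a, smooth (f a)) ->
  'D_v (fun z => \sum_(a <- r) f a z * c a) z = \sum_(a <- r) 'D_v (f a) z * c a.
Proof.
move=> sf; rewrite derive_sum => [|a]; last by apply: smooth_mul => //; exact: smooth_cst.
apply: eq_bigr => a _; rewrite derive_mul //; last exact: smooth_cst.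
by rewrite (derive_cst (c a)) mulr0 add0r mulrC.
Qed.

Lemma smooth_comp_affine (f : W -> R) (L M : V -> W) :
  continuous L -> (forall x h v, L (h *: v + x) = h *: M v + L x) ->
  smooth f -> smooth (fun x => f (L x)).
Proof. by move=> cL LE sf m; exact: (Ck_comp_affine cL LE (sf m)). Qed.

Lemma derive_comp_affine (f : W -> R) (L M : V -> W) v x :
  (forall x h v, L (h *: v + x) = h *: M v + L x) -> smooth f ->
  'D_v (fun x => f (L x)) x = 'D_(M v) f (L x).
Proof.
move=> LE sf; suff : is_derive x v (fun x => f (L x)) ('D_(M v) f (L x)) by case.
apply/is_derive_line.
apply: (@is_derive_ext _ _ (fun h : R => f (h *: M v + L x))) => [h|]; first by rewrite LE.
exact/is_derive_line/smooth_is_derive.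
Qed.

End SmoothSums.

Section KernelSwap.
Context {R : realType} (V : normedModType R) d (X : measurableType d).
Variable mu : {measure set X -> \bar R}.
(* Only used with [phi] the identity, between two structures on the same type. *)
Variable phi : X -> V.
Variables (I : nat -> finType) (e : forall N, I N -> V -> R).
Hypothesis es : forall N (a : I N), smooth (e a).
Hypothesis inv : forall N (z z' w : V), kfun e N (z + w) (z' + w) = kfun e N z z'.

(** By [kfun_derive] the derivative of the kernel in the outer variable is minus that in the
    integration variable. This moves a derivative of a mollified function onto the test functions
    [e a]. *)
Lemma ker_swap N v z (g : X -> R) :
  (forall a : I N, intble mu (fun x => e a (phi x) * g x)) ->
  (forall a : I N, intble mu (fun x => 'D_v (e a) (phi x) * g x)) ->
  \sum_(a : I N) 'D_v (e a) z * \int[mu]_x (e a (phi x) * g x) =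
  - \sum_(a : I N) e a z * \int[mu]_x ('D_v (e a) (phi x) * g x).
Proof.
move=> I1 I2.
transitivity (\int[mu]_x (\sum_(a : I N) 'D_v (e a) z * (e a (phi x) * g x))).
  rewrite Rint_sum => [|a]; last exact: intble_scale.
  by apply: eq_bigr => a _; rewrite Rint_scale.
transitivity (\int[mu]_x (- \sum_(a : I N) e a z * ('D_v (e a) (phi x) * g x))).
  apply: Rint_ext => x; under eq_bigr do rewrite mulrA.
  rewrite -mulr_suml (kfun_derive es inv) mulNr mulr_suml.
  by congr (- _); apply: eq_bigr => a _; rewrite mulrA.
rewrite Rint_opp; last by apply: intble_sum => a; exact: intble_scale.
rewrite Rint_sum => [|a]; last exact: intble_scale.
by congr (- _); apply: eq_bigr => a _; rewrite Rint_scale.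
Qed.

End KernelSwap.

Section TorusKernels.
Context {R : realType}.

Local Notation I1 := (fun N => {ffun 'I_N -> 'I_3} : finType).
Definition I2 := (fun N => (I1 N * I1 N)%type : finType).
Definition I3 := (fun N => (I2 N * I1 N)%type : finType).
Definition I4 := (fun N => (I1 N * I3 N)%type : finType).

Local Notation ck := (@circle_ker R).
Local Notation tpi := (2 * pi : R).

Definition e2 : forall N, I2 N -> measurableTypeR R * measurableTypeR R -> R :=
  prodker (I := I1) (J := I1) (ck tpi) (ck tpi).
Definition e3 : forall N, I3 N -> mpt R -> R := prodker (I := I2) (J := I1) e2 (ck tpi).
Definition e4 (T : R) : forall N, I4 N -> mst R -> R := prodker (I := I1) (J := I3) (ck T) e3.

Let tpi0 : 0 < tpi. Proof. by rewrite mulr_gt0 // pi_gt0. Qed.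

Lemma e3_approx : approx_id m3 e3.
Proof.
have fin := mI_fin 0 tpi.
apply: (approx_id_prod (I := I2) (J := I1) (e := e2) (e' := ck tpi) (sprod_fin fin fin) fin).
  exact: (approx_id_prod (I := I1) (J := I1) fin fin (circle_approx tpi0) (circle_approx tpi0)).
exact: circle_approx.
Qed.

Lemma e4_approx T : 0 < T -> approx_id (m4 0 T) (e4 T).
Proof.
move=> T0.
exact: (approx_id_prod (I := I1) (J := I3) (mI_fin 0 T) m3_fin (circle_approx T0) e3_approx).
Qed.

Lemma e3_smooth N (a : I3 N) : smooth (e3 a : pt R -> R).
Proof.
move: a => [[a b] c]; rewrite /e3 /prodker /e2 /prodker /=.
have s := @circle_ker_smooth R tpi N.
apply: smooth_mul; last first.
  by apply: (@smooth_comp_affine _ _ _ (ck tpi c) snd snd) => // z; exact: cvg_snd.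
apply: smooth_mul.
  apply: (@smooth_comp_affine _ _ _ (ck tpi a) (fun z : pt R => z.1.1) (fun z => z.1.1)) => // z.
  by apply: (@cvg_comp _ _ _ (fst : pt R -> _) fst _ (nbhs z.1)); exact: cvg_fst.
apply: (@smooth_comp_affine _ _ _ (ck tpi b) (fun z : pt R => z.1.2) (fun z => z.1.2)) => // z.
by apply: (@cvg_comp _ _ _ (fst : pt R -> _) snd _ (nbhs z.1)); [exact: cvg_fst|exact: cvg_snd].
Qed.

Lemma e4_smooth T N (a : I4 N) : smooth (e4 T a : st R -> R).
Proof.
move: a => [a b]; apply: smooth_mul.
  apply: (@smooth_comp_affine _ _ _ (ck T a) fst fst) => //; last exact: circle_ker_smooth.
  by move=> z; exact: cvg_fst.
apply: (@smooth_comp_affine _ _ _ (e3 b : pt R -> R) snd snd) => //; last exact: e3_smooth.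
by move=> z; exact: cvg_snd.
Qed.

Lemma e3_inv N (z z' w : pt R) : kfun (e3 : forall N, I3 N -> pt R -> R) N (z + w) (z' + w) = kfun e3 N z z'.
Proof.
have E2 (y y' : R * R) : kfun e2 N y y' = kfun (I := I1) (ck tpi) N y.1 y'.1 * kfun (I := I1) (ck tpi) N y.2 y'.2.
  exact: prodkerE.
have E3 (y y' : pt R) : kfun e3 N y y' = kfun e2 N y.1 y'.1 * kfun (I := I1) (ck tpi) N y.2 y'.2.
  exact: prodkerE.
rewrite [LHS]E3 [RHS]E3 !E2.
by congr (_ * _ * _); exact: circle_kfun_inv.
Qed.

Lemma e4_inv T N (z z' w : st R) : 0 < T ->
  kfun (e4 T : forall N, I4 N -> st R -> R) N (z + w) (z' + w) = kfun (e4 T) N z z'.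
Proof.
move=> T0.
have E4 (y y' : st R) : kfun (e4 T) N y y' = kfun (I := I1) (ck T) N y.1 y'.1 * kfun e3 N y.2 y'.2.
  exact: prodkerE.
rewrite [LHS]E4 [RHS]E4; congr (_ * _); first exact: circle_kfun_inv.
exact: e3_inv.
Qed.

Lemma e3_periodic N (a : I3 N) : periodic3 (e3 a : pt R -> R).
Proof.
move: a => [[a b] c] i [[x y] z].
have P N' (a' : I1 N') := @circle_ker_periodic R tpi tpi0 N' a'.
rewrite /e3 /prodker /e2 /prodker /= /basis3 /=.
by case: i => [[|[|[|i]]] Hi] //=; rewrite /GRing.scale /= ?mulr1 ?mulr0 ?addr0 P.
Qed.

Lemma e4_test T N (a : I4 N) : 0 < T -> test_periodic T (e4 T a : st R -> R).
Proof.
move=> T0; split; first exact: e4_smooth.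
  by move=> t i x; rewrite /e4 /prodker /=; congr (_ * _); exact: e3_periodic.
by move=> t x; rewrite /e4 /prodker /=; congr (_ * _); exact: circle_ker_periodic.
Qed.

End TorusKernels.

(** * Poincaré's inequality in one dimension and its tensorisation *)

Section VarianceTensor.
Context d1 d2 (X : measurableType d1) (Y : measurableType d2) (R : realType).
Variables (mu : {sigma_finite_measure set X -> \bar R})
          (nu : {sigma_finite_measure set Y -> \bar R}).
Hypotheses (mufin : (mu setT < +oo)%E) (nufin : (nu setT < +oo)%E).
Variables (alpha beta : R).
Hypotheses (a0 : 0 < alpha) (b0 : 0 < beta).
Hypotheses (muE : \int[mu]_x 1 = alpha) (nuE : \int[nu]_x 1 = beta).

Lemma sprod_mass : \int[sprod mu nu]_z 1 = alpha * beta.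
Proof.
have I1 := intble_cst (sprod_fin mufin nufin) 1.
have [_ <-] := Rint_fub1 I1.
rewrite nuE -muE mulrC -Rint_scale; last exact: intble_cst.
by apply: Rint_ext => x; rewrite mulr1.
Qed.

(* Efron-Stein: expand the square of [f - A / beta - B / alpha + m / (alpha beta)]
   with A, B the partial integrals of f and m its integral. *)
Lemma variance_tensor (f g1 g2 : X * Y -> R) (M : R) :
  measurable_fun setT f -> (forall z, `|f z| <= M) ->
  intble (sprod mu nu) g1 -> intble (sprod mu nu) g2 ->
  (forall y, \int[mu]_x (f (x, y) ^+ 2) - (\int[mu]_x f (x, y)) ^+ 2 / alpha <= \int[mu]_x g1 (x, y)) ->
  (forall x, \int[nu]_y (f (x, y) ^+ 2) - (\int[nu]_y f (x, y)) ^+ 2 / beta <= \int[nu]_y g2 (x, y)) ->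
  \int[sprod mu nu]_z (f z ^+ 2) - (\int[sprod mu nu]_z f z) ^+ 2 / (alpha * beta) <=
  \int[sprod mu nu]_z g1 z + \int[sprod mu nu]_z g2 z.
Proof.
move=> mf fM I1 I2 H1 H2.
have pfin := sprod_fin mufin nufin.
have Sf : sqint (sprod mu nu) f by apply: (sqint_bdd pfin mf (M := M)); exact: aeW.
have If := sqint_intble pfin Sf; have If2 := proj2 Sf.
pose A x := \int[nu]_y f (x, y); pose B y := \int[mu]_x f (x, y).
pose m := \int[sprod mu nu]_z f z.
have [IA EA] := Rint_fub1 If; have [IB EB] := Rint_fub2 If.
have M0 : 0 <= M by apply: le_trans (fM (point, point)).
have bdd d (Z : measurableType d) (mm : {sigma_finite_measure set Z -> \bar R}) (h : Z -> R) :
    (mm setT < +oo)%E -> measurable_fun setT h -> (forall z, `|h z| <= M) -> `|\int[mm]_z h z| <= M * \int[mm]_z 1.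
  move=> fin mh hM; have Ih : intble mm h by apply: (intble_bdd fin mh (M := M)); exact: aeW.
  apply: le_trans (Rint_abs Ih) _; rewrite -Rint_scale; last exact: intble_cst.
  apply: Rint_le; [exact: intble_abs|exact/intble_scale/intble_cst|].
  by move=> z; rewrite mulr1.
have SA : sqint mu A.
  apply: (sqint_bdd mufin (M := M * beta)); first exact: intble_meas IA.
  apply: aeW => x; rewrite -nuE; apply: bdd => // ; exact: measurableT_comp mf (pair1_measurable x).
have SB : sqint nu B.
  apply: (sqint_bdd nufin (M := M * alpha)); first exact: intble_meas IB.
  apply: aeW => y; rewrite -muE; apply: bdd => //; exact: measurableT_comp mf (pair2_measurable y).
have fst2 (h : X -> R) : sqint mu h -> sqint (sprod mu nu) (fun z => h z.1).
  move=> [mh Ih]; split; first exact: measurableT_comp mh measurable_fst.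
  exact: (intble_fst nufin Ih).
have snd2 (h : Y -> R) : sqint nu h -> sqint (sprod mu nu) (fun z => h z.2).
  move=> [mh Ih]; split; first exact: measurableT_comp mh measurable_snd.
  exact: (intble_snd mufin Ih).
have SA' := fst2 _ SA; have SB' := snd2 _ SB.
have e1 : \int[sprod mu nu]_z (f z * A z.1) = \int[mu]_x (A x ^+ 2).
  have [_ <-] := Rint_fub1 (sqint_mul Sf SA'); apply: Rint_ae.
  - exact: meas_fub1 (sqint_mul Sf SA').
  - exact: intble_meas (proj2 SA).
  - apply: filterS (intble_fub1 If) => x Ix /=; under Rint_ext do rewrite mulrC.
    by rewrite Rint_scale // -expr2.
have e2' : \int[sprod mu nu]_z (f z * B z.2) = \int[nu]_y (B y ^+ 2).
  have [_ <-] := Rint_fub2 (sqint_mul Sf SB'); apply: Rint_ae.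
  - exact: meas_fub2 (sqint_mul Sf SB').
  - exact: intble_meas (proj2 SB).
  - apply: filterS (intble_fub2 If) => x Ix /=; under Rint_ext do rewrite mulrC.
    by rewrite Rint_scale // -expr2.
have e3' : \int[sprod mu nu]_z (A z.1 * B z.2) = m ^+ 2.
  have [_ <-] := Rint_fub1 (sqint_mul SA' SB') => /=.
  under Rint_ext do rewrite (Rint_scale _ IB).
  rewrite EB; under Rint_ext do rewrite mulrC.
  by rewrite Rint_scale ?EA // -/m expr2.
have e4' : \int[sprod mu nu]_z (A z.1 ^+ 2) = beta * \int[mu]_x (A x ^+ 2).
  have [_ <-] := Rint_fub1 (proj2 SA') => /=.
  rewrite -Rint_scale; last by case: SA.
  apply: Rint_ext => x; rewrite mulrC -nuE -Rint_scale; last exact: intble_cst.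
  by apply: Rint_ext => y; rewrite mulr1.
have e5' : \int[sprod mu nu]_z (B z.2 ^+ 2) = alpha * \int[nu]_x (B x ^+ 2).
  have [_ <-] := Rint_fub2 (proj2 SB') => /=.
  rewrite -Rint_scale; last by case: SB.
  apply: Rint_ext => x; rewrite mulrC -muE -Rint_scale; last exact: intble_cst.
  by apply: Rint_ext => y; rewrite mulr1.
have e6 : \int[sprod mu nu]_z A z.1 = beta * m.
  have [_ <-] := Rint_fub1 (sqint_intble pfin SA') => /=.
  rewrite -[m]EA -Rint_scale //; apply: Rint_ext => x; rewrite mulrC -nuE -Rint_scale; last exact: intble_cst.
  by apply: Rint_ext => y; rewrite mulr1.
have e7 : \int[sprod mu nu]_z B z.2 = alpha * m.
  have [_ <-] := Rint_fub2 (sqint_intble pfin SB') => /=.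
  rewrite -[m]EB -Rint_scale //; apply: Rint_ext => x; rewrite mulrC -muE -Rint_scale; last exact: intble_cst.
  by apply: Rint_ext => y; rewrite mulr1.
have e8 : \int[sprod mu nu]_z (m ^+ 2) = m ^+ 2 * (alpha * beta).
  rewrite -sprod_mass -Rint_scale; last exact: intble_cst.
  by apply: Rint_ext => z; rewrite mulr1.
set SAq := \int[mu]_x (A x ^+ 2) in e1 e4'; set SBq := \int[nu]_x (B x ^+ 2) in e2' e5'.
have pos : 0 <= \int[sprod mu nu]_z (f z ^+ 2) - SAq / beta - SBq / alpha + m ^+ 2 / (alpha * beta).
  have c2 : sqint (sprod mu nu) (fun=> m).
    by apply: (sqint_bdd pfin (M := `|m|)) => //; exact: aeW.
  pose i1 := intble_scale (beta ^- 2) (proj2 SA').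
  pose i2 := intble_scale (alpha ^- 2) (proj2 SB').
  pose i3 := intble_scale ((alpha * beta) ^- 2) (proj2 c2).
  pose i4 := intble_scale (- 2 / beta) (sqint_mul Sf SA').
  pose i5 := intble_scale (- 2 / alpha) (sqint_mul Sf SB').
  pose i6 := intble_scale (2 / (alpha * beta) * m) If.
  pose i7 := intble_scale (2 / (alpha * beta)) (sqint_mul SA' SB').
  pose i8 := intble_scale (- 2 / (alpha * beta ^+ 2) * m) (sqint_intble pfin SA').
  pose i9 := intble_scale (- 2 / (alpha ^+ 2 * beta) * m) (sqint_intble pfin SB').
  pose j1 := intble_add If2 i1; pose j2 := intble_add j1 i2; pose j3 := intble_add j2 i3.
  pose j4 := intble_add j3 i4; pose j5 := intble_add j4 i5; pose j6 := intble_add j5 i6.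
  pose j7 := intble_add j6 i7; pose j8 := intble_add j7 i8; pose j9 := intble_add j8 i9.
  have := @Rint_ge0 _ _ _ (sprod mu nu) (fun z => (f z - A z.1 / beta - B z.2 / alpha + m / (alpha * beta)) ^+ 2) (fun z => sqr_ge0 _).
  rewrite (Rint_ext _ (g := fun z => f z ^+ 2 + beta ^- 2 * A z.1 ^+ 2 + alpha ^- 2 * B z.2 ^+ 2
    + (alpha * beta) ^- 2 * m ^+ 2 + - 2 / beta * (f z * A z.1) + - 2 / alpha * (f z * B z.2)
    + 2 / (alpha * beta) * m * f z + 2 / (alpha * beta) * (A z.1 * B z.2)
    + - 2 / (alpha * beta ^+ 2) * m * A z.1 + - 2 / (alpha ^+ 2 * beta) * m * B z.2)); last first.
    by move=> z; field; rewrite !gt_eqF.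
  rewrite (Rint_add j8 i9) (Rint_add j7 i8) (Rint_add j6 i7) (Rint_add j5 i6) (Rint_add j4 i5)
    (Rint_add j3 i4) (Rint_add j2 i3) (Rint_add j1 i2) (Rint_add If2 i1).
  rewrite (Rint_scale _ (proj2 SA')) (Rint_scale _ (proj2 SB')) (Rint_scale _ (proj2 c2))
    (Rint_scale _ (sqint_mul Sf SA')) (Rint_scale _ (sqint_mul Sf SB')) (Rint_scale _ If)
    (Rint_scale _ (sqint_mul SA' SB')) (Rint_scale _ (sqint_intble pfin SA')) (Rint_scale _ (sqint_intble pfin SB')).
  rewrite e1 e2' e3' e4' e5' e6 e7 e8 -/m => H; apply: le_trans H _.
  by rewrite le_eqVlt; apply/orP; left; apply/eqP; field; rewrite !gt_eqF.
(* [h1] and [h2] integrate the one-variable hypotheses over the other variable; their sum minus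
   [pos] is the claim. *)
have h1 : \int[sprod mu nu]_z (f z ^+ 2) - SBq / alpha <= \int[sprod mu nu]_z g1 z.
  have [J1 <-] := Rint_fub2 If2; have [J2 <-] := Rint_fub2 I1.
  have JB : intble nu (fun y => alpha^-1 * B y ^+ 2) by apply: intble_scale; case: SB.
  rewrite mulrC -Rint_scale; last by case: SB.
  rewrite -Rint_sub //; apply: Rint_le => //; first exact: intble_sub.
  by move=> y; rewrite mulrC; exact: H1.
have h2 : \int[sprod mu nu]_z (f z ^+ 2) - SAq / beta <= \int[sprod mu nu]_z g2 z.
  have [J1 <-] := Rint_fub1 If2; have [J2 <-] := Rint_fub1 I2.
  have JA : intble mu (fun y => beta^-1 * A y ^+ 2) by apply: intble_scale; case: SA.
  rewrite mulrC -Rint_scale; last by case: SA.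
  rewrite -Rint_sub //; apply: Rint_le => //; first exact: intble_sub.
  by move=> y; rewrite mulrC; exact: H2.
rewrite -/m; lra.
Qed.

End VarianceTensor.

Section IntervalPoincare.
Context {R : realType} (L : R).
Hypothesis L0 : 0 < L.

(** The oscillation of f, hence its distance to its mean, is at most B = int |f'|, and B^2 <= L int
    f'^2 by Cauchy-Schwarz. The left side is the variance times L, the form that tensorises; the
    constant L^2 is not sharp. *)
Lemma interval_poincare (f : R -> R) : smooth f ->
  \int[mI 0 L]_x (f x ^+ 2) - (\int[mI 0 L]_x f x) ^+ 2 / L <=
  \int[mI 0 L]_x (L ^+ 2 * ('D_1 f x) ^+ 2).
Proof.
move=> sf; have sD := smoothD (1 : R) sf.
have fin := mI_fin 0 L.
have cD := smooth_continuous sD.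
have ID := continuous_intble_mI 0 L cD.
have If := continuous_intble_mI 0 L (smooth_continuous sf).
have IA := intble_abs ID.
have sq (h : R -> R) : continuous h -> sqint (mI 0 L) h.
  move=> ch; have [M M0 HM] := continuous_bounded_itv 0 L ch.
  apply: (sqint_bdd fin (continuous_meas ch) (M := M)).
  by apply: (ae_imp (mI_ae 0 L)) => x; exact: HM.
have SD := sq _ cD; have Sf := sq _ (smooth_continuous sf).
set B := \int[mI 0 L]_x `|'D_1 f x|.
have B0 : 0 <= B by apply: Rint_ge0 => x.
have osc1 x y : 0 <= y -> y <= x -> x <= L -> `|f x - f y| <= B.
  move=> y0 yx xL; rewrite -(FTC_smooth yx sf).
  apply: le_trans (Rint_abs (intble_mI_sub y0 xL ID)) _.
  exact: Rint_mI_sub y0 xL _ IA.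
have osc x y : 0 <= x <= L -> 0 <= y <= L -> `|f x - f y| <= B.
  move=> /andP[x0 xL] /andP[y0 yL]; have [xy|xy] := leP x y; last exact: osc1 (ltW xy) xL.
  by rewrite distrC; exact: osc1.
pose m := (\int[mI 0 L]_x f x) / L.
have mE : \int[mI 0 L]_x f x = m * L by rewrite /m divfK // gt_eqF.
have dev x : 0 <= x <= L -> `|f x - m| <= B.
  move=> xL; have Ic := intble_cst fin (f x).
  have -> : f x - m = (\int[mI 0 L]_y (f x - f y)) / L.
    rewrite Rint_sub // mI_size ?ltW // subr0 mulrBl mulfK ?gt_eqF //.
  rewrite normrM [X in _ * X]ger0_norm; last by rewrite invr_ge0 ltW.
  rewrite ler_pdivrMr //.
  apply: le_trans (Rint_abs (intble_sub Ic If)) _.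
  have <- : \int[mI 0 L]_y B = B * L by rewrite mI_size ?subr0 // ltW.
  apply: Rint_le_ae; [exact: intble_abs (intble_sub Ic If)|exact: (intble_cst fin)|].
  by apply: (ae_imp (mI_ae 0 L)) => y yL; exact: osc.
have CS : B ^+ 2 <= L * \int[mI 0 L]_x (('D_1 f x) ^+ 2).
  have Sa : sqint (mI 0 L) (fun x => `|'D_1 f x|) by apply: sq => x; apply: cvg_norm; exact: cD.
  have S1 : sqint (mI 0 L) (fun=> 1) by apply: sq => x; exact: cvg_cst.
  have := cauchy_schwarz S1 Sa.
  rewrite (_ : \int[mI 0 L]_x (1 * `|'D_1 f x|) = B); last by apply: Rint_ext => x; rewrite mul1r.
  rewrite (_ : \int[mI 0 L]_x (1 ^+ 2) = L); last first.
    by rewrite mI_size ?ltW // subr0 expr1n mul1r.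
  rewrite (_ : \int[mI 0 L]_x (`|'D_1 f x| ^+ 2) = \int[mI 0 L]_x ('D_1 f x ^+ 2)) //.
  by apply: Rint_ext => x; rewrite real_normK ?num_real.
have Sm := sqint_sub Sf (sqint_bdd fin (f := fun=> m) (M := `|m|) (measurable_cst _) (aeW _ (fun=> lexx _))).
have -> : \int[mI 0 L]_x (f x ^+ 2) - (\int[mI 0 L]_x f x) ^+ 2 / L = \int[mI 0 L]_x ((f x - m) ^+ 2).
  have I1 := intble_scale (2 * m) If; have I2 := intble_cst fin (m ^+ 2).
  transitivity (\int[mI 0 L]_x (f x ^+ 2 - (2 * m * f x - m ^+ 2))); last by apply: Rint_ext => x; ring.
  rewrite (Rint_sub (proj2 Sf) (intble_sub I1 I2)).
  rewrite Rint_sub // Rint_scale // mI_size ?ltW // subr0 mE.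
  by field; rewrite gt_eqF.
apply: (@le_trans _ _ (L ^+ 2 * \int[mI 0 L]_x ('D_1 f x ^+ 2))); last first.
  by rewrite le_eqVlt -(Rint_scale _ (proj2 SD)) eqxx.
apply: (@le_trans _ _ (\int[mI 0 L]_x (B ^+ 2))).
  apply: Rint_le_ae; [by case: Sm|exact: (intble_cst fin)|].
  apply: (ae_imp (mI_ae 0 L)) => x xL.
  by rewrite -(real_normK (num_real (f x - m))) ler_pXn2r // ?nnegrE //; exact: dev.
rewrite (mI_size _ (ltW L0)) subr0 mulrC (expr2 L) -mulrA; apply: ler_wpM2l; first exact: ltW.
exact: CS.
Qed.

End IntervalPoincare.

(** * Weak derivatives on the torus and mollification *)

Section TorusFunctions.
Context {R : realType}.
Local Notation tpi := (2 * pi : R).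

Let tpi0 : 0 < tpi. Proof. by rewrite mulr_gt0 // pi_gt0. Qed.

Definition tsmooth (f : pt R -> R) : Prop := smooth f /\ periodic3 f.

Lemma tsmoothD f v : tsmooth f -> tsmooth (fun x => 'D_v f x).
Proof.
move=> [sf pf]; split; first exact: smoothD.
move=> i x; have sa : smooth (fun y : pt R => f (y + (2 * pi) *: basis3 i)).
  by rewrite (_ : (fun y => _) = f) //; apply/funext => y; exact: pf.
have := @derive_comp_affine _ _ _ f (fun y : pt R => y + (2 * pi) *: basis3 i) id v x _ sf.
rewrite (_ : (fun y => f (y + _)) = f); last by apply/funext => y; exact: pf.
by move=> -> // y h u; rewrite addrA.
Qed.

Lemma tsmooth_mul f g : tsmooth f -> tsmooth g -> tsmooth (fun x => f x * g x).
Proof. by move=> [sf pf] [sg pg]; split; [exact: smooth_mul|move=> i x; rewrite pf pg]. Qed.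

Lemma tsmooth_cst (c : R) : tsmooth (fun=> c).
Proof. by split; [exact: smooth_cst|]. Qed.

Lemma compact_T3 : compact (T3 : set (pt R)).
Proof. by rewrite T3E; apply: compact_setX; [apply: compact_setX|]; exact: segment_compact. Qed.

Lemma continuous_bdd3 (f : pt R -> R) : continuous f ->
  exists2 M : R, 0 <= M & {ae m3, forall x : pt R, `|f x| <= M}.
Proof.
move=> cf; have /compact_bounded [M [_ HM]] : compact (f @` T3).
  by apply: continuous_compact; [exact: continuous_subspaceT|exact: compact_T3].
exists (`|M| + 1); first by rewrite addr_ge0.
apply: (ae_imp m3_in) => x Tx; apply: (HM (`|M| + 1)) => /=.
  by rewrite ltr_pwDr // ler_norm.
by exists x.
Qed.

Lemma sqint3_cont (f : pt R -> R) : continuous f -> sqint m3 f.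
Proof.
move=> cf; have [M M0 HM] := continuous_bdd3 cf.
exact: (sqint_bdd m3_fin (continuous_meas3 cf) HM).
Qed.

Lemma intble3_mul (f u : pt R -> R) : continuous f -> intble m3 u ->
  intble m3 (fun x => u x * f x).
Proof.
move=> cf Iu; have [M M0 HM] := continuous_bdd3 cf.
exact: (intble_mul_bdd Iu (continuous_meas3 cf) HM).
Qed.

Lemma sqint3_mul (f u : pt R -> R) : continuous f -> sqint m3 u ->
  sqint m3 (fun x => u x * f x).
Proof.
move=> cf Su; have [M M0 HM] := continuous_bdd3 cf.
exact: (sqint_mul_bdd Su (continuous_meas3 cf) HM).
Qed.

Definition K3 N (u : pt R -> R) : pt R -> R := Kop m3 e3 N u.

(* The weak derivative, tested against the kernel functions only. *)
Definition wderiv (j : 'I_3) (u g : pt R -> R) : Prop :=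
  forall N (a : I3 N), \int[m3]_x (u x * 'D_(basis3 j) (e3 a : pt R -> R) x) =
    - \int[m3]_x (g x * e3 a x).

Lemma e3_tsmooth N (a : I3 N) : tsmooth (e3 a : pt R -> R).
Proof. by split; [exact: e3_smooth|exact: e3_periodic]. Qed.

Lemma K3_tsmooth N u : tsmooth (K3 N u).
Proof.
split; first by apply: smooth_lincomb => a; exact: e3_smooth.
by move=> i x; apply: eq_bigr => a _; congr (_ * _); exact: e3_periodic.
Qed.

Lemma K3_continuous N u : continuous (K3 N u).
Proof. by case: (K3_tsmooth N u) => /smooth_continuous. Qed.

(** [ker_swap] puts the derivative on the kernel functions, which are exactly the test functions of
    [wderiv]; the two minus signs cancel. *)
Lemma K3_derive N j u g x : intble m3 u -> wderiv j u g ->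
  'D_(basis3 j) (K3 N u) x = K3 N g x.
Proof.
move=> Iu ug; rewrite /K3 /Kop derive_lincomb; last by move=> a; exact: e3_smooth.
have H := @ker_swap R (pt R) _ _ m3 (fun y : mpt R => (y : pt R)) I3
  (e3 : forall N, I3 N -> pt R -> R) (@e3_smooth R) (@e3_inv R) N (basis3 j) x u.
rewrite H.
- rewrite -sumrN; apply: eq_bigr => a _; rewrite -mulrN; congr (_ * _).
  apply/eqP; rewrite eqr_oppLR; apply/eqP.
  transitivity (\int[m3]_y (u y * 'D_(basis3 j) (e3 a : pt R -> R) y)).
    by apply: Rint_ext => y; rewrite mulrC.
  by rewrite ug; congr (- _); apply: Rint_ext => y; rewrite mulrC.
- by move=> a; exact: (intble_ker (proj1 e3_approx)).
- move=> a; apply: (intble_ext (f := fun y : mpt R => u y * 'D_(basis3 j) (e3 a : pt R -> R) y)).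
    by move=> y; rewrite mulrC.
  by apply: intble3_mul => //; case: (tsmoothD (basis3 j) (e3_tsmooth a)) => /smooth_continuous.
Qed.

Lemma K3_weak h g : sqint m3 h -> sqint m3 g ->
  \int[m3]_x (h x * K3 N g x) @[N --> \oo] --> \int[m3]_x (h x * g x).
Proof. exact: (Kop_weak_L2 m3_fin (proj1 e3_approx) e3_approx). Qed.

Lemma K3_weak_bdd h g (M : R) : intble m3 h -> measurable_fun setT (g : mpt R -> R) ->
  {ae m3, forall y : pt R, `|g y| <= M} ->
  \int[m3]_x (h x * K3 N g x) @[N --> \oo] --> \int[m3]_x (h x * g x).
Proof. exact: (Kop_weak_Linf m3_fin (proj1 e3_approx) e3_approx). Qed.

(* Divergence-free in the weak sense, for the restricted measure. *)
Definition sol3 (a : 'I_3 -> pt R -> R) : Prop :=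
  forall psi, tsmooth psi -> \int[m3]_x (\sum_i a i x * 'D_(basis3 i) psi x) = 0.

Lemma cvg_Rsum (J : Type) (r : seq J) (u : J -> nat -> R) (l : J -> R) :
  (forall j, u j N @[N --> \oo] --> l j) ->
  \sum_(j <- r) u j N @[N --> \oo] --> \sum_(j <- r) l j.
Proof.
move=> H; elim: r => [|i r IH].
  by rewrite big_nil; under eq_fun do rewrite big_nil; exact: cvg_cst.
by rewrite big_cons; under eq_fun do rewrite big_cons; exact: cvgD.
Qed.

Lemma cvg_eq (u : nat -> R) (c l : R) : (forall N, u N = c) -> u N @[N --> \oo] --> l -> l = c.
Proof.
move=> uc; have -> : u = fun=> c by apply/funext.
by move=> /cvg_lim <- //; apply: lim_cst.
Qed.

(** Test the vanishing divergence of a with [f * K3 N g], whose gradient is given by the Leibniz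
    rule and [K3_derive], and let N grow. *)
Lemma sol3_leibniz_smooth a f g (G : 'I_3 -> pt R -> R) :
  (forall j, sqint m3 (a j)) -> sol3 a -> sqint m3 g -> (forall j, sqint m3 (G j)) ->
  (forall j, wderiv j g (G j)) -> tsmooth f ->
  \sum_j (\int[m3]_x (a j x * 'D_(basis3 j) f x * g x) + \int[m3]_x (a j x * f x * G j x)) = 0.
Proof.
move=> Sa sa Sg SG gG tf.
have Ig := sqint_intble m3_fin Sg.
have cf : continuous f by case: tf => /smooth_continuous.
have cD j : continuous (fun x => 'D_(basis3 j) f x).
  by case: (tsmoothD (basis3 j) tf) => /smooth_continuous.
have S1 j : sqint m3 (fun x => a j x * 'D_(basis3 j) f x) by exact: sqint3_mul.
have S2 j : sqint m3 (fun x => a j x * f x) by exact: sqint3_mul.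
pose u j N := \int[m3]_x (a j x * 'D_(basis3 j) f x * K3 N g x) +
  \int[m3]_x (a j x * f x * K3 N (G j) x).
have u0 N : \sum_j u j N = 0.
  have J j := intble3_mul (@K3_continuous N g) (sqint_intble m3_fin (S1 j)).
  have J' j := intble3_mul (@K3_continuous N (G j)) (sqint_intble m3_fin (S2 j)).
  have E2 : \int[m3]_x (\sum_j (a j x * 'D_(basis3 j) f x * K3 N g x + a j x * f x * K3 N (G j) x)) = \sum_j u j N.
    rewrite Rint_sum => [|j]; last exact: (intble_add (J j) (J' j)).
    by apply: eq_bigr => j _; rewrite (Rint_add (J j) (J' j)).
  rewrite -E2 -[RHS](sa (fun x => f x * K3 N g x)); last exact: tsmooth_mul (K3_tsmooth N g).
  apply: Rint_ext => x; apply: eq_bigr => j _.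
  rewrite derive_mul; [|by case: tf|by case: (K3_tsmooth N g)].
  by rewrite (K3_derive N x Ig (gG j)); ring.
have cu j : u j N @[N --> \oo] --> \int[m3]_x (a j x * 'D_(basis3 j) f x * g x) + \int[m3]_x (a j x * f x * G j x).
  by apply: cvgD; exact: K3_weak.
by apply: (cvg_eq u0); apply: cvg_Rsum => j; exact: cu.
Qed.

End TorusFunctions.

(** * Weak Leibniz rule, weak Laplacian and Poincaré's inequality on the torus *)

Section TorusWeakDerivatives.
Context {R : realType}.
Local Notation tpi := (2 * pi : R).
Local Notation mS := (mI 0 tpi).

Let tpi0 : 0 < tpi. Proof. by rewrite mulr_gt0 // pi_gt0. Qed.

(** Apply the smooth case to [K3 N f] and let N grow. The product a_j G_j is only integrable, so the
    limit of its pairing with [K3 N f] uses the bound on f. *)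
Lemma sol3_leibniz (a : 'I_3 -> pt R -> R) f g (F G : 'I_3 -> pt R -> R) (M : R) :
  (forall j, sqint m3 (a j)) -> sol3 a ->
  sqint m3 f -> (forall j, sqint m3 (F j)) -> (forall j, wderiv j f (F j)) ->
  sqint m3 g -> (forall j, sqint m3 (G j)) -> (forall j, wderiv j g (G j)) ->
  {ae m3, forall x : pt R, `|f x| <= M} -> (forall j, sqint m3 (fun x => a j x * g x)) ->
  \sum_j (\int[m3]_x (a j x * g x * F j x) + \int[m3]_x (a j x * G j x * f x)) = 0.
Proof.
move=> Sa sa Sf SF fF Sg SG gG fM Sag.
have If := sqint_intble m3_fin Sf.
pose u j N := \int[m3]_x (a j x * g x * K3 N (F j) x) + \int[m3]_x (a j x * G j x * K3 N f x).
have u0 N : \sum_j u j N = 0.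
  rewrite -[RHS](sol3_leibniz_smooth Sa sa Sg SG gG (K3_tsmooth N f)).
  apply: eq_bigr => j _; congr (_ + _); apply: Rint_ext => x; last by ring.
  by rewrite (K3_derive N x If (fF j)); ring.
apply: (cvg_eq u0); apply: cvg_Rsum => j; apply: cvgD; first exact: K3_weak.
have [mf _] := Sf.
exact: (K3_weak_bdd (sqint_mul (Sa j) (SG j)) mf fM).
Qed.

(** [K3 N v] is a finite combination of the kernel functions to which the hypothesis applies, so the
    identity holds for it exactly; then N grows. *)
Lemma wderiv_laplace v (V W : 'I_3 -> pt R -> R) Lw :
  sqint m3 v -> (forall j, sqint m3 (V j)) -> (forall j, wderiv j v (V j)) ->
  (forall j, sqint m3 (W j)) -> sqint m3 Lw ->
  (forall N (a : I3 N), \int[m3]_x (\sum_j W j x * 'D_(basis3 j) (e3 a : pt R -> R) x) =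
     - \int[m3]_x (Lw x * e3 a x)) ->
  \sum_j \int[m3]_x (W j x * V j x) = - \int[m3]_x (Lw x * v x).
Proof.
move=> Sv SV vV SW SL HL.
have Iv := sqint_intble m3_fin Sv; have IL := sqint_intble m3_fin SL.
pose u N := \sum_j \int[m3]_x (W j x * K3 N (V j) x) + \int[m3]_x (Lw x * K3 N v x).
have eI N (a : I3 N) (h : pt R -> R) : intble m3 h -> intble m3 (fun x => h x * e3 a x).
  by move=> Ih; exact: (intble3_mul (smooth_continuous (@e3_smooth R N a)) Ih).
have u0 N : u N = 0.
  pose c (a : I3 N) := \int[m3]_y (e3 a y * v y).
  have D j x : K3 N (V j) x = \sum_(a : I3 N) 'D_(basis3 j) (e3 a : pt R -> R) x * c a.
    rewrite -(K3_derive N x Iv (vV j)) /K3 /Kop derive_lincomb // => a; exact: e3_smooth.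
  have DI j (a : I3 N) : intble m3 (fun x => W j x * 'D_(basis3 j) (e3 a : pt R -> R) x).
    exact: (intble3_mul (smooth_continuous (proj1 (tsmoothD (basis3 j) (e3_tsmooth a)))) (sqint_intble m3_fin (SW j))).
  have -> : u N = \sum_(a : I3 N) c a * (\sum_j \int[m3]_x (W j x * 'D_(basis3 j) (e3 a : pt R -> R) x) + \int[m3]_x (Lw x * e3 a x)).
    under [RHS]eq_bigr do rewrite mulrDr mulr_sumr.
    rewrite big_split /= exchange_big /= /u; congr (_ + _).
      apply: eq_bigr => j _.
      transitivity (\int[m3]_x (\sum_(a : I3 N) c a * (W j x * 'D_(basis3 j) (e3 a : pt R -> R) x))).
        by apply: Rint_ext => x; rewrite D mulr_sumr; apply: eq_bigr => a _; ring.
      rewrite Rint_sum => [|a]; last exact: intble_scale (DI j a).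
      by apply: eq_bigr => a _; rewrite (Rint_scale _ (DI j a)).
    transitivity (\int[m3]_x (\sum_(a : I3 N) c a * (Lw x * e3 a x))).
      by apply: Rint_ext => x; rewrite /K3 /Kop mulr_sumr; apply: eq_bigr => a _; rewrite /c; ring.
    rewrite Rint_sum => [|a]; last exact: intble_scale (eI N a Lw IL).
    by apply: eq_bigr => a _; rewrite (Rint_scale _ (eI N a Lw IL)).
  apply: big1 => a _; rewrite -Rint_sum // HL addNr mulr0 //.
apply/eqP; rewrite -addr_eq0; apply/eqP; apply: (cvg_eq u0).
apply: cvgD; last exact: (K3_weak SL Sv).
by apply: cvg_Rsum => j; exact: (K3_weak (SW j) (SV j)).
Qed.

Let V3 := tpi * tpi * tpi.
Let V30 : 0 < V3. Proof. exact: (mulr_gt0 (mulr_gt0 tpi0 tpi0) tpi0). Qed.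

Lemma mS_mass : \int[mS]_x 1 = tpi.
Proof. by rewrite mI_size ?mul1r ?subr0 // ltW. Qed.

Lemma poincare_line N (g Gj : pt R -> R) (l : R -> pt R) j : continuous l ->
  (forall x h : R, l (h + x) = h *: basis3 j + l x) -> intble m3 g -> wderiv j g Gj ->
  \int[mS]_x (K3 N g (l x) ^+ 2) - (\int[mS]_x K3 N g (l x)) ^+ 2 / tpi <=
  \int[mS]_x (tpi ^+ 2 * K3 N Gj (l x) ^+ 2).
Proof.
move=> cl lE Ig gG.
have sf : smooth (K3 N g) by case: (K3_tsmooth N g).
have LE : forall x h v : R, l (h *: v + x) = h *: (v *: basis3 j) + l x.
  by move=> x h v; rewrite lE scalerA.
have sl : smooth (fun x : R => K3 N g (l x)) by move=> m; exact: (Ck_comp_affine cl LE (sf m)).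
apply: le_trans (interval_poincare tpi0 sl) _.
rewrite le_eqVlt; apply/orP; left; apply/eqP; apply: Rint_ext => x.
have := @derive_comp_affine _ (R : normedModType R) (pt R) (K3 N g) l (fun v : R => v *: basis3 j) 1 x LE sf.
by move=> ->; rewrite scale1r (K3_derive N (l x) Ig gG).
Qed.

(** The mollified function is smooth with partial derivatives [K3 N (G j)]. The interval inequality
    along each axis is tensorised twice, first over two coordinates and then with the third; the L_2
    contraction removes the mollifier on the right. *)
Lemma poincare_K3 N g (G : 'I_3 -> pt R -> R) :
  sqint m3 g -> (forall j, sqint m3 (G j)) -> (forall j, wderiv j g (G j)) ->
  \int[m3]_x (K3 N g x ^+ 2) - (\int[m3]_x K3 N g x) ^+ 2 / V3 <=
  \sum_j tpi ^+ 2 * \int[m3]_x (G j x ^+ 2).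
Proof.
move=> Sg SG gG; have Ig := sqint_intble m3_fin Sg.
have fin := mI_fin 0 tpi; have fin2 := sprod_fin fin fin.
have sf : smooth (K3 N g) by case: (K3_tsmooth N g).
have mk := proj1 (@e3_approx R).
have [M HM] := Kop_bdd mk N g.
have mf : measurable_fun setT (K3 N g : mpt R -> R) := Kop_meas mk N g.
pose h j (x : mpt R) := tpi ^+ 2 * K3 N (G j) x ^+ 2.
have mh j : measurable_fun setT (h j).
  by apply: measurable_funM => //; apply: measurable_funX; exact: (Kop_meas mk N (G j)).
have hb j : exists Mj, forall x, `|h j x| <= Mj.
  have [Mj HMj] := Kop_bdd mk N (G j); exists (tpi ^+ 2 * Mj ^+ 2) => x.
  rewrite /h normrM ger0_norm ?sqr_ge0 //; apply: ler_wpM2l; first exact: sqr_ge0.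
  have P0 : 0 <= Mj := le_trans (normr_ge0 _) (HMj x).
  by rewrite normrX; apply: lerXn2r; rewrite ?nnegrE ?HMj.
have Ih j : intble m3 (h j).
  by have [Mj HMj] := hb j; apply: (intble_bdd m3_fin (mh j) (M := Mj)); exact: aeW.
pose j0 : 'I_3 := ord0; pose j1 : 'I_3 := Ordinal (isT : (1 < 3)%N); pose j2 : 'I_3 := Ordinal (isT : (2 < 3)%N).
have V2 x3 : \int[sprod mS mS]_z (K3 N g (z, x3) ^+ 2) - (\int[sprod mS mS]_z K3 N g (z, x3)) ^+ 2 / (tpi * tpi)
   <= \int[sprod mS mS]_z h j0 (z, x3) + \int[sprod mS mS]_z h j1 (z, x3).
  have hI j : intble (sprod mS mS) (fun z => h j (z, x3)).
    have [Mj HMj] := hb j; apply: (intble_bdd fin2 (M := Mj)); last exact: aeW.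
    exact: measurableT_comp (mh j) (pair2_measurable x3).
  apply: (variance_tensor fin fin tpi0 tpi0 mS_mass mS_mass (f := fun z => K3 N g (z, x3))
    (g1 := fun z => h j0 (z, x3)) (g2 := fun z => h j1 (z, x3)) (M := M)) => //.
  - exact: measurableT_comp mf (pair2_measurable x3).
  - by move=> z; exact: HM.
  - move=> x2.
    apply: (@poincare_line N g (G j0) (fun x : R => ((x, x2), x3) : pt R) j0 _ _ Ig (gG j0)).
      by move=> x; exact: (cvg_pair (cvg_pair cvg_id (cvg_cst x2)) (cvg_cst x3)).
    by move=> x h'; transitivity ((h' * 1 + x, h' * 0 + x2, h' * 0 + x3) : pt R) => //; rewrite mulr1 !mulr0 !add0r.
  - move=> x1.
    apply: (@poincare_line N g (G j1) (fun x : R => ((x1, x), x3) : pt R) j1 _ _ Ig (gG j1)).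
      by move=> x; exact: (cvg_pair (cvg_pair (cvg_cst x1) cvg_id) (cvg_cst x3)).
    by move=> x h'; transitivity ((h' * 0 + x1, h' * 1 + x, h' * 0 + x3) : pt R) => //; rewrite mulr1 !mulr0 !add0r.
have V1 z : \int[mS]_x (K3 N g (z, x) ^+ 2) - (\int[mS]_x K3 N g (z, x)) ^+ 2 / tpi <= \int[mS]_x h j2 (z, x).
  apply: (@poincare_line N g (G j2) (fun x : R => (z, x) : pt R) j2 _ _ Ig (gG j2)).
    by move=> x; exact: (cvg_pair (cvg_cst z) cvg_id).
  case: z => x1 x2 x h'.
  by transitivity ((h' * 0 + x1, h' * 0 + x2, h' * 1 + x) : pt R) => //; rewrite mulr1 !mulr0 !add0r.
have E2 : \int[sprod mS mS]_z 1 = tpi * tpi := sprod_mass fin fin mS_mass mS_mass.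
have := variance_tensor fin2 fin (mulr_gt0 tpi0 tpi0) tpi0 E2 mS_mass
   (f := K3 N g) (g1 := fun z => h j0 z + h j1 z) (g2 := h j2) mf HM
   (intble_add (Ih j0) (Ih j1)) (Ih j2).
move=> /(_ _ V1) H; apply: le_trans (H _) _ => [x3|].
  apply: le_trans (V2 x3) _; rewrite Rint_add //.
    have [Mj HMj] := hb j0; apply: (intble_bdd fin2 (M := Mj)); last exact: aeW.
    exact: measurableT_comp (mh j0) (pair2_measurable x3).
  have [Mj HMj] := hb j1; apply: (intble_bdd fin2 (M := Mj)); last exact: aeW.
  exact: measurableT_comp (mh j1) (pair2_measurable x3).
rewrite -/m3 Rint_add // !big_ord_recl big_ord0 addr0 addrA.
have KE j : \int[m3]_x h j x <= tpi ^+ 2 * \int[m3]_x (G j x ^+ 2).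
  rewrite Rint_scale; last exact: (proj2 (sqint_Kop m3_fin mk N (G j))).
  by apply: ler_wpM2l; [exact: sqr_ge0|exact: Kop_L2 m3_fin mk N _ (SG j)].
by apply: lerD; [apply: lerD|]; apply: le_trans (KE _) _; rewrite le_eqVlt; apply/orP; left; apply/eqP;
  congr (_ * _); apply: Rint_ext => x; congr (G _ _ ^+ _); apply: val_inj.
Qed.

(** Mollification keeps the zero mean, so [poincare_K3] bounds the norm of [K3 N g]. With A the
    integral of g^2 and B the claimed bound, Cauchy-Schwarz bounds the square of int g K3 N g by A
    B, and weak convergence gives A^2 <= A B. *)
Lemma poincare_wderiv g (G : 'I_3 -> pt R -> R) :
  sqint m3 g -> (forall j, sqint m3 (G j)) -> (forall j, wderiv j g (G j)) ->
  \int[m3]_x g x = 0 ->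
  \int[m3]_x (g x ^+ 2) <= tpi ^+ 2 * \sum_j \int[m3]_x (G j x ^+ 2).
Proof.
move=> Sg SG gG g0; have Ig := sqint_intble m3_fin Sg.
have mk := proj1 (@e3_approx R).
set A := \int[m3]_x (g x ^+ 2); set B := _ * _.
have A0 : 0 <= A by apply: Rint_ge0 => x; exact: sqr_ge0.
have B0 : 0 <= B.
  by apply: mulr_ge0; [exact: sqr_ge0|apply: sumr_ge0 => j _; apply: Rint_ge0 => x; exact: sqr_ge0].
have bound N : (\int[m3]_x (g x * K3 N g x)) ^+ 2 <= A * B.
  apply: le_trans (cauchy_schwarz Sg (sqint_Kop m3_fin mk N g)) _.
  apply: ler_wpM2l => //; have := poincare_K3 N Sg SG gG.
  by rewrite (Rint_Kop m3_fin mk N Ig) g0 expr0n /= mul0r subr0 -mulr_sumr.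
have cv : (\int[m3]_x (g x * K3 N g x)) ^+ 2 @[N --> \oo] --> (A : R) ^+ 2.
  have c := K3_weak Sg Sg.
  have -> : A = \int[m3]_x (g x * g x) by apply: Rint_ext => x; rewrite expr2.
  by rewrite expr2; under eq_fun do rewrite expr2; exact: (cvgM (c) (c)).
have : A ^+ 2 <= A * B.
  rewrite leNgt; apply/negP => lt.
  have d0 : 0 < (A ^+ 2 - A * B) / 2 by rewrite divr_gt0 // subr_gt0.
  have [n _ /(_ n (leqnn n))] := cvg_near cv d0.
  by rewrite /= ler_norml => /andP[H1 _]; have := bound n; lra.
have [->//|An] := eqVneq A 0.
by rewrite expr2 ler_pM2l // lt_neqAle eq_sym An.
Qed.

End TorusWeakDerivatives.

(** * Time-periodic functions on windows of several periods *)

Section PeriodicFunctions.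
Context {R : realType}.
Implicit Types a b c T : R.

Lemma mI_split a b c (f : measurableTypeR R -> R) : a <= b -> b <= c -> intble (mI a c) f ->
  \int[mI a c]_x f x = \int[mI a b]_x f x + \int[mI b c]_x f x.
Proof.
move=> ab bc If; have mf := intble_meas If.
rewrite !mI_Rint //.
have := proj1 (mI_intble a c mf) If => /(@Rintegral_itvB _ _ _ _ b).
rewrite !bnd_simp => /(_ ab bc) /eqP; rewrite subr_eq addrC => /eqP ->; congr (_ + _).
rewrite Rintegral_itv_obnd_cbnd //.
apply: integrableS (proj1 (mI_intble _ _ mf) If) => // x /=; rewrite !in_itv /=.
by move=> /andP[/ltW /(le_trans ab) -> ->].
Qed.

Lemma mI_split_ge0 a b c (f : measurableTypeR R -> \bar R) : a <= b -> b <= c ->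
  measurable_fun setT f -> (forall x, 0 <= f x)%E ->
  (\int[mI a c]_x f x <= \int[mI a b]_x f x + \int[mI b c]_x f x)%E.
Proof.
move=> ab bc mf f0; rewrite !mI_integral //.
rewrite (@itv_bndbnd_setU _ _ _ (BRight b)) ?bnd_simp //.
rewrite ge0_integral_setU //=.
- apply: leeD => //; apply: ge0_subset_integral => //.
    exact: measurable_funTS.
  by move=> x /=; rewrite !in_itv /= => /andP[/ltW -> ->].
- exact: measurable_funTS.
- apply/disj_setPS => x [] /=; rewrite !in_itv /= => /andP[_ xb] /andP[bx _].
  by move: (le_lt_trans xb bx); rewrite ltxx.
Qed.

Variable T : R.
Hypothesis T0 : 0 < T.

Let nT n : n.+1%:R * T = n%:R * T + T.
Proof. by rewrite -natr1 mulrDl mul1r. Qed.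

Let nT0 n : 0 <= n%:R * T.
Proof. by rewrite mulr_ge0 // ltW. Qed.

Lemma periodic_natmul (A : Type) (f : R -> A) : (forall t, f (t + T) = f t) ->
  forall n t, f (t + n%:R * T) = f t.
Proof.
move=> fT; elim=> [|n IH] t; first by rewrite mul0r addr0.
by rewrite nT addrA fT IH.
Qed.

Lemma periodic_integral (f : measurableTypeR R -> \bar R) n :
  measurable_fun setT f -> (forall x, 0 <= f x)%E -> (forall t, f (t + T) = f t) ->
  (\int[mI 0 T]_x f x < +oo)%E -> (\int[mI 0 (n%:R * T)]_x f x < +oo)%E.
Proof.
move=> mf f0 fT foo; elim: n => [|n IH].
  by rewrite mul0r mI_integral // set_itv1 integral_set1.
apply: le_lt_trans (mI_split_ge0 (nT0 n) _ mf f0) _; first by rewrite nT lerDl ltW.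
apply: lte_add_pinfty => //; rewrite nT; have -> : n%:R * T = 0 + n%:R * T by rewrite add0r.
rewrite [X in mI _ X](_ : _ = T + n%:R * T); last by ring.
rewrite -(mp_ge0 (measurable_translation _) (fun A mA => mI_translation _ _ _ mA) mf f0).
by under eq_integral do rewrite periodic_natmul //.
Qed.

Lemma Rint_periods (f : measurableTypeR R -> R) n : intble (mI 0 (n%:R * T)) f ->
  \int[mI 0 (n%:R * T)]_x f x = \sum_(k < n) \int[mI 0 T]_x f (x + k%:R * T).
Proof.
elim: n => [|n IH] If.
  rewrite mul0r big_ord0 mI_Rint ?set_itv1 ?Rintegral_set1 //; exact: intble_meas If.
have le : n%:R * T <= n.+1%:R * T by rewrite nT lerDl ltW.
rewrite big_ord_recr /= (mI_split (nT0 n) le If) -IH; last exact: intble_mI_sub If.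
congr (_ + _).
have E1 : n.+1%:R * T = T + n%:R * T by rewrite nT addrC.
have E0 : n%:R * T = 0 + n%:R * T by rewrite add0r.
rewrite mI_shift_Rint -?E1 -?E0 //.
exact: intble_mI_sub If.
Qed.

Lemma intble_period (f : measurableTypeR R -> R) n k : (k < n)%N -> intble (mI 0 (n%:R * T)) f ->
  intble (mI 0 T) (fun x => f (x + k%:R * T)).
Proof.
move=> kn If; apply: mI_shift_intble; apply: intble_mI_sub If; first by rewrite add0r.
by rewrite addrC -nT ler_wpM2r ?ler_nat // ltW.
Qed.

Lemma ae_windows (P : R -> Prop) : (forall n, {ae mI 0 (n%:R * T), forall x, P x}) ->
  {ae @lebesgue_measure R, forall x : measurableTypeR R, 0 <= x -> P x}.
Proof.
move=> H.
have H1 : {ae @lebesgue_measure R, forall (x : measurableTypeR R) n, x \in `[0, n%:R * T] -> P x}.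
  apply: ae_all_nat => n.
  exact: (proj1 (@restr_ae _ (measurableTypeR R) R (@lebesgue_measure R) (mI 0 (n%:R * T)) _
    (measurable_itv `[0, n%:R * T]) (fun A mA => mIE _ _ A) P) (H n)).
move: H1; apply: filterS => x Hx x0.
have [n Hn] : exists n : nat, x / T <= n%:R.
  by have /ltW := truncnS_gt (x / T); exists (Num.truncn (x / T)).+1.
by apply: (Hx n); rewrite in_itv /= x0 -ler_pdivrMr.
Qed.

(** The half-line is covered by countably many translates of one period, on each of which P holds
    almost everywhere. *)
Lemma periodic_ae (P : R -> Prop) : (forall t, P (t + T) <-> P t) ->
  {ae mI 0 T, forall x, P x} -> {ae @lebesgue_measure R, forall x : measurableTypeR R, 0 <= x -> P x}.
Proof.
move=> PT H.
have PE : forall k t, P (t + k%:R * T) <-> P t.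
  move=> k t; have := @periodic_natmul _ P _ k t; move=> -> //.
  by move=> s; apply/propext; exact: PT.
have H1 : {ae @lebesgue_measure R, forall (x : measurableTypeR R) n,
    x \in `[n%:R * T, n.+1%:R * T] -> P x}.
  apply: ae_all_nat => n.
  apply: (proj1 (@restr_ae _ (measurableTypeR R) R (@lebesgue_measure R) (mI (n%:R * T) (n.+1%:R * T)) _
    (measurable_itv `[n%:R * T, n.+1%:R * T]) (fun A mA => mIE _ _ A) P)).
  apply: (ae_imp (P := fun x : measurableTypeR R => P (x + - (n%:R * T)))) => [|x].
    apply: mI_shift_ae; rewrite subrr nT; have -> // : n%:R * T + T - n%:R * T = T by ring.
  by rewrite -(PE n) subrK.
move: H1; apply: filterS => x Hx x0.
apply: (Hx (Num.truncn (x / T))).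
have xT0 : 0 <= x / T by rewrite divr_ge0 // ltW.
have /andP[h1 h2] := truncn_itv xT0.
by rewrite in_itv /= -ler_pdivlMr // h1 -ler_pdivrMr // ltW.
Qed.

End PeriodicFunctions.

(** * Space-time windows and mollification over one period *)

Section SpaceTime.
Context d1 d2 (X : measurableType d1) (Y : measurableType d2) (R : realType).
Variables (mu : {sigma_finite_measure set X -> \bar R})
          (nu : {sigma_finite_measure set Y -> \bar R}).

Lemma sqint_tonelli (u : X * Y -> R) : measurable_fun setT u ->
  (\int[mu]_x \int[nu]_y (u (x, y) ^+ 2)%:E < +oo)%E -> sqint (sprod mu nu) u.
Proof.
move=> m H; split=> //; apply/integrableP; split; first exact/measurable_EFinP/measurable_funX.
have E : (\int[sprod mu nu]_z `|(EFin \o (fun x : X * Y => (u x ^+ 2)%R)) z| =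
   \int[mu]_x \int[nu]_y (u (x, y) ^+ 2)%:E)%E.
  rewrite /sprod fubini_tonelli1 /=.
  - apply: eq_integral => x _; rewrite /fubini_F; apply: eq_integral => y _ /=.
    by rewrite ger0_norm // sqr_ge0.
  - have mE : measurable_fun setT (EFin \o (fun z : X * Y => (u z ^+ 2)%R)).
      exact/measurable_EFinP/measurable_funX.
    exact: (measurableT_comp (@abse_measurable R _ ) mE).
  - by move=> z; rewrite lee_fin normr_ge0.
by rewrite E.
Qed.

Lemma sqint_slice1 (u : X * Y -> R) : sqint (sprod mu nu) u -> {ae mu, forall x, sqint nu (fun y => u (x, y))}.
Proof.
move=> [m If]; apply: (ae_imp (intble_fub1 If)) => x H; split=> //.
exact: measurableT_comp m (pair1_measurable x).
Qed.

End SpaceTime.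

Section SpaceTimeWindows.
Context {R : realType}.

Lemma intble_m4_sub (a b c d : R) (f : mst R -> R) : c <= a -> b <= d ->
  intble (m4 c d) f -> intble (m4 a b) f.
Proof.
move=> ca bd If; have mf := intble_meas If.
have RI a' b' := @restr_intble _ _ R leb4 (m4 a' b') _
  (measurableX (measurable_itv `[a', b']) measurable_T3) (@m4E R a' b') f mf.
apply/RI; move/RI : If => If; apply: integrableS If.
- exact: (measurableX (measurable_itv `[c, d]) measurable_T3).
- exact: (measurableX (measurable_itv `[a, b]) measurable_T3).
- move=> [t x] /= [+ Tx]; rewrite !in_itv /= => /andP[at' tb]; split=> //=.
  by rewrite (le_trans ca at') (le_trans tb bd).
Qed.

Definition tshift (h : R) (z : mst R) : mst R := (z.1 + h, z.2).

Lemma tshift_meas h : measurable_fun setT (tshift h).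
Proof.
apply/measurable_fun_pairP; split; last exact: measurable_snd.
exact: (measurableT_comp (measurable_translation h) measurable_fst).
Qed.

Lemma m4_translation (a b h : R) A : measurable A ->
  m4 a b (tshift h @^-1` A) = m4 (a + h) (b + h) A.
Proof.
move=> mA.
have mx := measurable_fun_xsection m3 mA.
exact: (mp_ge0 (measurable_translation h) (fun B mB => mI_translation a b h mB) mx).
Qed.

Lemma intble_tshift (a b h : R) (f : mst R -> R) : intble (m4 (a + h) (b + h)) f ->
  intble (m4 a b) (fun z => f (tshift h z)).
Proof. exact: (mp_intble (tshift_meas h) (@m4_translation a b h)). Qed.

Variable T : R.
Hypothesis T0 : 0 < T.

Lemma intble_window (f : mst R -> R) n k : (k < n)%N -> intble (m4 0 (n%:R * T)) f ->
  intble (m4 0 T) (fun z => f (tshift (k%:R * T) z)).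
Proof.
move=> kn If; apply: intble_tshift; apply: intble_m4_sub If.
  by rewrite add0r mulr_ge0 // ltW.
have -> : T + k%:R * T = k.+1%:R * T by rewrite -natr1; ring.
by rewrite ler_wpM2r ?ler_nat // ltW.
Qed.

Lemma sqint_window (f : mst R -> R) n k : (k < n)%N -> sqint (m4 0 (n%:R * T)) f ->
  sqint (m4 0 T) (fun z => f (tshift (k%:R * T) z)).
Proof.
move=> kn [mf If]; split; first exact: measurableT_comp mf (tshift_meas _).
exact: (intble_window kn If).
Qed.

Lemma Rint4_periods (f : mst R -> R) n : intble (m4 0 (n%:R * T)) f ->
  \int[m4 0 (n%:R * T)]_z f z = \sum_(k < n) \int[m4 0 T]_z f (tshift (k%:R * T) z).
Proof.
move=> If; have [I1 <-] := Rint_fub1 If; rewrite Rint_periods //.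
apply: eq_bigr => k _.
by have [_ <-] := Rint_fub1 (intble_window (ltn_ord k) If).
Qed.

Definition tperiodic (g : st R -> R) : Prop := forall t x, g (t + T, x) = g (t, x).

Lemma sqint_periodic (g : mst R -> R) n : measurable_fun setT g -> tperiodic g ->
  (\int[mI 0 T]_t \int[m3]_x (g (t, x) ^+ 2)%:E < +oo)%E -> sqint (m4 0 (n%:R * T)) g.
Proof.
move=> mg gT foo; apply: sqint_tonelli => //.
apply: (@periodic_integral R T T0 (fun t => (\int[m3]_x (g (t, x) ^+ 2)%:E)%E)) => //.
- have mE : measurable_fun setT (fun z : mst R => (g z ^+ 2)%:E).
    exact/measurable_EFinP/measurable_funX.
  have g0 (z : mst R) : (0 <= (g z ^+ 2)%:E)%E by rewrite lee_fin sqr_ge0.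
  exact: measurable_fun_fubini_tonelli_F mE g0.
- by move=> t; apply: integral_ge0 => x _; rewrite lee_fin sqr_ge0.
- by move=> t; apply: eq_integral => x _; rewrite gT.
Qed.

(** Mollification on the product of the torus and the time circle: it integrates over one period,
    but its values are T-periodic on all of time. *)
Definition K4 N (g : st R -> R) : st R -> R := Kop (m4 0 T) (e4 T) N g.

Let mk := proj1 (e4_approx T0).
Let fin := @m4_fin R 0 T.

Lemma K4_smooth N g : smooth (K4 N g).
Proof. by apply: smooth_lincomb => a; exact: e4_smooth. Qed.

Lemma K4_meas N g : measurable_fun setT (K4 N g : mst R -> R).
Proof. exact: (Kop_meas mk). Qed.

Lemma K4_bdd N g : exists M, forall z, `|K4 N g z| <= M.
Proof. exact: (Kop_bdd mk). Qed.

Lemma K4_tperiodic N g : tperiodic (K4 N g).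
Proof. by move=> t x; apply: eq_bigr => a _; congr (_ * _); have [_ _] := e4_test a T0. Qed.

Lemma K4_periodic3 N g t : periodic3 (fun x => K4 N g (t, x)).
Proof.
move=> i x; apply: eq_bigr => a _; congr (_ * _).
by have [_ H _] := e4_test a T0; exact: H.
Qed.

Lemma K4_mul_intble N g a b (h : mst R -> R) : intble (m4 a b) h ->
  intble (m4 a b) (fun z => h z * K4 N g z).
Proof.
move=> Ih; have [M HM] := K4_bdd N g.
by apply: (intble_mul_bdd Ih (K4_meas N g) (M := M)); exact: aeW.
Qed.

(** Here h need not be periodic. A window of n periods is cut into single ones, where the translates
    of h are paired with the same periodic g. *)
Lemma K4_windows (h g : mst R -> R) n :
  (forall N, intble (m4 0 (n%:R * T)) (fun z => h z * K4 N g z)) ->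
  intble (m4 0 (n%:R * T)) (fun z => h z * g z) -> tperiodic g ->
  (forall k, (k < n)%N -> \int[m4 0 T]_z (h (tshift (k%:R * T) z) * K4 N g z) @[N --> \oo] -->
     \int[m4 0 T]_z (h (tshift (k%:R * T) z) * g z)) ->
  \int[m4 0 (n%:R * T)]_z (h z * K4 N g z) @[N --> \oo] --> \int[m4 0 (n%:R * T)]_z (h z * g z).
Proof.
move=> I1 I2 gT H.
have P (f : st R -> R) k z : tperiodic f -> f (tshift (k%:R * T) z) = f z.
  move=> fT; case: z => t x; rewrite /tshift /=.
  exact: (@periodic_natmul _ T _ (fun t => f (t, x)) (fun t => fT t x)).
have E1 N (k : 'I_n) : \int[m4 0 T]_z (h (tshift (k%:R * T) z) * K4 N g (tshift (k%:R * T) z)) =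
  \int[m4 0 T]_z (h (tshift (k%:R * T) z) * K4 N g z).
  by apply: Rint_ext => z; rewrite (P _ _ _ (K4_tperiodic N g)).
have E2 (k : 'I_n) : \int[m4 0 T]_z (h (tshift (k%:R * T) z) * g (tshift (k%:R * T) z)) =
  \int[m4 0 T]_z (h (tshift (k%:R * T) z) * g z).
  by apply: Rint_ext => z; rewrite (P _ _ _ gT).
have EN : (fun N => \int[m4 0 (n%:R * T)]_z (h z * K4 N g z)) =
   fun N => \sum_(k < n) \int[m4 0 T]_z (h (tshift (k%:R * T) z) * K4 N g z).
  by apply/funext => N; rewrite (Rint4_periods (I1 N)); apply: eq_bigr => k _; exact: E1.
rewrite EN (Rint4_periods I2) (eq_bigr _ (fun k _ => E2 k)).
apply: cvg_Rsum => k; exact: H.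
Qed.

Lemma K4_weak (h g : mst R -> R) n : sqint (m4 0 (n%:R * T)) h -> sqint (m4 0 (n%:R * T)) g ->
  sqint (m4 0 T) g -> tperiodic g ->
  \int[m4 0 (n%:R * T)]_z (h z * K4 N g z) @[N --> \oo] --> \int[m4 0 (n%:R * T)]_z (h z * g z).
Proof.
move=> Sh Sg Sg0 gT; apply: K4_windows => //.
- by move=> N; apply: K4_mul_intble; apply: sqint_intble Sh; exact: m4_fin.
- exact: sqint_mul.
- move=> k kn; apply: (Kop_weak_L2 fin mk (e4_approx T0)) => //; exact: (sqint_window kn Sh).
Qed.

Lemma K4_weak_bdd (h g : mst R -> R) (M : R) n : intble (m4 0 (n%:R * T)) h ->
  measurable_fun setT g -> {ae m4 0 T, forall z, `|g z| <= M} ->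
  {ae m4 0 (n%:R * T), forall z, `|g z| <= M} -> tperiodic g ->
  \int[m4 0 (n%:R * T)]_z (h z * K4 N g z) @[N --> \oo] --> \int[m4 0 (n%:R * T)]_z (h z * g z).
Proof.
move=> Ih mg gM gM' gT; apply: K4_windows => //.
- by move=> N; exact: K4_mul_intble.
- exact: (intble_mul_bdd Ih mg gM').
- move=> k kn; apply: (Kop_weak_Linf fin mk (e4_approx T0) _ mg gM) => //.
  exact: (intble_window kn Ih).
Qed.

Definition wderiv4 (d : st R) (u g : st R -> R) : Prop :=
  forall N (a : I4 N), \int[m4 0 T]_z (u z * 'D_d (e4 T a : st R -> R) z) =
    - \int[m4 0 T]_z (g z * e4 T a z).

Lemma continuous_bdd4 (a b : R) (f : st R -> R) : continuous f ->
  exists2 M : R, 0 <= M & {ae m4 a b, forall z : st R, `|f z| <= M}.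
Proof.
move=> cf; pose D : set (st R) := `[a, b]%classic `*` T3.
have /compact_bounded [M [_ HM]] : compact (f @` D).
  apply: continuous_compact; first exact: continuous_subspaceT.
  by apply: compact_setX; [exact: segment_compact|exact: compact_T3].
exists (`|M| + 1); first by rewrite addr_ge0.
apply/(@restr_ae _ _ R leb4 (m4 a b) _
  (measurableX (measurable_itv `[a, b]) measurable_T3) (@m4E R a b)).
apply: aeW => z Dz; apply: (HM (`|M| + 1)) => /=.
  by rewrite ltr_pwDr // ler_norm.
by exists z.
Qed.

Lemma intble4_mul (a b : R) (f : st R -> R) (u : mst R -> R) : continuous f -> intble (m4 a b) u ->
  intble (m4 a b) (fun x => u x * f x).
Proof.
move=> cf Iu; have [M M0 HM] := continuous_bdd4 a b cf.
exact: (intble_mul_bdd Iu (continuous_meas4 cf) HM).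
Qed.

Lemma sqint4_mul (a b : R) (f : st R -> R) (u : mst R -> R) : continuous f -> sqint (m4 a b) u ->
  sqint (m4 a b) (fun x => u x * f x).
Proof.
move=> cf Su; have [M M0 HM] := continuous_bdd4 a b cf.
exact: (sqint_mul_bdd Su (continuous_meas4 cf) HM).
Qed.

(** No weak derivative of u is assumed. This form serves divergences, where only the sum over the
    directions is known. *)
Lemma K4_derive_gen N d (u : mst R -> R) z : intble (m4 0 T) u ->
  'D_d (K4 N u) z =
   - \sum_(a : I4 N) e4 T a z * \int[m4 0 T]_y ('D_d (e4 T a : st R -> R) y * u y).
Proof.
move=> Iu; rewrite /K4 /Kop derive_lincomb; last by move=> a; exact: e4_smooth.
apply: (@ker_swap R (st R) _ _ (m4 0 T) (fun y : mst R => (y : st R)) I4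
  (e4 T : forall N, I4 N -> st R -> R) (@e4_smooth R T) (fun N z z' w => @e4_inv R T N z z' w T0) N d z u).
- by move=> a; exact: (intble_ker mk).
- move=> a; apply: (intble_ext (f := fun y : mst R => u y * 'D_d (e4 T a : st R -> R) y)).
    by move=> y; rewrite mulrC.
  apply: intble4_mul => //; exact: (smooth_continuous (smoothD d (e4_smooth T a))).
Qed.

Lemma K4_derive N d u g z : intble (m4 0 T) u -> wderiv4 d u g ->
  'D_d (K4 N u) z = K4 N g z.
Proof.
move=> Iu ug; rewrite K4_derive_gen // -sumrN; apply: eq_bigr => a _; rewrite -mulrN; congr (_ * _).
apply/eqP; rewrite eqr_oppLR; apply/eqP.
transitivity (\int[m4 0 T]_y (u y * 'D_d (e4 T a : st R -> R) y)).
  by apply: Rint_ext => y; rewrite mulrC.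
by rewrite ug; congr (- _); apply: Rint_ext => y; rewrite mulrC.
Qed.

End SpaceTimeWindows.

(** * From space-time identities to almost every time slice *)

Section AlmostEverywhere.
Context d (X : measurableType d) (R : realType) (mu : {measure set X -> \bar R}).

Lemma ae_all_fin (I : finType) (P : I -> X -> Prop) :
  (forall i, {ae mu, forall x, P i x}) -> {ae mu, forall x i, P i x}.
Proof.
move=> H; have H1 : {ae mu, forall x (n : nat), forall i, n = enum_rank i -> P i x}.
  apply: (ae_all_nat (P := fun (n : nat) x => forall i, n = enum_rank i -> P i x)) => n; have [nI|nI] := ltnP n #|I|.
    apply: (ae_imp (H (enum_val (Ordinal nI)))) => x Px i ni.
    by have -> : i = enum_val (Ordinal nI); [rewrite -[LHS]enum_rankK; congr enum_val; exact: val_inj|].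
  by apply: aeW => x i ni; move: nI; rewrite ni leqNgt ltn_ord.
by apply: (ae_imp H1) => x Hx i; exact: (Hx (enum_rank i)).
Qed.

Lemma Rint_eq0_ae (f : X -> R) : intble mu f -> \int[mu]_x `|f x| = 0 ->
  {ae mu, forall x, f x = 0}.
Proof.
move=> If f0; have mf : measurable_fun setT (EFin \o f) := measurable_int mu If.
have /integrableP[_ foo] := If.
have : (\int[mu]_(x in setT) `|(EFin \o f) x| = 0)%E.
  rewrite -[LHS]fineK; last by rewrite ge0_fin_numE //; apply: integral_ge0.
  by congr EFin.
move/(ae_eq_integral_abs mu measurableT mf); apply: filterS => x /(_ I) /= [].
exact.
Qed.

End AlmostEverywhere.

Section Sections.
Context d1 d2 (X : measurableType d1) (Y : measurableType d2) (R : realType).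
Variables (mu : {sigma_finite_measure set X -> \bar R})
          (nu : {sigma_finite_measure set Y -> \bar R}).

Lemma ae_section1 (P : X * Y -> Prop) : {ae sprod mu nu, forall z, P z} ->
  {ae mu, forall x, {ae nu, forall y, P (x, y)}}.
Proof.
move=> [A [mA A0 PA]].
have mx := measurable_fun_xsection nu mA.
have : (\int[mu]_(x in setT) `|nu (xsection A x)| = 0)%E.
  by rewrite -[RHS]A0; apply: eq_integral => x _; rewrite gee0_abs.
move/(ae_eq_integral_abs mu measurableT mx); apply: filterS => x /(_ I) /= Hx.
exists (xsection A x); split=> //; first exact: measurable_xsection.
by move=> y /= nP; rewrite /xsection /=; apply/mem_set; exact: PA.
Qed.

End Sections.

Section TimeSlices.
Context {R : realType} (T : R).
Hypothesis T0 : 0 < T.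
Local Notation I1 := (fun N => {ffun 'I_N -> 'I_3} : finType).

(** If m is orthogonal to all the modes, its mollifications vanish, and they converge to m in
    L_1. *)
Lemma circle_determined (m : measurableTypeR R -> R) : intble (mI 0 T) m ->
  (forall N (a : I1 N), \int[mI 0 T]_t (circle_ker T a t * m t) = 0) ->
  {ae mI 0 T, forall t, m t = 0}.
Proof.
move=> Im H; apply: Rint_eq0_ae => //.
have [_ /(_ _ Im)] := circle_approx T0.
have E N : \int[mI 0 T]_x `|Kop (I := I1) (mI 0 T) (circle_ker T) N m x - m x| = \int[mI 0 T]_x `|m x|.
  apply: Rint_ext => x; rewrite /Kop big1 ?sub0r ?normrN // => a _.
  by rewrite H mulr0.
move=> c; have := cvg_eq E c; exact: esym.
Qed.

Lemma tensor_test (p : R -> R) (q : pt R -> R) : smooth p -> (forall t, p (t + T) = p t) ->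
  tsmooth q -> test_periodic T (fun z : st R => p z.1 * q z.2).
Proof.
move=> sp pT [sq qT]; split.
- apply: smooth_mul.
    by apply: (@smooth_comp_affine _ _ _ p fst fst) => // z; exact: cvg_fst.
  by apply: (@smooth_comp_affine _ _ _ q snd snd) => // z; exact: cvg_snd.
- by move=> t i x /=; rewrite qT.
- by move=> t x /=; rewrite pT.
Qed.

Lemma tensor_dx (p : R -> R) (q : pt R -> R) k (z : st R) : smooth p -> smooth q ->
  'D_(dx k) (fun z : st R => p z.1 * q z.2) z = p z.1 * 'D_(basis3 k) q z.2.
Proof.
move=> sp sq.
have s1 : smooth (fun z : st R => p z.1).
  by apply: (@smooth_comp_affine _ _ _ p fst fst) => // w; exact: cvg_fst.
have s2 : smooth (fun z : st R => q z.2).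
  by apply: (@smooth_comp_affine _ _ _ q snd snd) => // w; exact: cvg_snd.
rewrite (derive_mul _ _ s1 s2).
rewrite (@derive_comp_affine _ _ _ q snd snd) // (@derive_comp_affine _ _ _ p fst fst) //=.
by rewrite derive0 mulr0 addr0.
Qed.

Lemma tensor_dt (p : R -> R) (q : pt R -> R) (z : st R) : smooth p -> smooth q ->
  'D_dt (fun z : st R => p z.1 * q z.2) z = 'D_1 p z.1 * q z.2.
Proof.
move=> sp sq.
have s1 : smooth (fun z : st R => p z.1).
  by apply: (@smooth_comp_affine _ _ _ p fst fst) => // w; exact: cvg_fst.
have s2 : smooth (fun z : st R => q z.2).
  by apply: (@smooth_comp_affine _ _ _ q snd snd) => // w; exact: cvg_snd.
rewrite (derive_mul _ _ s1 s2).
rewrite (@derive_comp_affine _ _ _ q snd snd) // (@derive_comp_affine _ _ _ p fst fst) //=.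
by rewrite derive0 mulr0 add0r mulrC.
Qed.

(** Testing with products of a time mode and a space mode shows that the slice integral, as a
    function of t, is orthogonal to all time modes. There are countably many space modes [e3], so
    one null set of times serves all of them; this is why weak derivatives on slices are tested on
    [e3] only. *)
Lemma slice_weak (W : 'I_3 -> mst R -> R) (L : mst R -> R) :
  (forall k, intble (m4 0 T) (W k)) -> intble (m4 0 T) L ->
  (forall phi, test_periodic T phi ->
     \int[m4 0 T]_z (\sum_k W k z * 'D_(dx k) phi z + L z * phi z) = 0) ->
  {ae mI 0 T, forall t, forall N (b : I3 N),
     \int[m3]_x (\sum_k W k (t, x) * 'D_(basis3 k) (e3 b : pt R -> R) x + L (t, x) * e3 b x) = 0}.
Proof.
move=> IW IL H; apply: ae_all_nat => N; apply: ae_all_fin => b.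
have ts : tsmooth (e3 b : pt R -> R) := e3_tsmooth b; have se := proj1 ts.
pose Phi (z : mst R) := \sum_k W k z * 'D_(basis3 k) (e3 b : pt R -> R) z.2 + L z * e3 b z.2.
have c2 (q : pt R -> R) : smooth q -> continuous (fun z : st R => q z.2).
  move=> sq; apply: smooth_continuous.
  by apply: (@smooth_comp_affine _ _ _ q snd snd) => // w; exact: cvg_snd.
have IPhi : intble (m4 0 T) Phi.
  apply: intble_add; last exact: (intble4_mul (c2 _ se) IL).
  by apply: intble_sum => k; exact: (intble4_mul (c2 _ (smoothD (basis3 k) se)) (IW k)).
have [Im _] := Rint_fub1 IPhi.
apply: (circle_determined Im) => N' a.
have sa := @circle_ker_smooth R T N' a.
have c1 : continuous (fun z : st R => circle_ker T a z.1).
  apply: smooth_continuous.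
  by apply: (@smooth_comp_affine _ _ _ (circle_ker T a) fst fst) => // w; exact: cvg_fst.
have IPa : intble (m4 0 T) (fun z => Phi z * circle_ker T a z.1) by exact: intble4_mul.
rewrite -[RHS](H _ (tensor_test sa (circle_ker_periodic T0 a) ts)).
transitivity (\int[m4 0 T]_z (Phi z * circle_ker T a z.1)).
  have [_ <-] := Rint_fub1 IPa.
  apply: Rint_ae.
  - by apply: measurable_funM; [apply: continuous_meas; exact: smooth_continuous|exact: intble_meas Im].
  - exact: meas_fub1 IPa.
  - apply: (ae_imp (intble_fub1 IPhi)) => t It; rewrite -Rint_scale //.
    by apply: Rint_ext => x; rewrite mulrC.
apply: Rint_ext => z; rewrite /Phi mulrDl mulr_suml; congr (_ + _); last by ring.
by apply: eq_bigr => k _; rewrite tensor_dx //; ring.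
Qed.

End TimeSlices.

(** * A smooth step function *)

Section FlatFunctions.
Context {R : realType}.

(* p(1/x) exp(-1/x) for x > 0, extended by 0; differentiation maps p to X^2 (p - p'). *)
Definition flat (p : {poly R}) (x : R) : R :=
  if 0 < x then p.[x^-1] * expR (- x^-1) else 0.

Lemma poly_growth (p : {poly R}) : exists C n, 0 <= C /\ forall y : R, 1 <= y -> `|p.[y]| <= C * y ^+ n.
Proof.
elim/poly_ind: p => [|p c [C [n [C0 H]]]].
  by exists 0, 0%N; split=> // y _; rewrite horner0 normr0 mul0r.
exists (C + `|c|), n.+1; split=> [|y y1]; first exact: addr_ge0.
have y0 : 0 <= y := le_trans ler01 y1.
rewrite hornerMXaddC mulrDl; apply: le_trans (ler_normD _ _) _; apply: lerD.
  by rewrite normrM (ger0_norm y0) exprS mulrCA mulrC; apply: ler_wpM2l => //; exact: H.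
by rewrite ler_peMr // exprn_ege1.
Qed.

(** With y = 1/x and p of growth y^n, the bound exp y >= y^(n+2) / (n+2)! leaves a factor y^-2. Two
    powers are asked for so that the derivative at 0 vanishes. *)
Lemma flat_quadratic (p : {poly R}) : exists2 C, 0 <= C & forall x, x <= 1 -> `|flat p x| <= C * x ^+ 2.
Proof.
have [C [n [C0 H]]] := poly_growth p.
exists (C * (n.+2)`!%:R); first by rewrite mulr_ge0.
move=> x x1; rewrite /flat; case: ltP => [x0|x0]; last first.
  by rewrite normr0 mulr_ge0 ?sqr_ge0 // mulr_ge0.
have y1 : 1 <= x^-1 by rewrite invf_ge1.
rewrite normrM (ger0_norm (expR_ge0 _)) expRN.
set y := x^-1 in y1 *; have y0 : 0 < y := lt_le_trans ltr01 y1.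
have -> : x = y^-1 by rewrite /y invrK.
have h1 := expR_ge1Dxn n.+1 (ltW y0).
have h2 : y ^+ n.+2 / (n.+2)`!%:R <= expR y by apply: le_trans h1; rewrite lerDr.
rewrite ler_pdivrMr ?expR_gt0 //.
apply: le_trans (H _ y1) _; rewrite -!mulrA; apply: ler_wpM2l => //.
have f0 : 0 < (n.+2)`!%:R :> R by rewrite ltr0n fact_gt0.
have -> : y ^+ n = (n.+2)`!%:R * (y^-1 ^+ 2 * (y ^+ n.+2 / (n.+2)`!%:R)).
  by rewrite -addn2 exprD exprVn; field; rewrite !gt_eqF.
apply: ler_wpM2l; first exact: ltW.
by rewrite expr2 -mulrA; do 2 (apply: ler_wpM2l; first by rewrite invr_ge0 ltW).
Qed.

Lemma flat_derive (p : {poly R}) (x : R) :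
  is_derive x (1 : R) (flat p) (flat ('X ^+ 2 * (p - p^`())) x).
Proof.
have [x0|x0|->] := ltgtP x 0.
- have -> : flat ('X ^+ 2 * (p - p^`())) x = 0 by rewrite /flat ltNge ltW.
  apply: (near_eq_is_derive (f := cst 0)); rewrite ?oner_neq0 //.
  near=> y; rewrite /flat ltNge ltW //=; near: y; exact: lt_nbhsl.
- apply: (near_eq_is_derive (f := fun y : R => p.[y^-1] * expR (- y^-1))); rewrite ?oner_neq0 //.
    by near=> y; rewrite /flat ifT //; near: y; exact: lt_nbhsr.
  have xn : x != 0 by rewrite gt_eqF.
  have dV : is_derive x (1 : R) (fun y : R => y^-1) (- x ^- 2).
    have := @is_deriveV R id x 1 1 xn (is_derive_id _ _).
    by rewrite /= scaler1.
  have dp : is_derive x (1 : R) (fun y : R => p.[y^-1]) (p^`().[x^-1] * - x ^- 2).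
    have dh (y : R) : is_derive y (1 : R) (horner p) (p^`().[y]).
      apply: DeriveDef; first exact: (@derivable_horner R p y).
      by rewrite -derive1E (derivE p).
    exact: (is_derive_comp1 (dh _) dV).
  have dE : is_derive x (1 : R) (fun y : R => expR (- y^-1)) (expR (- x^-1) * - - x ^- 2).
    exact: (is_derive_comp1 (is_derive_expR _) (is_deriveN dV)).
  have H := @is_deriveM R R _ _ x 1 _ _ dp dE.
  have -> : flat ('X ^+ 2 * (p - p^`())) x =
      p.[x^-1] * (expR (- x^-1) * - - x ^- 2) + expR (- x^-1) * (p^`().[x^-1] * - x ^- 2).
    rewrite /flat x0 hornerM hornerXn hornerD hornerN -exprVn; ring.
  exact: H.
(* At 0 the quadratic bound makes the difference quotient at most C |h|. *)
- have -> : flat ('X ^+ 2 * (p - p^`())) 0 = 0 by rewrite /flat ltxx.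
  have [C C0 HC] := flat_quadratic p.
  have f0 : flat p 0 = 0 by rewrite /flat ltxx.
  have H : h^-1 *: (flat p (h *: 1 + 0) - flat p 0) @[h --> (0 : R)^'] --> (0 : R).
    apply/cvgr0Pnorm_le => e e0; near=> h.
    rewrite f0 subr0 addr0 /GRing.scale /= mulr1 normrM normfV.
    have hn : h != 0 by near: h; exact: nbhs_dnbhs_neq.
    rewrite ler_pdivrMl ?normr_gt0 //.
    have h1 : `|h| <= 1 by near: h; apply: dnbhs0_le.
    have he : `|h| <= e / (C + 1).
      by near: h; apply: dnbhs0_le; rewrite divr_gt0 // ltr_wpDl.
    apply: le_trans (HC _ (le_trans (ler_norm _) h1)) _.
    rewrite -(real_normK (num_real h)) mulrC expr2 -mulrA; apply: ler_wpM2l => //.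
    apply: le_trans (ler_wpM2r C0 he) _.
    rewrite mulrAC ler_pdivrMr ?ltr_wpDl // ler_wpM2l ?ltW //; lra.
  by split; [apply/cvg_ex; exists 0|exact: cvg_lim H].
Unshelve. all: by end_near.
Qed.

Lemma flat_smooth (p : {poly R}) : smooth (flat p).
Proof.
apply: smooth_family => [q|q].
  move=> x; apply: differentiable_continuous; apply/derivable1_diffP.
  by have [] := flat_derive q x.
by exists 1, ('X ^+ 2 * (q - q^`())) => x; rewrite mul1r; exact: flat_derive.
Qed.

(** The classical quotient rising from 0 for x <= 0 to 1 for x >= 1; the denominator is positive
    since x and 1 - x are never both nonpositive. *)
Definition step (x : R) : R := flat 1 x / (flat 1 x + flat 1 (1 - x)).

Let flat1_ge0 x : 0 <= flat 1 x.
Proof. by rewrite /flat hornerC mul1r; case: ifP => // _; exact: expR_ge0. Qed.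

Let flat1_gt0 x : 0 < x -> 0 < flat 1 x.
Proof. by move=> x0; rewrite /flat hornerC mul1r x0; exact: expR_gt0. Qed.

Let flat_le0 p x : x <= 0 -> flat p x = 0.
Proof. by move=> x0; rewrite /flat ltNge x0. Qed.

Let den_gt0 x : 0 < flat 1 x + flat 1 (1 - x).
Proof.
have [x0|x0] := ltP 0 x; first by rewrite ltr_pwDl // flat1_gt0.
by rewrite ltr_wpDl // flat1_gt0 //; lra.
Qed.

Lemma step_smooth : smooth step.
Proof.
have s2 : smooth (fun x : R => flat 1 (1 - x)).
  apply: (@smooth_comp_affine _ _ _ (flat 1) (fun x : R => 1 - x) (fun x => - x)).
  - by move=> x; apply: cvgB; [exact: cvg_cst|exact: cvg_id].
  - by move=> x h v; rewrite /GRing.scale /=; ring.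
  - exact: flat_smooth.
move=> m; apply: Ck_mul; first exact: flat_smooth.
apply: Ck_inv; first by move=> x; rewrite gt_eqF.
by apply: Ck_add; [exact: flat_smooth|exact: s2].
Qed.

Lemma step_le0 x : x <= 0 -> step x = 0.
Proof. by move=> x0; rewrite /step flat_le0 // mul0r. Qed.

Lemma step_ge1 x : 1 <= x -> step x = 1.
Proof.
move=> x1; rewrite /step [flat 1 (1 - x)]flat_le0 ?subr_le0 // addr0 divff // gt_eqF //.
by rewrite flat1_gt0 // (lt_le_trans ltr01).
Qed.

Lemma step_bounded x : `|step x| <= 1.
Proof.
have d0 := den_gt0 x.
rewrite ger0_norm; first by rewrite /step ler_pdivrMr // mul1r lerDl.
exact: divr_ge0 (ltW d0).
Qed.

End FlatFunctions.

(** * From a weak differential equation to its integrated form *)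

Section WeakDifferentialEquation.
Context {R : realType} (K : R).
Hypothesis K0 : 0 < K.
Implicit Types s t r : R.

(** As n grows this tends to the indicator of ]s, +oo[ and its derivative to the Dirac mass at s. *)
Definition cutoff s (n : nat) (r : R) : R := step (n%:R * (r - s)).

Lemma cutoff_smooth s n : smooth (cutoff s n).
Proof.
apply: (@smooth_comp_affine _ _ _ (@step R) (fun r : R => n%:R * (r - s)) (fun v => n%:R * v)).
- by move=> x; apply: cvgMr; apply: cvgB; [exact: cvg_id|exact: cvg_cst].
- by move=> x h v; rewrite /GRing.scale /=; ring.
- exact: step_smooth.
Qed.

Lemma cutoff_derive s n r : 'D_1 (cutoff s n) r = n%:R * 'D_1 (@step R) (n%:R * (r - s)).
Proof.
have d : is_derive r (1 : R) (fun r : R => n%:R * (r - s)) n%:R.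
  have H := is_deriveZ n%:R (is_deriveB (is_derive_id r (1 : R)) (is_derive_cst s r (1 : R))).
  by apply: (is_derive_eq H); rewrite subr0 /GRing.scale /= mulr1.
have [_ ->] := @is_derive_comp1 R _ (@step R) (fun r : R => n%:R * (r - s)) r 1 _ _
  (smooth_is_derive (n%:R * (r - s)) 1 (@step_smooth R)) d.
by rewrite mulrC.
Qed.

Lemma step_deriv_out (x : R) : x < 0 \/ 1 < x -> 'D_1 (@step R) x = 0.
Proof.
case=> xx.
  have H : \forall y \near x, cst 0 y = step y.
    by near=> y; rewrite step_le0 // ltW //; near: y; exact: lt_nbhsl.
  by rewrite -(near_eq_derive (1 : R) H) derive_cst.
have H : \forall y \near x, cst 1 y = step y.
  by near=> y; rewrite step_ge1 // ltW //; near: y; exact: lt_nbhsr.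
by rewrite -(near_eq_derive (1 : R) H) derive_cst.
Unshelve. all: by end_near.
Qed.

Lemma step_deriv_bound : exists2 C : R, 0 <= C & forall x, `|'D_1 (@step R) x| <= C.
Proof.
have sD := smoothD (1 : R) (@step_smooth R).
have [C C0 HC] := continuous_bounded_itv 0 1 (smooth_continuous sD).
exists C => // x; have [/andP[x0 x1]|] := boolP (0 <= x <= 1); first by apply: HC; rewrite x0.
rewrite negb_and -!ltNge => /orP[H|H]; rewrite step_deriv_out ?normr0 //; [by left|by right].
Qed.

Lemma cutoff_deriv_mass s n : 0 <= s -> s < K -> (K - s)^-1 <= n%:R ->
  \int[mI 0 K]_r 'D_1 (cutoff s n) r = 1.
Proof.
move=> s0 sK nK; rewrite FTC_smooth; [|exact: ltW|exact: cutoff_smooth].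
rewrite /cutoff step_ge1 ?step_le0 ?subr0 //.
  by rewrite mulr_ge0_le0 // sub0r oppr_le0.
by rewrite -ler_pdivrMr ?subr_gt0 // div1r.
Qed.

(** The derivative has integral 1, is bounded by n C, and lives on an interval of length 1/n to the
    right of s; there h is close to h s. *)
Lemma cutoff_deriv_cvg s (h : measurableTypeR R -> R) : 0 < s -> s < K -> {for s, continuous (h : R -> R)} ->
  intble (mI 0 K) h ->
  \int[mI 0 K]_r ('D_1 (cutoff s n) r * h r) @[n --> \oo] --> h s.
Proof.
move=> s0 sK ch Ih; apply: near_cvg => e e0.
have [C C0 HC] := step_deriv_bound.
have e1 : 0 < e / (C + 1) by rewrite divr_gt0 // ltr_wpDl.
have /cvgrPdist_le/(_ _ e1) [d /= d0 Hd] := ch.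
near=> n.
have n0 : 0 < n%:R :> R by near: n; exists 1%N => // n /= n1; rewrite ltr0n.
have nK : (K - s)^-1 <= n%:R by near: n; exact: nbhs_infty_ger.
have nd : d^-1 < n%:R by near: n; exact: nbhs_infty_gtr.
have cD : continuous (fun r : R => 'D_1 (cutoff s n) r).
  exact: (smooth_continuous (smoothD (1 : R) (cutoff_smooth s n))).
have mD := continuous_meas cD.
have ID : intble (mI 0 K) (fun r : measurableTypeR R => 'D_1 (cutoff s n) r) := continuous_intble_mI 0 K cD.
have Bd r : `|'D_1 (cutoff s n) r| <= n%:R * C.
  by rewrite cutoff_derive normrM ger0_norm // ler_wpM2l.
have IDh : intble (mI 0 K) (fun r : measurableTypeR R => 'D_1 (cutoff s n) r * h r).
  apply: (intble_ext (f := fun r : measurableTypeR R => h r * 'D_1 (cutoff s n) r)).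
    by move=> r; rewrite mulrC.
  by apply: (intble_mul_bdd Ih mD (M := n%:R * C)); exact: aeW.
have E : \int[mI 0 K]_r ('D_1 (cutoff s n) r * h r) - h s =
   \int[mI 0 K]_r ('D_1 (cutoff s n) r * h r - h s * 'D_1 (cutoff s n) r).
  rewrite Rint_sub //; last exact: intble_scale.
  by rewrite Rint_scale // cutoff_deriv_mass // ?mulr1 // ltW.
have IE : intble (mI 0 K) (fun r : measurableTypeR R => 'D_1 (cutoff s n) r * h r - h s * 'D_1 (cutoff s n) r).
  by apply: intble_sub => //; exact: intble_scale.
rewrite E; apply: le_trans (Rint_abs IE) _.
(* The error is dominated by the constant n C e / (C + 1) on [J], of length 1/n, so its integral is
   at most e. *)
pose J : set (measurableTypeR R) := `[s, s + n%:R^-1]%classic.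
have mJ : measurable J by exact: measurable_itv.
pose B (r : measurableTypeR R) : R := n%:R * C * (e / (C + 1)) * \1_J r.
have mB : measurable_fun setT B by apply: measurable_funM => //; exact: measurable_indic.
have IB : intble (mI 0 K) B.
  apply: (intble_bdd (@mI_fin R 0 K) mB (M := n%:R * C * (e / (C + 1)))); apply: aeW => r.
  have P0 : 0 <= n%:R * C * (e / (C + 1)) := mulr_ge0 (mulr_ge0 (ler0n R n) C0) (ltW e1).
  by rewrite /B normrM (ger0_norm P0) ler_piMr // indicE; case: (r \in J); rewrite ?normr1 ?normr0.
have le1 : \int[mI 0 K]_r `|'D_1 (cutoff s n) r * h r - h s * 'D_1 (cutoff s n) r| <= \int[mI 0 K]_r B r.
  apply: Rint_le => //; first exact: intble_abs.
  move=> r; rewrite (mulrC (h s)) -mulrBr normrM /B indicE.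
  have [rJ|rJ] := boolP (r \in J).
    rewrite mulr1; apply: ler_pM => //.
    rewrite distrC; apply: Hd.
    move: rJ; rewrite inE /J /= in_itv /= => /andP[sr rs].
    rewrite /ball /= distrC ger0_norm ?subr_ge0 //.
    apply: (@le_lt_trans _ _ n%:R^-1); first by rewrite lerBlDl.
    by rewrite -[d]invrK ltf_pV2 // posrE invr_gt0.
  rewrite cutoff_derive step_deriv_out ?mulr0 ?normr0 ?mul0r //.
  move: rJ; rewrite notin_setE /J /= in_itv /= => /negP; rewrite negb_and -!ltNge => /orP[H|H].
    by left; rewrite pmulr_rlt0 // subr_lt0.
  by right; rewrite mulrC -ltr_pdivrMr // div1r ltrBrDl.
apply: le_trans le1 _; rewrite Rint_scale; last first.
  apply: (intble_bdd (@mI_fin R 0 K) (M := 1)); first exact: measurable_indic.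
  by apply: aeW => r; rewrite indicE; case: (r \in J); rewrite ?normr1 ?normr0.
have le2 : \int[mI 0 K]_r (\1_J r : R) <= n%:R^-1.
  rewrite /Rintegral integral_indic // setIT.
  rewrite -lee_fin fineK; last first.
    rewrite ge0_fin_numE //; apply: le_lt_trans (@mI_fin R 0 K).
    by apply: le_measure; rewrite ?inE.
  apply: (@le_trans _ _ (@lebesgue_measure R J)).
    by apply: le_measure; rewrite ?inE //; exact: measurableI.
  by rewrite /J lebesgue_measure_itv /= lte_fin ltrDl invr_gt0 n0 -EFinB lee_fin addrC addKr.
have P0 : 0 <= n%:R * C * (e / (C + 1)) := mulr_ge0 (mulr_ge0 (ler0n R n) C0) (ltW e1).
apply: le_trans (ler_wpM2l P0 le2) _.
have -> : n%:R * C * (e / (C + 1)) / n%:R = C * e / (C + 1).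
  by field; rewrite !gt_eqF // ltr_wpDl.
by rewrite ler_pdivrMr ?ltr_wpDl // mulrC ler_pM2l //; lra.
Unshelve. all: by end_near.
Qed.

Lemma cutoff_cvg s (g : measurableTypeR R -> R) : intble (mI 0 K) g -> 0 <= s -> s <= K ->
  \int[mI 0 K]_r (cutoff s n r * g r) @[n --> \oo] --> \int[mI s K]_r g r.
Proof.
move=> Ig s0 sK; have mg := intble_meas Ig.
have mc n := continuous_meas (smooth_continuous (cutoff_smooth s n)).
have -> : \int[mI s K]_r g r = \int[mI 0 K]_r ((if s < r then 1 else 0) * g r).
  have mif : measurable_fun setT (fun r : measurableTypeR R => (if s < r then 1 else 0 : R)).
    by apply: measurable_fun_if => //; exact: measurable_fun_ltr.
  rewrite (@mI_split R 0 s K) //; last first.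
    apply: (intble_ext (f := fun r : measurableTypeR R => g r * (if s < r then 1 else 0))).
      by move=> r; rewrite mulrC.
    by apply: (intble_mul_bdd Ig mif (M := 1)); apply: aeW => r; case: ifP; rewrite ?normr1 ?normr0.
  rewrite (_ : \int[mI 0 s]_x _ = 0) ?add0r; last first.
    transitivity (\int[mI 0 s]_x (0 : R)); last by rewrite Rintegral_cst // mul0r.
    apply: Rint_ae => //; first exact: measurable_funM.
    by apply: (ae_imp (mI_ae 0 s)) => r /andP[_ rs]; rewrite ltNge rs mul0r.
  rewrite mI_Rint // mI_Rint; last exact: measurable_funM.
  have Isg := proj1 (mI_intble s K mg) (intble_mI_sub s0 (lexx K) Ig).
  have Iog : (@lebesgue_measure R).-integrable `]s, K] (EFin \o g).
    by apply: integrableS Isg => // x /=; rewrite !in_itv /= => /andP[/ltW -> ->].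
  have Isf : (@lebesgue_measure R).-integrable `]s, K] (EFin \o (fun x => (if s < x then 1 else 0) * g x)).
    apply: eq_integrable Iog => // x; rewrite inE /= in_itv /= => /andP[-> _].
    by rewrite mul1r.
  rewrite -[LHS]Rintegral_itv_obnd_cbnd // -[RHS]Rintegral_itv_obnd_cbnd //.
  apply: eq_Rintegral => x; rewrite inE /= in_itv /= => /andP[-> _].
  by rewrite mul1r.
apply: (dominated_Rint (g := fun r : measurableTypeR R => `|g r|)).
- by move=> n; apply: measurable_funM => //; exact: mc.
- by apply: measurable_funM => //; apply: measurable_fun_if => //; exact: measurable_fun_ltr.
- apply: aeW => r; apply: cvgMl; case: ltP => sr; last first.
    have -> : (fun n => cutoff s n r) = fun=> 0; last exact: cvg_cst.
    by apply/funext => n; rewrite /cutoff step_le0 // mulr_ge0_le0 // subr_le0.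
  apply: near_cvg => e e0; near=> n.
  rewrite /cutoff step_ge1 ?subrr ?normr0 ?(ltW e0) //.
  rewrite -ler_pdivrMr ?subr_gt0 // div1r.
  by near: n; exact: nbhs_infty_ger.
- exact: intble_abs.
- move=> n; apply: aeW => r; rewrite normrM ler_piMl //; exact: step_bounded.
Unshelve. all: by end_near.
Qed.

(** The test functions are differences of two cutoffs, smooth approximations of the indicator of
    [s, t]. In the limit their derivatives give h s - h t; continuity of h at s and t is what gives
    these values a meaning. *)
Lemma weak_ode (h g : measurableTypeR R -> R) : intble (mI 0 K) h -> intble (mI 0 K) g ->
  (forall chi : R -> R, smooth chi -> (exists a b, [/\ 0 < a, b <= K & forall r, ~~ (a <= r <= b) -> chi r = 0]) ->
     \int[mI 0 K]_r ('D_1 chi r * h r) + \int[mI 0 K]_r (chi r * g r) = 0) ->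
  forall s t, 0 < s -> s <= t -> t < K -> {for s, continuous (h : R -> R)} -> {for t, continuous (h : R -> R)} ->
  h t - h s = \int[mI s t]_r g r.
Proof.
move=> Ih Ig H s t s0 st tK cs ct.
have t0 : 0 < t := lt_le_trans s0 st; have sK : s < K := le_lt_trans st tK.
have E : (\int[mI 0 K]_r ('D_1 (cutoff s n) r * h r) - \int[mI 0 K]_r ('D_1 (cutoff t n) r * h r))
   + (\int[mI 0 K]_r (cutoff s n r * g r) - \int[mI 0 K]_r (cutoff t n r * g r)) @[n --> \oo] -->
   (h s - h t) + (\int[mI s K]_r g r - \int[mI t K]_r g r).
  by apply: cvgD; apply: cvgB; [exact: cutoff_deriv_cvg..|apply: cutoff_cvg => //; exact: ltW|apply: cutoff_cvg => //; exact: ltW].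
(* For n large the difference of cutoffs is supported in [s, t + 1/n], inside ]0, K], so these terms
   vanish exactly. *)
have Z : (fun n => (\int[mI 0 K]_r ('D_1 (cutoff s n) r * h r) - \int[mI 0 K]_r ('D_1 (cutoff t n) r * h r))
   + (\int[mI 0 K]_r (cutoff s n r * g r) - \int[mI 0 K]_r (cutoff t n r * g r))) n @[n --> \oo] --> (0 : R).
  apply: near_cvg => e e0; near=> n.
  have n0 : 0 < n%:R :> R by near: n; exists 1%N => // n /= n1; rewrite ltr0n.
  have nK : (K - t)^-1 <= n%:R by near: n; exact: nbhs_infty_ger.
  pose chi r := cutoff s n r + -1 * cutoff t n r.
  have s2 : smooth (fun r : R => -1 * cutoff t n r) := smooth_mul (@smooth_cst R _ (-1)) (cutoff_smooth t n).
  have sc : smooth chi := smooth_add (cutoff_smooth s n) s2.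
  have dchi r : 'D_1 chi r = 'D_1 (cutoff s n) r - 'D_1 (cutoff t n) r.
    rewrite (derive_add _ _ (cutoff_smooth s n) s2).
    rewrite (derive_mul _ _ (@smooth_cst R _ (-1)) (cutoff_smooth t n)).
    by rewrite derive_cst mulr0 addr0 mulN1r.
  have cD u : continuous (fun r : R => 'D_1 (cutoff u n) r).
    exact: (smooth_continuous (smoothD (1 : R) (cutoff_smooth u n))).
  have I1 u : intble (mI 0 K) (fun r : measurableTypeR R => 'D_1 (cutoff u n) r * h r).
    have [M M0 HM] := continuous_bounded_itv 0 K (cD u).
    apply: (intble_ext (f := fun r : measurableTypeR R => h r * 'D_1 (cutoff u n) r)).
      by move=> r; rewrite mulrC.
    apply: (intble_mul_bdd Ih (continuous_meas (cD u)) (M := M)).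
    by apply: (ae_imp (mI_ae 0 K)) => r; exact: HM.
  have I2 u : intble (mI 0 K) (fun r : measurableTypeR R => cutoff u n r * g r).
    apply: (intble_ext (f := fun r : measurableTypeR R => g r * cutoff u n r)).
      by move=> r; rewrite mulrC.
    apply: (intble_mul_bdd Ig (continuous_meas (smooth_continuous (cutoff_smooth u n))) (M := 1)).
    by apply: aeW => r; exact: step_bounded.
  rewrite -!Rint_sub //.
  have -> : \int[mI 0 K]_r ('D_1 (cutoff s n) r * h r - 'D_1 (cutoff t n) r * h r) = \int[mI 0 K]_r ('D_1 chi r * h r).
    by apply: Rint_ext => r; rewrite dchi mulrBl.
  have -> : \int[mI 0 K]_r (cutoff s n r * g r - cutoff t n r * g r) = \int[mI 0 K]_r (chi r * g r).
    by apply: Rint_ext => r; rewrite /chi; ring.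
  rewrite (H _ sc) ?subr0 ?normr0 ?(ltW e0) //.
  exists s, (t + n%:R^-1); split=> //.
    by rewrite -lerBrDl -[K - t]invrK lef_pV2 // posrE // invr_gt0 subr_gt0.
  move=> r; rewrite negb_and -!ltNge => /orP[rs|tr].
    rewrite /chi /cutoff !step_le0 ?mulr0 ?addr0 //; rewrite mulr_ge0_le0 // subr_le0; last exact: ltW.
    exact: le_trans (ltW rs) st.
  have nt : 1 <= n%:R * (r - t) by rewrite mulrC -ler_pdivrMr // div1r lerBrDl ltW.
  rewrite /chi /cutoff !step_ge1 ?mulr1 ?subrr //.
  by apply: le_trans nt _; rewrite ler_wpM2l // lerB.
have := cvg_unique _ E Z => /(_ (@norm_hausdorff _ _)).
rewrite (mI_split st (ltW tK)); last exact: intble_mI_sub (ltW s0) (lexx K) Ig.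
by move=> /(_ _) Q; rewrite addrK in Q; lra.
Unshelve. all: by end_near.
Qed.

End WeakDifferentialEquation.

(** * Products with functions of time, and derivatives on slices *)

Section SliceIntegrals.
Context {R : realType} (a b : R).

Lemma slice_int (c : R -> R) (Phi : mst R -> R) : continuous c -> intble (m4 a b) Phi ->
  intble (m4 a b) (fun z => c z.1 * Phi z) /\
  \int[m4 a b]_z (c z.1 * Phi z) = \int[mI a b]_t (c t * \int[m3]_x Phi (t, x)).
Proof.
move=> cc IP.
have c4 : continuous (fun z : st R => c z.1).
  by move=> z; apply: (@cvg_comp _ _ _ fst c _ (nbhs z.1)); [exact: cvg_fst|exact: cc].
have Ic : intble (m4 a b) (fun z => c z.1 * Phi z).
  apply: (intble_ext (f := fun z : mst R => Phi z * c z.1)) => [z|]; first by rewrite mulrC.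
  exact: intble4_mul.
split=> //; have [_ <-] := Rint_fub1 Ic; apply: Rint_ae.
- exact: meas_fub1 Ic.
- apply: measurable_funM; [exact: continuous_meas|exact: meas_fub1 IP].
- by apply: (ae_imp (intble_fub1 IP)) => t It; rewrite -Rint_scale.
Qed.

Lemma slice_zero (c : R -> R) (Phi : mst R -> R) : continuous c -> intble (m4 a b) Phi ->
  {ae mI a b, forall t, \int[m3]_x Phi (t, x) = 0} -> \int[m4 a b]_z (c z.1 * Phi z) = 0.
Proof.
move=> cc IP H; have [_ ->] := slice_int cc IP.
transitivity (\int[mI a b]_t (0 : R)); last by rewrite Rintegral_cst // mul0r.
apply: Rint_ae => //.
  apply: measurable_funM; [exact: continuous_meas|exact: meas_fub1 IP].
by apply: (ae_imp H) => t ->; rewrite mulr0.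
Qed.

Lemma sum3 (f : 'I_3 -> R) :
  \sum_i f i = f ord0 + f (lift ord0 ord0) + f (lift ord0 (lift ord0 ord0)).
Proof. by rewrite !big_ord_recl big_ord0 addr0 addrA. Qed.

End SliceIntegrals.

Section SliceDerivative.
Context {R : realType}.

Lemma derive_slice (f : st R -> R) t j x : smooth f ->
  'D_(basis3 j) (fun y => f (t, y)) x = 'D_(dx j) f (t, x).
Proof.
move=> sf; apply: (@derive_comp_affine _ _ _ f (fun y : pt R => (t, y)) (fun v => (0, v))) => //.
by move=> y h v; transitivity ((h * 0 + t, h *: v + y) : st R) => //; rewrite mulr0 add0r.
Qed.

Lemma smooth_slice (f : st R -> R) t : smooth f -> smooth (fun y : pt R => f (t, y)).
Proof.
move=> sf; apply: (@smooth_comp_affine _ _ _ f (fun y : pt R => (t, y)) (fun v => (0, v))) => //.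
  by move=> y; exact: (cvg_pair (cvg_cst t) cvg_id).
by move=> y h v; transitivity ((h * 0 + t, h *: v + y) : st R) => //; rewrite mulr0 add0r.
Qed.

Lemma smooth_fst (c : R -> R) : smooth c -> smooth (fun z : st R => c z.1).
Proof. by move=> sc; apply: (@smooth_comp_affine _ _ _ c fst fst) => // w; exact: cvg_fst. Qed.

Lemma cut_smooth (c : R -> R) (f : st R -> R) : smooth c -> smooth f ->
  smooth (fun z : st R => c z.1 * f z).
Proof. by move=> sc sf; apply: smooth_mul => //; exact: smooth_fst. Qed.

Lemma cut_dx (c : R -> R) (f : st R -> R) j z : smooth c -> smooth f ->
  'D_(dx j) (fun z : st R => c z.1 * f z) z = c z.1 * 'D_(dx j) f z.
Proof.
move=> sc sf; rewrite (derive_mul _ _ (smooth_fst sc) sf).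
by rewrite (@derive_comp_affine _ _ _ c fst fst) //= derive0 mulr0 addr0.
Qed.

Lemma cut_dt (c : R -> R) (f : st R -> R) z : smooth c -> smooth f ->
  'D_dt (fun z : st R => c z.1 * f z) z = c z.1 * 'D_dt f z + f z * 'D_1 c z.1.
Proof.
move=> sc sf; rewrite (derive_mul _ _ (smooth_fst sc) sf).
by rewrite (@derive_comp_affine _ _ _ c fst fst).
Qed.

End SliceDerivative.

(** * Testing the weak equation of [v] with the regular field [U] *)

Section Duality.
Context {R : realType} (T : R) (n : nat) (nu M : R).
Hypothesis T0 : 0 < T.
Local Notation K := (n.+1%:R * T).
Local Notation W4 := (m4 0 K).
Variables (U Ut LU gp F v : 'I_3 -> mst R -> R) (DU Dv : 'I_3 -> 'I_3 -> mst R -> R).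
Variable p : mst R -> R.
Hypotheses (SU : forall i, sqint W4 (U i)) (SUt : forall i, sqint W4 (Ut i))
  (SLU : forall i, sqint W4 (LU i)) (Sgp : forall i, sqint W4 (gp i))
  (SF : forall i, sqint W4 (F i)) (Sv : forall i, sqint W4 (v i))
  (SDU : forall i j, sqint W4 (DU i j)) (SDv : forall i j, sqint W4 (Dv i j)) (Sp : sqint W4 p).
Hypotheses (pU : forall i, tperiodic T (U i)) (pUt : forall i, tperiodic T (Ut i))
  (pLU : forall i, tperiodic T (LU i)) (pDU : forall i j, tperiodic T (DU i j)).
Hypothesis UM : forall i, {ae W4, forall z, `|U i z| <= M}.
Hypothesis wdt : forall i, wderiv4 T dt (U i) (Ut i).
Hypothesis wdx : forall i j, wderiv4 T (dx j) (U i) (DU i j).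
Hypothesis lap4 : forall i N (a : I4 N),
  \int[m4 0 T]_z (\sum_j DU i j z * 'D_(dx j) (e4 T a : st R -> R) z) =
  - \int[m4 0 T]_z (LU i z * e4 T a z).
Hypothesis solU : forall t, sol3 (slice U t).
Hypothesis solv : {ae mI 0 K, forall t, sol3 (slice v t)}.
Hypothesis wdU : {ae mI 0 K, forall t, forall i j, wderiv j (slice U t i) (fun x => DU i j (t, x))}.
Hypothesis wdv : {ae mI 0 K, forall t, forall i j, wderiv j (slice v t i) (fun x => Dv i j (t, x))}.
Hypothesis wdp : {ae mI 0 K, forall t, forall i, wderiv i (fun x => p (t, x)) (slice gp t i)}.
Hypothesis lap3 : {ae mI 0 K, forall t, forall i N (a : I3 N),
  \int[m3]_x (\sum_j DU i j (t, x) * 'D_(basis3 j) (e3 a : pt R -> R) x) =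
  - \int[m3]_x (slice LU t i x * e3 a x)}.
Hypothesis eqn : forall i, {ae W4, forall z,
  Ut i z + \sum_j U j z * DU i j z - nu * LU i z + gp i z = F i z}.
Hypothesis weak : forall phi : 'I_3 -> st R -> R,
  (forall i, smooth (phi i)) -> (forall i t, periodic3 (slice phi t i)) ->
  (forall t, divergence_free (slice phi t)) ->
  (exists a b : R, [/\ 0 < a, b <= K & forall i t x, ~~ (a <= t <= b) -> phi i (t, x) = 0]) ->
  \int[W4]_z (\sum_i (v i z * 'D_dt (phi i) z
       + \sum_j v j z * v i z * 'D_(dx j) (phi i) z
       + nu * v i z * (\sum_j 'D_(dx j) (fun z => 'D_(dx j) (phi i) z) z)
       + F i z * phi i z)) = 0.

Let TK : T <= K.
Proof. by rewrite -[X in X <= _]mul1r; apply: ler_wpM2r; [exact: ltW|rewrite ler1n]. Qed.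

Let toT f : intble W4 f -> intble (m4 0 T) f.
Proof. by apply: intble_m4_sub TK. Qed.

Let toTs f : sqint W4 f -> sqint (m4 0 T) f.
Proof. by move=> [mf If]; split=> //; exact: toT. Qed.

Let i4 f : sqint W4 f -> intble W4 f.
Proof. by apply: sqint_intble; exact: m4_fin. Qed.

Let UM1 i : {ae m4 0 T, forall z, `|U i z| <= M}.
Proof.
have HK : 0 <= K by rewrite mulr_ge0 // ltW.
have rK a b := @restr_ae _ _ R leb4 (m4 a b) _ (measurableX (measurable_itv `[a, b]) measurable_T3) (@m4E R a b).
apply/rK; have /rK H := UM i.
apply: (ae_imp H) => z Hz [+ zT]; rewrite /= in_itv /= => /andP[z0 zt]; apply: Hz; split=> //=.
by rewrite in_itv /= z0 (le_trans zt).
Qed.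

Let KU N i z : 'D_dt (K4 T N (U i)) z = K4 T N (Ut i) z.
Proof. exact: (K4_derive T0 _ _ (toT (i4 (SU i))) (wdt i)). Qed.

Let KD N i j z : 'D_(dx j) (K4 T N (U i)) z = K4 T N (DU i j) z.
Proof. exact: (K4_derive T0 _ _ (toT (i4 (SU i))) (wdx i j)). Qed.

(** Only the weak divergence [LU] of [DU] is known, not the separate second derivatives; all
    derivatives go onto the kernel, and the sum over j is then [lap4]. *)
Let KL N i z : \sum_j 'D_(dx j) (K4 T N (DU i j)) z = K4 T N (LU i) z.
Proof.
under eq_bigr => j _ do rewrite (K4_derive_gen T0 _ _ _ (toT (i4 (SDU i j)))).
rewrite sumrN exchange_big /= -sumrN; apply: eq_bigr => a _.
rewrite -mulr_sumr -mulrN; congr (_ * _).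
have I1 j : intble (m4 0 T) (fun y => DU i j y * 'D_(dx j) (e4 T a : st R -> R) y).
  apply: intble4_mul (toT (i4 (SDU i j))); exact: (smooth_continuous (smoothD (dx j) (e4_smooth T a))).
apply/eqP; rewrite eqr_oppLR; apply/eqP.
transitivity (\sum_j \int[m4 0 T]_y (DU i j y * 'D_(dx j) (e4 T a : st R -> R) y)).
  by apply: eq_bigr => j _; apply: Rint_ext => y; rewrite mulrC.
rewrite -Rint_sum // lap4; congr (- _); apply: Rint_ext => y; exact: mulrC.
Qed.

(** After moving the derivatives onto the kernel, each mode tests the divergence of [U] on every
    time slice. *)
Let Kdiv N z : \sum_i 'D_(dx i) (K4 T N (U i)) z = 0.
Proof.
under eq_bigr => j _ do rewrite (K4_derive_gen T0 _ _ _ (toT (i4 (SU j)))).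
rewrite sumrN exchange_big /= -sumrN big1 // => a _.
have I1 j : intble (m4 0 T) (fun y => U j y * 'D_(dx j) (e4 T a : st R -> R) y).
  apply: intble4_mul (toT (i4 (SU j))); exact: (smooth_continuous (smoothD (dx j) (e4_smooth T a))).
rewrite -mulr_sumr.
have -> : \sum_j \int[m4 0 T]_y ('D_(dx j) (e4 T a : st R -> R) y * U j y) = 0; last by rewrite mulr0 oppr0.
transitivity (\sum_j \int[m4 0 T]_y (U j y * 'D_(dx j) (e4 T a : st R -> R) y)).
  by apply: eq_bigr => j _; apply: Rint_ext => y; rewrite mulrC.
rewrite -Rint_sum //; have [_ <-] := Rint_fub1 (intble_sum (index_enum _) I1).
transitivity (\int[mI 0 T]_t (0 : R)); last by rewrite Rintegral_cst // mul0r.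
apply: Rint_ext => t; rewrite -[RHS](solU t (psi := fun y => e4 T a (t, y))).
  by apply: Rint_ext => x; apply: eq_bigr => j _; rewrite derive_slice //; exact: e4_smooth.
split; first by apply: smooth_slice; exact: e4_smooth.
by have [_ H _] := e4_test a T0; exact: H.
Qed.

Section Cutoff.
Variable chi : R -> R.
Hypothesis schi : smooth chi.
Hypothesis supp : exists a b, [/\ 0 < a, b <= K & forall r, ~~ (a <= r <= b) -> chi r = 0].

Let cchi : continuous chi := smooth_continuous schi.
Let cdchi : continuous (fun r : R => 'D_1 chi r) := smooth_continuous (smoothD (1 : R) schi).

Let i4m f g : sqint W4 f -> sqint W4 g -> intble W4 (fun z => f z * g z).
Proof. exact: sqint_mul. Qed.

(** The field chi(t) [K4 T N (U i)] is an admissible test field: smooth, periodic in space,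
    divergence-free and supported in time inside the window. *)
Let tested N :
  \int[W4]_z (\sum_i (v i z * (chi z.1 * K4 T N (Ut i) z + K4 T N (U i) z * 'D_1 chi z.1)
     + \sum_j v j z * v i z * (chi z.1 * K4 T N (DU i j) z)
     + nu * v i z * (chi z.1 * K4 T N (LU i) z)
     + F i z * (chi z.1 * K4 T N (U i) z))) = 0.
Proof.
have sK g := K4_smooth T N g.
rewrite -[RHS](weak (phi := fun i z => chi z.1 * K4 T N (U i) z)).
- apply: Rint_ext => z; apply: eq_bigr => i _.
  have D1 : (fun z => chi z.1 * K4 T N (U i) z) =1 (fun z => chi z.1 * K4 T N (U i) z) by [].
  have E j : (fun z => 'D_(dx j) (fun z => chi z.1 * K4 T N (U i) z) z) =
     (fun z => chi z.1 * K4 T N (DU i j) z).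
    by apply/funext => y; rewrite cut_dx // KD.
  congr (_ + _ + _ + _).
  + by rewrite cut_dt // KU.
  + by apply: eq_bigr => j _; rewrite cut_dx // KD.
  + congr (_ * _); rewrite -KL mulr_sumr; apply: eq_bigr => j _.
    by rewrite E cut_dx.
- by move=> i; exact: cut_smooth.
- by move=> i t k x; rewrite /slice /=; congr (_ * _); exact: K4_periodic3.
- move=> t x.
  transitivity (\sum_i chi t * 'D_(dx i) (K4 T N (U i)) (t, x)); last by rewrite -mulr_sumr Kdiv mulr0.
  apply: eq_bigr => i _; rewrite /slice.
  rewrite (@derive_slice _ (fun z => chi z.1 * K4 T N (U i) z)) ?cut_dx //.
  exact: cut_smooth.
- have [a [b [a0 bK H]]] := supp; exists a, b; split=> // i t x tab.
  by rewrite /= H // mul0r.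
Qed.

(** [E] and [C] are the convective terms of v and [U]; [D] is the viscous cross term. *)
Let E i (z : mst R) := \sum_j v j z * Dv i j z.
Let C i (z : mst R) := \sum_j U j z * DU i j z.
Let D i (z : mst R) := \sum_j DU i j z * Dv i j z.

Let IE i : intble W4 (E i). Proof. by apply: intble_sum => j; exact: sqint_mul. Qed.
Let ID i : intble W4 (D i). Proof. by apply: intble_sum => j; exact: sqint_mul. Qed.
Let SC i : sqint W4 (C i).
Proof.
apply: sqint_sum => j; apply: (sqint_ext (f := fun z => DU i j z * U j z)) => [z|].
  exact: mulrC.
by apply: (sqint_mul_bdd (SDU i j) _ (UM j)); case: (SU j).
Qed.

Let IU i f : intble W4 f -> intble W4 (fun z => f z * U i z).
Proof. by move=> If; apply: (intble_mul_bdd If _ (UM i)); case: (SU i). Qed.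

Let Ic f : intble W4 f -> intble W4 (fun z => chi z.1 * f z).
Proof. by move=> If; have [] := slice_int cchi If. Qed.

Let Sc f : sqint W4 f -> sqint W4 (fun z => chi z.1 * f z).
Proof.
move=> Sf; apply: (sqint_ext (f := fun z => f z * chi z.1)) => [z|]; first exact: mulrC.
apply: sqint4_mul => //; exact: (smooth_continuous (smooth_fst schi)).
Qed.

Let Sdc f : sqint W4 f -> sqint W4 (fun z => 'D_1 chi z.1 * f z).
Proof.
move=> Sf; apply: (sqint_ext (f := fun z => f z * 'D_1 chi z.1)) => [z|]; first exact: mulrC.
apply: sqint4_mul => //; exact: (smooth_continuous (smooth_fst (smoothD (1 : R) schi))).
Qed.

Let IK N g f : intble W4 f -> intble W4 (fun z => f z * K4 T N g z).
Proof. exact: (K4_mul_intble T0). Qed.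

(* The quadratic terms v_j v_i and Dv_ij v_j are only integrable: the derivative is moved
   off the smooth approximation of U before passing to the limit. *)
Let quadratic N i :
  \int[W4]_z (chi z.1 * (\sum_j v j z * v i z * K4 T N (DU i j) z + E i z * K4 T N (U i) z)) = 0.
Proof.
have I1 : intble W4 (fun z => \sum_j v j z * v i z * K4 T N (DU i j) z).
  by apply: intble_sum => j; apply: IK; exact: sqint_mul.
apply: slice_zero => //; first by apply: intble_add => //; exact: IK.
have Hv : {ae mI 0 K, forall t, forall i, sqint m3 (slice v t i)}.
  by apply: ae_all_fin => j; exact: (sqint_slice1 (Sv j)).
have HDv : {ae mI 0 K, forall t, forall j, sqint m3 (fun x => Dv i j (t, x))}.
  by apply: ae_all_fin => j; exact: (sqint_slice1 (SDv i j)).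
have H1 := ae_imp2 Hv HDv (fun t A B => conj A B).
have H2 := ae_imp2 solv wdv (fun t A B => conj A B).
apply: (ae_imp2 H1 H2) => t [Svt SDvt] [solvt wdvt].
have tf : tsmooth (fun x => K4 T N (U i) (t, x)).
  by split; [apply: smooth_slice; exact: K4_smooth|exact: K4_periodic3].
have cK g : continuous (fun x : pt R => K4 T N g (t, x)).
  by apply: smooth_continuous; apply: smooth_slice; exact: K4_smooth.
have := sol3_leibniz_smooth Svt solvt (Svt i) SDvt (wdvt i) tf.
have J1 j : intble m3 (fun x => v j (t, x) * v i (t, x) * K4 T N (DU i j) (t, x)).
  by apply: intble3_mul; [exact: cK|exact: (sqint_mul (Svt j) (Svt i))].
have J2 j : intble m3 (fun x => v j (t, x) * Dv i j (t, x) * K4 T N (U i) (t, x)).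
  by apply: intble3_mul; [exact: cK|exact: (sqint_mul (Svt j) (SDvt j))].
move=> Hl; rewrite -[RHS]Hl.
transitivity (\int[m3]_x \sum_j (v j (t, x) * v i (t, x) * K4 T N (DU i j) (t, x) +
    v j (t, x) * Dv i j (t, x) * K4 T N (U i) (t, x))).
  apply: Rint_ext => x; rewrite big_split /=; by rewrite /E mulr_suml.
rewrite Rint_sum => [|j]; last exact: (intble_add (J1 j) (J2 j)).
apply: eq_bigr => j _; rewrite (Rint_add (J1 j) (J2 j)); congr (_ + _); apply: Rint_ext => x.
  rewrite (derive_slice _ _ _ (K4_smooth T N (U i))) KD /slice; ring.
by rewrite /slice; ring.
Qed.

Let IN (f g : mst R -> R) N : sqint W4 f -> intble W4 (fun z => f z * K4 T N g z).
Proof. by move=> Sf; apply: IK; exact: i4. Qed.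

Let approx N :
  \sum_i (\int[W4]_z ('D_1 chi z.1 * v i z * K4 T N (U i) z) + \int[W4]_z (chi z.1 * v i z * K4 T N (Ut i) z)
    + nu * \int[W4]_z (chi z.1 * v i z * K4 T N (LU i) z) + \int[W4]_z (chi z.1 * F i z * K4 T N (U i) z)
    - \int[W4]_z (chi z.1 * E i z * K4 T N (U i) z)) = 0.
Proof.
pose Q i (z : mst R) := \sum_j v j z * v i z * K4 T N (DU i j) z + E i z * K4 T N (U i) z.
have J1 i : intble W4 (fun z => 'D_1 chi z.1 * v i z * K4 T N (U i) z) by apply: IN; exact: Sdc.
have J2 i : intble W4 (fun z => chi z.1 * v i z * K4 T N (Ut i) z) by apply: IN; exact: Sc.
have J3 i : intble W4 (fun z => chi z.1 * v i z * K4 T N (LU i) z) by apply: IN; exact: Sc.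
have J3' i := intble_scale nu (J3 i).
have J4 i : intble W4 (fun z => chi z.1 * F i z * K4 T N (U i) z) by apply: IN; exact: Sc.
have J5 i : intble W4 (fun z => chi z.1 * E i z * K4 T N (U i) z) by apply: IK; exact: Ic.
have J6 i : intble W4 (fun z => chi z.1 * Q i z).
  apply: Ic; apply: intble_add; last exact: IK.
  by apply: intble_sum => j; apply: IK; exact: sqint_mul.
have A1 i := intble_add (J1 i) (J2 i).
have A2 i := intble_add (A1 i) (J3' i).
have A3 i := intble_add (A2 i) (J4 i).
have A4 i := intble_sub (A3 i) (J5 i).
have A5 i := intble_add (A4 i) (J6 i).
rewrite -[RHS](tested N).
transitivity (\int[W4]_z \sum_i ('D_1 chi z.1 * v i z * K4 T N (U i) z + chi z.1 * v i z * K4 T N (Ut i) z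
    + nu * (chi z.1 * v i z * K4 T N (LU i) z) + chi z.1 * F i z * K4 T N (U i) z
    - chi z.1 * E i z * K4 T N (U i) z + chi z.1 * Q i z)); last first.
  apply: Rint_ext => z; apply: eq_bigr => i _; rewrite /Q.
  have -> : \sum_j v j z * v i z * (chi z.1 * K4 T N (DU i j) z) = chi z.1 * \sum_j v j z * v i z * K4 T N (DU i j) z.
    by rewrite mulr_sumr; apply: eq_bigr => j _; ring.
  ring.
rewrite (Rint_sum _ A5); apply: eq_bigr => i _.
rewrite (Rint_add (A4 i) (J6 i)) quadratic addr0 (Rint_sub (A3 i) (J5 i)) (Rint_add (A2 i) (J4 i)).
by rewrite (Rint_add (A1 i) (J3' i)) (Rint_add (J1 i) (J2 i)) (Rint_scale nu (J3 i)).
Qed.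

(** Each pairing is between two square-integrable factors, except that with the merely integrable
    [E i]: there the bound on [U] is used. *)
Let limit :
  \sum_i (\int[W4]_z ('D_1 chi z.1 * v i z * U i z) + \int[W4]_z (chi z.1 * v i z * Ut i z)
    + nu * \int[W4]_z (chi z.1 * v i z * LU i z) + \int[W4]_z (chi z.1 * F i z * U i z)
    - \int[W4]_z (chi z.1 * E i z * U i z)) = 0.
Proof.
apply: (cvg_eq approx); apply: cvg_Rsum => i; apply: cvgB; first apply: cvgD; first apply: cvgD; first apply: cvgD.
- exact: (K4_weak T0 (Sdc (Sv i)) (SU i) (toTs (SU i)) (pU i)).
- exact: (K4_weak T0 (Sc (Sv i)) (SUt i) (toTs (SUt i)) (pUt i)).
- by apply: cvgMr; exact: (K4_weak T0 (Sc (Sv i)) (SLU i) (toTs (SLU i)) (pLU i)).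
- exact: (K4_weak T0 (Sc (SF i)) (SU i) (toTs (SU i)) (pU i)).
- by apply: (K4_weak_bdd T0 (Ic (IE i)) _ (UM1 i) (UM i) (pU i)); case: (SU i).
Qed.

Let Ivm f i : sqint W4 f -> intble W4 (fun z => chi z.1 * v i z * f z).
Proof. by move=> Sf; apply: sqint_mul => //; exact: Sc. Qed.

(** The strong equation of [U] multiplied by chi v_i. It serves to eliminate the time derivative
    [Ut] from [limit]. *)
Let equation i :
  \int[W4]_z (chi z.1 * v i z * Ut i z) + \int[W4]_z (chi z.1 * v i z * C i z)
    - nu * \int[W4]_z (chi z.1 * v i z * LU i z) + \int[W4]_z (chi z.1 * v i z * gp i z)
    = \int[W4]_z (chi z.1 * v i z * F i z).
Proof.
have J1 := Ivm i (SUt i); have J2 := Ivm i (SC i); have J3 := Ivm i (SLU i); have J3' := intble_scale nu J3.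
have J4 := Ivm i (Sgp i); have J5 := Ivm i (SF i).
have A1 := intble_add J1 J2; have A2 := intble_sub A1 J3'; have A3 := intble_add A2 J4.
rewrite -(Rint_scale nu J3) -(Rint_add J1 J2) -(Rint_sub A1 J3') -(Rint_add A2 J4).
apply: Rint_ae; [exact: intble_meas A3|exact: intble_meas J5|].
apply: (ae_imp (eqn i)) => z <-; rewrite /C; ring.
Qed.

Let Hsv : {ae mI 0 K, forall t, forall i, sqint m3 (slice v t i)}.
Proof. by apply: ae_all_fin => j; exact: (sqint_slice1 (Sv j)). Qed.

(** On almost every slice v is weakly divergence-free, hence orthogonal to the gradient of p: this
    is the Leibniz rule with the constant factor 1. *)
Let pressure : \sum_i \int[W4]_z (chi z.1 * v i z * gp i z) = 0.
Proof.
have J i : intble W4 (fun z => v i z * gp i z) by exact: sqint_mul.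
rewrite -Rint_sum => [|i]; last exact: Ivm.
transitivity (\int[W4]_z (chi z.1 * \sum_i v i z * gp i z)).
  by apply: Rint_ext => z; rewrite mulr_sumr; apply: eq_bigr => i _; rewrite mulrA.
apply: slice_zero => //; first exact: intble_sum.
have Hgp : {ae mI 0 K, forall t, forall j, sqint m3 (fun x => gp j (t, x))}.
  by apply: ae_all_fin => j; exact: (sqint_slice1 (Sgp j)).
have H1 := ae_imp2 Hsv Hgp (fun t A B => conj A B).
have H2 := ae_imp2 (sqint_slice1 Sp) H1 (fun t A B => conj A B).
have H3 := ae_imp2 solv wdp (fun t A B => conj A B).
apply: (ae_imp2 H2 H3) => t [Spt [Svt Sgt]] [solvt wdpt].
have := sol3_leibniz_smooth Svt solvt Spt Sgt wdpt (tsmooth_cst 1).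
rewrite (Rint_sum _ (fun j => sqint_mul (Svt j) (Sgt j))).
move=> Hl; rewrite -[RHS]Hl; apply: eq_bigr => j _.
rewrite -[LHS]add0r; congr (_ + _).
  rewrite -[LHS](mul0r (\int[m3]_x (0 : R))) -Rint_scale; last exact: intble0.
  by apply: Rint_ext => x; rewrite derive_cst mul0r mulr0 mul0r.
by apply: Rint_ext => x; rewrite mulr1.
Qed.

(** Integration by parts on almost every slice, by [wderiv_laplace]. *)
Let viscosity i : \int[W4]_z (chi z.1 * v i z * LU i z) = - \int[W4]_z (chi z.1 * D i z).
Proof.
have J1 : intble W4 (fun z => v i z * LU i z) by exact: sqint_mul.
have J2 : intble W4 (fun z => v i z * LU i z + D i z) by exact: intble_add.
apply/eqP; rewrite -addr_eq0 -Rint_add; [|exact: Ivm|exact: Ic].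
apply/eqP; transitivity (\int[W4]_z (chi z.1 * (v i z * LU i z + D i z))).
  by apply: Rint_ext => z; ring.
apply: slice_zero => //.
have HDv : {ae mI 0 K, forall t, forall j, sqint m3 (fun x => Dv i j (t, x))}.
  by apply: ae_all_fin => j; exact: (sqint_slice1 (SDv i j)).
have HDU : {ae mI 0 K, forall t, forall j, sqint m3 (fun x => DU i j (t, x))}.
  by apply: ae_all_fin => j; exact: (sqint_slice1 (SDU i j)).
have H1 := ae_imp2 Hsv HDv (fun t A B => conj A B).
have H2 := ae_imp2 (sqint_slice1 (SLU i)) HDU (fun t A B => conj A B).
have H3 := ae_imp2 lap3 wdv (fun t A B => conj A B).
have H4 := ae_imp2 H1 H2 (fun t A B => conj A B).
apply: (ae_imp2 H3 H4) => t [lapt wdvt] [[Svt SDvt] [SLt SDUt]].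
have JD j : intble m3 (fun x => DU i j (t, x) * Dv i j (t, x)) := sqint_mul (SDUt j) (SDvt j).
have JL : intble m3 (fun x => v i (t, x) * LU i (t, x)) := sqint_mul (Svt i) SLt.
rewrite (Rint_add JL (intble_sum (index_enum _) JD)).
rewrite Rint_sum // (wderiv_laplace (Svt i) SDvt (wdvt i) SDUt SLt (lapt i)).
by apply/eqP; rewrite subr_eq0; apply/eqP; apply: Rint_ext => x; exact: mulrC.
Qed.

Definition pairing (z : mst R) : R := \sum_i v i z * U i z.
Definition pairing_rate (z : mst R) : R :=
  \sum_i (F i z * U i z + v i z * F i z - v i z * (\sum_j U j z * DU i j z)
    - (\sum_j v j z * Dv i j z) * U i z - 2 * nu * \sum_j DU i j z * Dv i j z).

Let JP i : intble W4 (fun z => v i z * U i z). Proof. exact: sqint_mul. Qed.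

Lemma pairing_intble : intble W4 pairing.
Proof. exact: intble_sum. Qed.

Let R1 i : intble W4 (fun z => F i z * U i z + v i z * F i z). Proof. by apply: intble_add; exact: sqint_mul. Qed.
Let R2 i : intble W4 (fun z => F i z * U i z + v i z * F i z - v i z * C i z).
Proof. by apply: intble_sub (R1 i) _; exact: sqint_mul. Qed.
Let R3 i : intble W4 (fun z => F i z * U i z + v i z * F i z - v i z * C i z - E i z * U i z).
Proof. by apply: intble_sub (R2 i) _; exact: IU. Qed.
Let R4 i : intble W4 (fun z => F i z * U i z + v i z * F i z - v i z * C i z - E i z * U i z - 2 * nu * D i z).
Proof. by apply: intble_sub (R3 i) _; exact: intble_scale. Qed.

Lemma pairing_rate_intble : intble W4 pairing_rate.
Proof. exact: intble_sum. Qed.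

(** Substituting [equation] for the term in [Ut] in [limit] brings in a second viscous term; with
    [pressure] and [viscosity] the two make up - 2 nu int [D]. So the time derivative of (v, U) is,
    weakly, the integral of [pairing_rate]. *)
Lemma duality :
  \int[mI 0 K]_t ('D_1 chi t * \int[m3]_x pairing (t, x))
  + \int[mI 0 K]_t (chi t * \int[m3]_x pairing_rate (t, x)) = 0.
Proof.
have [_ <-] := slice_int cdchi pairing_intble.
have [_ <-] := slice_int cchi pairing_rate_intble.
have E1 : \int[W4]_z ('D_1 chi z.1 * pairing z) = \sum_i \int[W4]_z ('D_1 chi z.1 * v i z * U i z).
  rewrite -Rint_sum => [|i]; last by apply: sqint_mul => //; exact: Sdc.
  by apply: Rint_ext => z; rewrite mulr_sumr; apply: eq_bigr => i _; rewrite mulrA.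
have E2 : \int[W4]_z (chi z.1 * pairing_rate z) = \sum_i (\int[W4]_z (chi z.1 * F i z * U i z)
   + \int[W4]_z (chi z.1 * v i z * F i z) - \int[W4]_z (chi z.1 * v i z * C i z)
   - \int[W4]_z (chi z.1 * E i z * U i z) - 2 * nu * \int[W4]_z (chi z.1 * D i z)).
  have J1 i : intble W4 (fun z => chi z.1 * F i z * U i z) by apply: sqint_mul => //; exact: Sc.
  have J2 i := Ivm i (SF i); have J3 i := Ivm i (SC i).
  have J4 i : intble W4 (fun z => chi z.1 * E i z * U i z) by apply: IU; exact: Ic.
  have J5 i : intble W4 (fun z => chi z.1 * D i z) by exact: Ic.
  have J5' i := intble_scale (2 * nu) (J5 i).
  have A1 i := intble_add (J1 i) (J2 i). have A2 i := intble_sub (A1 i) (J3 i).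
  have A3 i := intble_sub (A2 i) (J4 i). have A4 i := intble_sub (A3 i) (J5' i).
  transitivity (\sum_i \int[W4]_z (chi z.1 * F i z * U i z + chi z.1 * v i z * F i z - chi z.1 * v i z * C i z
     - chi z.1 * E i z * U i z - 2 * nu * (chi z.1 * D i z))).
    rewrite -(Rint_sum _ A4); apply: Rint_ext => z; rewrite mulr_sumr; apply: eq_bigr => i _.
    by rewrite /C /E /D; ring.
  apply: eq_bigr => i _.
  rewrite (Rint_sub (A3 i) (J5' i)) (Rint_sub (A2 i) (J4 i)) (Rint_sub (A1 i) (J3 i)) (Rint_add (J1 i) (J2 i)).
  by rewrite (Rint_scale (2 * nu) (J5 i)).
rewrite E1 E2.
have := limit; have := pressure; have Eq := equation; have Vi := viscosity.
rewrite !sum3.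
have := Eq ord0; have := Eq (lift ord0 ord0); have := Eq (lift ord0 (lift ord0 ord0)).
rewrite !Vi; lra.
Qed.

End Cutoff.

End Duality.

(** * The energy estimate for the difference on one time slice *)

Section SliceEnergy.
Context {R : realType} (nu M : R).
Variables (U F v : 'I_3 -> mpt R -> R) (DU Dv : 'I_3 -> 'I_3 -> mpt R -> R).
Hypotheses (SU : forall i, sqint m3 (U i)) (SF : forall i, sqint m3 (F i)) (Sv : forall i, sqint m3 (v i))
  (SDU : forall i j, sqint m3 (DU i j)) (SDv : forall i j, sqint m3 (Dv i j)).
Hypotheses (solU : sol3 U) (solv : sol3 v).
Hypotheses (meanU : forall i, \int[m3]_x U i x = 0) (meanv : forall i, \int[m3]_x v i x = 0).
Hypotheses (wdU : forall i j, wderiv j (U i) (DU i j)) (wdv : forall i j, wderiv j (v i) (Dv i j)).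
Hypotheses (M0 : 0 <= M) (UM : forall i, {ae m3, forall x, `|U i x| <= M}).

Let w i x := v i x - U i x.
Let Dw i j x := Dv i j x - DU i j x.

Let i3 (f : mpt R -> R) : sqint m3 f -> intble m3 f. Proof. exact: (sqint_intble m3_fin). Qed.
Let Sw i : sqint m3 (w i). Proof. exact: sqint_sub. Qed.
Let SDw i j : sqint m3 (Dw i j). Proof. exact: sqint_sub. Qed.
Let SUm (f : mpt R -> R) i : sqint m3 f -> sqint m3 (fun x => f x * U i x).
Proof. by move=> Sf; apply: (sqint_mul_bdd Sf _ (UM i)); case: (SU i). Qed.

Let cD j psi : tsmooth psi -> continuous (fun x : pt R => 'D_(basis3 j) psi x).
Proof. by move=> tp; case: (tsmoothD (basis3 j) tp) => /smooth_continuous. Qed.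

Let solw : sol3 w.
Proof.
move=> psi tp.
have J (a : 'I_3 -> mpt R -> R) : (forall i, sqint m3 (a i)) ->
    intble m3 (fun x => \sum_i a i x * 'D_(basis3 i) psi x).
  move=> Sa; apply: intble_sum => i. exact: (intble3_mul (@cD i psi tp) (i3 (Sa i))).
rewrite -[RHS]subr0 -[X in _ = X - _](solv tp) -[X in _ = _ - X](solU tp) -(Rint_sub (J _ Sv) (J _ SU)).
by apply: Rint_ext => x; rewrite -sumrB; apply: eq_bigr => i _; rewrite mulrBl.
Qed.

Let wdw i j : wderiv j (w i) (Dw i j).
Proof.
move=> N a; have tp := @e3_tsmooth R N a.
have J (f : mpt R -> R) : sqint m3 f -> intble m3 (fun x => f x * 'D_(basis3 j) (e3 a : pt R -> R) x).
  by move=> Sf; exact: (intble3_mul (@cD j _ tp) (i3 Sf)).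
have J' (f : mpt R -> R) : sqint m3 f -> intble m3 (fun x => f x * e3 a x).
  by move=> Sf; exact: (intble3_mul (@smooth_continuous R _ _ (proj1 tp)) (i3 Sf)).
transitivity (\int[m3]_x (v i x * 'D_(basis3 j) (e3 a : pt R -> R) x - U i x * 'D_(basis3 j) (e3 a : pt R -> R) x)).
  by apply: Rint_ext => x; rewrite mulrBl.
rewrite (Rint_sub (J _ (Sv i)) (J _ (SU i))) wdU wdv opprK addrC -opprB; congr (- _).
rewrite -(Rint_sub (J' _ (SDv i j)) (J' _ (SDU i j))).
by apply: Rint_ext => x; rewrite mulrBl.
Qed.

Let poincare_w i : \int[m3]_x (w i x ^+ 2) <= (2 * pi) ^+ 2 * \sum_j \int[m3]_x (Dw i j x ^+ 2).
Proof.
apply: (poincare_wderiv (Sw i) (SDw i) (@wdw i)).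
by rewrite Rint_sub ?meanU ?meanv ?subrr //; exact: i3.
Qed.

Let X i j x := U j x * v i x * DU i j x + v j x * Dv i j x * U i x.
Let P i j x := w j x * Dw i j x * U i x.

Let IX i j : intble m3 (X i j).
Proof.
apply: intble_add.
  apply: (intble_ext (f := fun x => v i x * U j x * DU i j x)) => [x|]; first by ring.
  by apply: sqint_mul => //; exact: SUm.
apply: (intble_ext (f := fun x => v j x * U i x * Dv i j x)) => [x|]; first by ring.
by apply: sqint_mul => //; exact: SUm.
Qed.

Let IP i j : intble m3 (P i j).
Proof.
apply: (intble_ext (f := fun x => w j x * U i x * Dw i j x)) => [x|]; first by rewrite /P; ring.
by apply: sqint_mul => //; exact: SUm.
Qed.

(** X - P splits into U . grad(v_i U_i) and one half of w . grad(U_i^2); both integrate to 0 because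
    U and w are divergence-free. What remains is quadratic in w, with one factor [U]. *)
Let cancel i : \sum_j \int[m3]_x X i j x = \sum_j \int[m3]_x P i j x.
Proof.
have SvU j : sqint m3 (fun x => U j x * v i x).
  by apply: (sqint_ext (f := fun x => v i x * U j x)) => [x|]; [exact: mulrC|exact: SUm].
have L1 := sol3_leibniz SU solU (SU i) (SDU i) (wdU i) (Sv i) (SDv i) (wdv i) (UM i) SvU.
have L2 := sol3_leibniz Sw solw (SU i) (SDU i) (wdU i) (SU i) (SDU i) (wdU i) (UM i) (fun j => SUm i (Sw j)).
have I1 j : intble m3 (fun x => U j x * v i x * DU i j x) by exact: sqint_mul.
have I2 j : intble m3 (fun x => U j x * Dv i j x * U i x).
  apply: (intble_ext (f := fun x => Dv i j x * (U j x * U i x))) => [x|]; first by ring.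
  by apply: sqint_mul => //; exact: SUm.
have I3 j : intble m3 (fun x => w j x * U i x * DU i j x).
  by apply: sqint_mul => //; exact: SUm.
have I4 j : intble m3 (fun x => w j x * DU i j x * U i x).
  by apply: (intble_ext (f := fun x => w j x * U i x * DU i j x)) => [x|]; [ring|exact: I3].
apply/eqP; rewrite -subr_eq0 -sumrB; apply/eqP.
have E j : \int[m3]_x X i j x - \int[m3]_x P i j x =
    (\int[m3]_x (U j x * v i x * DU i j x) + \int[m3]_x (U j x * Dv i j x * U i x))
    + 2^-1 * (\int[m3]_x (w j x * U i x * DU i j x) + \int[m3]_x (w j x * DU i j x * U i x)).
  have -> : \int[m3]_x (w j x * DU i j x * U i x) = \int[m3]_x (w j x * U i x * DU i j x).
    by apply: Rint_ext => x; ring.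
  have half (r : R) : 2^-1 * (r + r) = r by field.
  rewrite half -(Rint_sub (IX i j) (IP i j)).
  rewrite -(Rint_add (I1 j) (I2 j)) -(Rint_add (intble_add (I1 j) (I2 j)) (I3 j)).
  by apply: Rint_ext => x; rewrite /X /P /w /Dw; ring.
rewrite (eq_bigr _ (fun j _ => E j)) big_split /= -mulr_sumr L1 L2; ring.
Qed.

(** The bound M on U_i and ab <= (a^2 + b^2)/2. *)
Let bound i j : `|\int[m3]_x P i j x| <= M / 2 * (\int[m3]_x (w j x ^+ 2) + \int[m3]_x (Dw i j x ^+ 2)).
Proof.
apply: le_trans (Rint_abs (IP i j)) _.
have I1 : intble m3 (fun x => w j x ^+ 2) by case: (Sw j).
have I2 : intble m3 (fun x => Dw i j x ^+ 2) by case: (SDw i j).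
rewrite -Rint_add // -Rint_scale; last exact: intble_add.
apply: Rint_le_ae; [exact: intble_abs|apply: intble_scale; exact: intble_add|].
apply: (ae_imp (UM i)) => x Ux; rewrite /P !normrM.
have h1 : `|w j x| * `|Dw i j x| <= 2^-1 * (w j x ^+ 2 + Dw i j x ^+ 2).
  rewrite -(real_normK (num_real (w j x))) -(real_normK (num_real (Dw i j x))).
  have := sqr_ge0 (`|w j x| - `|Dw i j x|); nra.
have h0 : 0 <= `|w j x| * `|Dw i j x| by exact: mulr_ge0.
have : `|w j x| * `|Dw i j x| * `|U i x| <= 2^-1 * (w j x ^+ 2 + Dw i j x ^+ 2) * M by exact: ler_pM.
by move=> H; apply: le_trans H _; lra.
Qed.

(** The force terms cancel and the gradients form a square, so the right side is 2 nu Q - 2 B, where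
    Q is the integral of |grad w|^2 and B the trilinear term. Smallness of M absorbs 2 |B| into nu
    Q, and Poincaré bounds the remaining nu Q below by the left side. *)
Lemma energy_rate : M * (3 * (2 * pi) ^+ 2 + 1) <= nu ->
  nu / (2 * pi) ^+ 2 * \int[m3]_x (\sum_i (v i x - U i x) ^+ 2) <=
  2 * nu * \int[m3]_x (\sum_i \sum_j Dv i j x ^+ 2) + 2 * nu * \int[m3]_x (\sum_i \sum_j DU i j x ^+ 2)
  - 2 * \int[m3]_x (\sum_i F i x * v i x) - 2 * \int[m3]_x (\sum_i F i x * U i x)
  + 2 * \int[m3]_x (\sum_i (F i x * U i x + v i x * F i x - v i x * (\sum_j U j x * DU i j x)
      - (\sum_j v j x * Dv i j x) * U i x - 2 * nu * \sum_j DU i j x * Dv i j x)).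
Proof.
move=> Mnu.
pose W := \sum_i \int[m3]_x (w i x ^+ 2).
pose Q := \sum_i \sum_j \int[m3]_x (Dw i j x ^+ 2).
have Iw i : intble m3 (fun x => w i x ^+ 2) by case: (Sw i).
have IDw i j : intble m3 (fun x => Dw i j x ^+ 2) by case: (SDw i j).
have WE : \int[m3]_x (\sum_i (v i x - U i x) ^+ 2) = W by rewrite (Rint_sum _ Iw).
have pi0 : 0 < (2 * pi : R) ^+ 2 by rewrite exprn_gt0 // mulr_gt0 // pi_gt0.
have WQ : W <= (2 * pi) ^+ 2 * Q.
  by rewrite /Q mulr_sumr; apply: ler_sum => i _; exact: poincare_w.
have Q0 : 0 <= Q by apply: sumr_ge0 => i _; apply: sumr_ge0 => j _; apply: Rint_ge0 => x; exact: sqr_ge0.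
pose B := \sum_i \sum_j \int[m3]_x P i j x.
have BQ : `|B| <= M / 2 * (3 * W + Q).
  apply: le_trans (ler_norm_sum _ _ _) _.
  have -> : M / 2 * (3 * W + Q) = \sum_i \sum_j M / 2 * (\int[m3]_x (w j x ^+ 2) + \int[m3]_x (Dw i j x ^+ 2)).
    rewrite /W /Q !sum3; ring.
  apply: ler_sum => i _; apply: le_trans (ler_norm_sum _ _ _) _.
  by apply: ler_sum => j _; exact: bound.
pose FF := fun x => \sum_i F i x * v i x; pose GG := fun x => \sum_i F i x * U i x.
pose d1 := fun x => \sum_i \sum_j Dv i j x ^+ 2; pose d2 := fun x => \sum_i \sum_j DU i j x ^+ 2.
pose d3 := fun x => \sum_i \sum_j DU i j x * Dv i j x.
pose xx := fun x => \sum_i \sum_j X i j x.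
have IFF : intble m3 FF by apply: intble_sum => i; exact: sqint_mul.
have IGG : intble m3 GG by apply: intble_sum => i; exact: sqint_mul.
have Id1 : intble m3 d1 by apply: intble_sum => i; apply: intble_sum => j; case: (SDv i j).
have Id2 : intble m3 d2 by apply: intble_sum => i; apply: intble_sum => j; case: (SDU i j).
have Id3 : intble m3 d3 by apply: intble_sum => i; apply: intble_sum => j; exact: (sqint_mul (SDU i j) (SDv i j)).
have Ixx : intble m3 xx by apply: intble_sum => i; apply: intble_sum => j; exact: IX.
have EX : \int[m3]_x xx x = B.
  rewrite Rint_sum => [|i]; last exact: intble_sum.
  by apply: eq_bigr => i _; rewrite Rint_sum // cancel.
have EQ : Q = \int[m3]_x d1 x + \int[m3]_x d2 x - 2 * \int[m3]_x d3 x.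
  have J12 := intble_add Id1 Id2; have J3 := intble_scale 2 Id3.
  rewrite -(Rint_scale 2 Id3) -(Rint_add Id1 Id2) -(Rint_sub J12 J3).
  transitivity (\int[m3]_x \sum_i \sum_j Dw i j x ^+ 2).
    rewrite Rint_sum => [|i]; last exact: intble_sum.
    by apply: eq_bigr => i _; rewrite Rint_sum.
  by apply: Rint_ext => x; rewrite /d1 /d2 /d3 /Dw !sum3; ring.
have -> : \int[m3]_x (\sum_i (F i x * U i x + v i x * F i x - v i x * (\sum_j U j x * DU i j x)
      - (\sum_j v j x * Dv i j x) * U i x - 2 * nu * \sum_j DU i j x * Dv i j x)) =
   \int[m3]_x GG x + \int[m3]_x FF x - B - 2 * nu * \int[m3]_x d3 x.
  have J1 := intble_add IGG IFF; have J2 := intble_sub J1 Ixx; have J3 := intble_scale (2 * nu) Id3.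
  rewrite -EX -(Rint_scale (2 * nu) Id3) -(Rint_add IGG IFF) -(Rint_sub J1 Ixx) -(Rint_sub J2 J3).
  by apply: Rint_ext => x; rewrite /GG /FF /xx /d3 /X !sum3; ring.
rewrite WE -/(FF _) -/(GG _) -/(d1 _) -/(d2 _).
have nu0 : 0 <= nu by apply: le_trans Mnu; rewrite mulr_ge0 // addr_ge0 // mulr_ge0 // ltW.
have h1 : nu / (2 * pi) ^+ 2 * W <= nu * Q.
  rewrite -mulrA; apply: ler_wpM2l => //; rewrite mulrC ler_pdivrMr // mulrC //.
(* Summing the bounds over i and j counts each int w_j^2 three times, whence M (3 W + Q); Poincaré
   then produces the constant 3 (2 pi)^2 + 1. *)
have h2 : 2 * `|B| <= nu * Q.
  have : M * (3 * W + Q) <= M * ((3 * (2 * pi) ^+ 2 + 1) * Q).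
    apply: ler_wpM2l => //; lra.
  have := ler_wpM2r Q0 Mnu; rewrite -mulrA => h3 h4; lra.
have h3 : B <= `|B| by exact: ler_norm.
have -> : \int[m3]_x (\sum_i F i x * v i x) = \int[m3]_x FF x by [].
have -> : \int[m3]_x (\sum_i F i x * U i x) = \int[m3]_x GG x by [].
have -> : \int[m3]_x (\sum_i \sum_j Dv i j x ^+ 2) = \int[m3]_x d1 x by [].
have -> : \int[m3]_x (\sum_i \sum_j DU i j x ^+ 2) = \int[m3]_x d2 x by [].
have h5 : nu * Q = nu * \int[m3]_x d1 x + nu * \int[m3]_x d2 x - 2 * nu * \int[m3]_x d3 x by rewrite EQ; ring.
lra.
Qed.

End SliceEnergy.

(** * Decay from the integrated differential inequality *)

Section Decay.
Context {R : realType} (c : R) (y : measurableTypeR R -> R).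
Hypotheses (c0 : 0 < c) (y0 : forall t, 0 <= y t) (Iy : forall K, intble (mI 0 K) y).

Lemma ae_inhabited (a b : R) (P : R -> Prop) : a < b -> {ae mI a b, forall t, P t} ->
  exists2 t, a <= t <= b & P t.
Proof.
move=> ab H; apply: contrapT => N.
have : \int[mI a b]_x (1 : R) = \int[mI a b]_x (0 : R).
  apply: Rint_ae => //; apply: (ae_imp2 H (mI_ae a b)) => t Pt tab.
  by case: N; exists t.
by rewrite !mI_size ?ltW // mul1r mul0r => /eqP; rewrite subr_eq0 gt_eqF.
Qed.

(** Once y drops below e at a time where the inequality holds, it stays below. If that never
    happened, y would be at least e almost everywhere, and the integral term would eventually exceed
    the initial value. *)
Lemma decay :
  {ae @lebesgue_measure R, forall s : measurableTypeR R, 0 < s -> forall t, s < t ->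
     y t + c * \int[mI s t]_r y r <= y s} ->
  forall e : R, 0 < e -> exists s : R, forall t, s < t -> y t <= e.
Proof.
move=> H e e0.
have HI a b : {ae mI a b, forall s : R, 0 < s -> forall t : R, s < t -> y t + c * \int[mI s t]_r y r <= y s}.
  apply/(restr_ae (measurable_itv `[a, b]) (nu := mI a b) (fun A _ => mIE a b A)).
  by apply: filterS H => s Hs _.
have l12 : (1 : R) < 2 by lra.
(* The inequality holds for almost every s only; the interval [1, 2] serves to pick one positive
   starting time. *)
have [s0 /andP[s01 _] H0] := ae_inhabited l12 (HI 1 2).
have s00 : 0 < s0 := lt_le_trans ltr01 s01.
have {}H0 := H0 s00.
apply: contrapT => N.
(* Chosen so that c e (b - s0) = y s0 + c e, which exceeds the value at s0. *)
pose b := s0 + y s0 / (c * e) + 1.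
have sb : s0 < b.
  rewrite /b -addrA ltrDl; apply: ltr_wpDl => //; apply: divr_ge0 => //; apply: ltW; exact: mulr_gt0.
have Is : intble (mI s0 b) y := intble_mI_sub (ltW s00) (lexx b) (Iy b).
have : \int[mI s0 b]_r e <= \int[mI s0 b]_r y r.
  apply: Rint_le_ae => //; first exact: intble_cst (@mI_fin R s0 b) e.
  apply: (ae_imp2 (HI s0 b) (mI_ae s0 b)) => s Hs /andP[ss _].
  rewrite leNgt; apply/negP => ye; apply: N; exists s => t st.
  have := Hs (lt_le_trans s00 ss) t st.
  have /(mulr_ge0 (ltW c0)) : 0 <= \int[mI s t]_r y r by exact: Rint_ge0.
  by move=> ?; lra.
have P0 : 0 <= y b := y0 b; have P1 := H0 b sb.
rewrite (mI_size _ (ltW sb)) => Q; have := ler_wpM2l (ltW c0) Q; move: P1.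
have -> : c * (e * (b - s0)) = y s0 + c * e.
  by rewrite /b; field; rewrite !gt_eqF.
have := mulr_gt0 c0 e0; lra.
Qed.

End Decay.

(** * Extended-real norms and energies as real integrals *)

Section SquareIntegrals.
Context {R : realType} (I : finType).
Implicit Types u : I -> st R -> R.

Lemma L2sqE (u : I -> pt R -> R) : (forall i, measurable_fun setT (u i : mpt R -> R)) ->
  L2sq u = (\int[m3]_x (\sum_i u i x ^+ 2)%:E)%E.
Proof.
move=> mu; rewrite m3_integral //; apply/measurable_EFinP.
by apply: measurable_sum => i; exact: measurable_funX.
Qed.

Lemma sumsq_intble (u : I -> mpt R -> R) : (forall i, sqint m3 (u i)) ->
  intble m3 (fun x => \sum_i u i x ^+ 2).
Proof. by move=> Su; apply: intble_sum => i; case: (Su i). Qed.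

Lemma L2sq_real (u : I -> mpt R -> R) : (forall i, sqint m3 (u i)) ->
  L2sq u = (\int[m3]_x (\sum_i u i x ^+ 2))%:E.
Proof.
move=> Su; rewrite L2sqE => [|i]; last by case: (Su i).
by rewrite /Rintegral fineK //; exact: (integrable_fin_num _ (sumsq_intble Su)).
Qed.

Lemma L2norm_real (u : I -> mpt R -> R) : (forall i, sqint m3 (u i)) ->
  L2norm u = (Num.sqrt (\int[m3]_x (\sum_i u i x ^+ 2)))%:E.
Proof.
move=> Su; rewrite /L2norm L2sq_real // poweR_EFin powR12_sqrt //.
by apply: Rint_ge0 => x; apply: sumr_ge0 => i _; exact: sqr_ge0.
Qed.

Lemma sqint_of_L2sq (u : I -> mpt R -> R) : (forall i, measurable_fun setT (u i)) ->
  (L2sq u < +oo)%E -> forall i, sqint m3 (u i).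
Proof.
move=> mu; rewrite L2sqE // => foo i; split; first exact: mu.
have ms : measurable_fun setT (fun x : mpt R => \sum_i u i x ^+ 2).
  by apply: measurable_sum => j; exact: measurable_funX.
have Is : intble m3 (fun x => \sum_i u i x ^+ 2).
  apply/integrableP; split; first exact/measurable_EFinP.
  apply: le_lt_trans foo; rewrite le_eqVlt; apply/orP; left; apply/eqP; apply: eq_integral => x _ /=.
  by rewrite ger0_norm //; apply: sumr_ge0 => j _; exact: sqr_ge0.
apply: intble_le Is; first exact: measurable_funX.
move=> x; rewrite ger0_norm ?sqr_ge0 // (bigD1 i) //= lerDl.
by apply: sumr_ge0 => j _; exact: sqr_ge0.
Qed.

Lemma slice_meas (f : mst R -> R) t : measurable_fun setT f -> measurable_fun setT (fun x : mpt R => f (t, x)).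
Proof. by move=> mf; exact: measurableT_comp mf (pair1_measurable t). Qed.

Lemma L2sq_slice_meas u : (forall i, measurable_fun setT (u i : mst R -> R)) ->
  measurable_fun setT (fun t : measurableTypeR R => L2sq (slice u t)).
Proof.
move=> mu.
have -> : (fun t => L2sq (slice u t)) = fun t => (\int[m3]_x (\sum_i u i (t, x) ^+ 2)%:E)%E.
  by apply/funext => t; rewrite L2sqE // => i; exact: slice_meas.
have mE : measurable_fun setT (fun z : mst R => (\sum_i u i z ^+ 2)%:E).
  by apply/measurable_EFinP; apply: measurable_sum => i; exact: measurable_funX.
have s0 (z : mst R) : (0 <= (\sum_i u i z ^+ 2)%:E)%E.
  by rewrite lee_fin; apply: sumr_ge0 => i _; exact: sqr_ge0.
exact: measurable_fun_fubini_tonelli_F mE s0.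
Qed.

Lemma L2sq_ge0 (u : I -> pt R -> R) : (0 <= L2sq u)%E.
Proof. by apply: integral_ge0 => x _; rewrite lee_fin; apply: sumr_ge0 => i _; exact: sqr_ge0. Qed.

Lemma component_integral_finite u (K : R) i : (forall i, measurable_fun setT (u i : mst R -> R)) ->
  (\int[@lebesgue_measure R]_(t in `[0%R, K]) L2sq (slice u t) < +oo)%E ->
  (\int[mI 0 K]_t \int[m3]_x (u i (t, x) ^+ 2)%:E < +oo)%E.
Proof.
move=> mu; rewrite -mI_integral; last exact: L2sq_slice_meas.
have m1 : measurable_fun setT (fun t : measurableTypeR R => (\int[m3]_x (u i (t, x) ^+ 2)%:E)%E).
  have mE : measurable_fun setT (fun z : mst R => (u i z ^+ 2)%:E).
    by apply/measurable_EFinP; apply: measurable_funX; exact: mu.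
  have s0 (z : mst R) : (0 <= (u i z ^+ 2)%:E)%E by rewrite lee_fin sqr_ge0.
  exact: measurable_fun_fubini_tonelli_F mE s0.
have f0 (t : measurableTypeR R) : (0 <= \int[m3]_x (u i (t, x) ^+ 2)%:E)%E.
  by apply: integral_ge0 => x _; rewrite lee_fin sqr_ge0.
have le (t : measurableTypeR R) : (\int[m3]_x (u i (t, x) ^+ 2)%:E <= L2sq (slice u t))%E.
  rewrite L2sqE => [|j]; last by apply: slice_meas; exact: mu.
  have g0 (x : mpt R) : (0 <= (u i (t, x) ^+ 2)%:E)%E by rewrite lee_fin sqr_ge0.
  have n1 : measurable_fun setT (fun x : mpt R => (u i (t, x) ^+ 2)%:E).
    by apply/measurable_EFinP; apply: measurable_funX; apply: slice_meas; exact: mu.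
  have n2 : measurable_fun setT (fun x : mpt R => (\sum_j u j (t, x) ^+ 2)%:E).
    by apply/measurable_EFinP; apply: measurable_sum => j; apply: measurable_funX; apply: slice_meas; exact: mu.
  apply: (ge0_le_integral _ measurableT (fun x _ => g0 x) n1 n2) => x _.
  by rewrite lee_fin (bigD1 i) //= lerDl; apply: sumr_ge0 => j _; exact: sqr_ge0.
apply: le_lt_trans.
exact: (ge0_le_integral _ measurableT (fun t _ => f0 t) m1 (L2sq_slice_meas mu) (fun t _ => le t)).
Qed.

Lemma sqint_of_evolution u (K : R) i : (forall i, measurable_fun setT (u i : mst R -> R)) ->
  (\int[@lebesgue_measure R]_(t in `[0%R, K]) L2sq (slice u t) < +oo)%E ->
  sqint (m4 0 K) (u i).
Proof. by move=> mu foo; exact: (sqint_tonelli (mu i) (component_integral_finite i mu foo)). Qed.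

Lemma sumsq4_intble u (s t : R) : (forall i, sqint (m4 s t) (u i)) ->
  intble (m4 s t) (fun z => \sum_i u i z ^+ 2).
Proof. by move=> Su; apply: intble_sum => i; case: (Su i). Qed.

Lemma L2sq_integral_real u (s t : R) : (forall i, sqint (m4 s t) (u i)) ->
  (\int[@lebesgue_measure R]_(r in `[s, t]) L2sq (slice u r))%E =
  (\int[mI s t]_r \int[m3]_x (\sum_i u i (r, x) ^+ 2))%:E.
Proof.
move=> Su; have mu i : measurable_fun setT (u i : mst R -> R) by case: (Su i).
rewrite -mI_integral; last exact: L2sq_slice_meas.
have Is := sumsq4_intble Su; have [_ ->] := Rint_fub1 Is.
have -> : (\int[m4 s t]_z (\sum_i u i z ^+ 2))%:E = (\int[m4 s t]_z (\sum_i u i z ^+ 2)%:E)%E.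
  by rewrite /Rintegral fineK //; exact: (integrable_fin_num _ Is).
rewrite /m4 /sprod fubini_tonelli1 /=.
- apply: eq_integral => r _; rewrite /fubini_F L2sqE //.
  by move=> i; exact: slice_meas.
- by apply/measurable_EFinP; apply: measurable_sum => i; exact: measurable_funX.
- by move=> z; rewrite lee_fin; apply: sumr_ge0 => i _; exact: sqr_ge0.
Qed.

Lemma dotL2E (u w : I -> mpt R -> R) : (forall i, measurable_fun setT (u i)) ->
  (forall i, measurable_fun setT (w i)) ->
  dotL2 u w = \int[m3]_x (\sum_i u i x * w i x).
Proof.
move=> mu mw; rewrite m3_Rint //.
by apply: measurable_sum => i; exact: measurable_funM.
Qed.

Lemma dotL2_integral_real (u w : I -> mst R -> R) (s t : R) :
  (forall i, sqint (m4 s t) (u i)) -> (forall i, sqint (m4 s t) (w i)) ->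
  \int[@lebesgue_measure R]_(r in `[s, t]) dotL2 (slice u r) (slice w r) =
  \int[mI s t]_r \int[m3]_x (\sum_i u i (r, x) * w i (r, x)).
Proof.
move=> Su Sw; have mu i : measurable_fun setT (u i : mst R -> R) by case: (Su i).
have mw i : measurable_fun setT (w i : mst R -> R) by case: (Sw i).
have Is : intble (m4 s t) (fun z => \sum_i u i z * w i z).
  by apply: intble_sum => i; exact: sqint_mul.
have E r : dotL2 (slice u r) (slice w r) = \int[m3]_x (\sum_i u i (r, x) * w i (r, x)).
  exact: (@dotL2E (slice u r) (slice w r) (fun i => slice_meas r (mu i)) (fun i => slice_meas r (mw i))).
rewrite mI_Rint; last exact: meas_fub1 Is.
by apply: eq_Rintegral => r _; exact: E.
Qed.

Lemma sqint_m4_sub (f : mst R -> R) (a b c d : R) : c <= a -> b <= d ->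
  sqint (m4 c d) f -> sqint (m4 a b) f.
Proof. by move=> ca bd [mf If]; split=> //; exact: intble_m4_sub ca bd If. Qed.

End SquareIntegrals.

(** * Periodic weak derivatives restricted to time slices *)

Section PeriodicWeakDerivatives.
Context {R : realType} (T : R).
Hypothesis T0 : 0 < T.

Lemma int_periodicE (f : mst R -> R) : intble (m4 0 T) f -> int_periodic T f = \int[m4 0 T]_z f z.
Proof.
move=> If; have mf := intble_meas If; rewrite /int_periodic.
have -> : (fun t => \int[leb3]_(x in T3) f (t, x)) = fun t => \int[m3]_x f (t, x).
  by apply/funext => t; rewrite m3_Rint //; exact: slice_meas.
rewrite -mI_Rint; last exact: meas_fub1 If.
by have [_ ->] := Rint_fub1 If.
Qed.

Lemma test_smooth_continuous (phi : st R -> R) d : test_periodic T phi -> continuous (fun z => 'D_d phi z).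
Proof. by case=> sphi _ _; apply: smooth_continuous; exact: smoothD. Qed.

Lemma weak_deriv_m4 d (u g : mst R -> R) : intble (m4 0 T) u -> intble (m4 0 T) g -> weak_deriv T d u g ->
  forall phi, test_periodic T phi ->
  \int[m4 0 T]_z (u z * 'D_d phi z) = - \int[m4 0 T]_z (g z * phi z).
Proof.
move=> Iu Ig H phi tp; have := H phi tp.
have cphi : continuous phi by case: tp => /smooth_continuous.
by rewrite !int_periodicE //; [exact: intble4_mul|exact: (intble4_mul (@test_smooth_continuous phi d tp))].
Qed.

Lemma weak_deriv_wderiv4 d (u g : mst R -> R) : intble (m4 0 T) u -> intble (m4 0 T) g ->
  weak_deriv T d u g -> wderiv4 T d u g.
Proof. by move=> Iu Ig H N a; apply: weak_deriv_m4 => //; exact: e4_test. Qed.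

Lemma weak_deriv_slices j (u g : mst R -> R) : intble (m4 0 T) u -> intble (m4 0 T) g ->
  weak_deriv T (dx j) u g ->
  {ae mI 0 T, forall t, wderiv j (fun x => u (t, x)) (fun x => g (t, x))}.
Proof.
move=> Iu Ig H.
(* A single derivative is viewed as the divergence of a field with only its j-th component nonzero,
   the form handled by [slice_weak]. *)
pose W k := if k == j then u else (fun=> 0).
have IW k : intble (m4 0 T) (W k) by rewrite /W; case: ifP => // _; exact: intble0.
have E (k : 'I_3) : (k == j) = false -> W k = fun=> 0 by rewrite /W => ->.
have WE (D : 'I_3 -> R) z : \sum_k W k z * D k = u z * D j.
  rewrite (bigD1 j) //= {1}/W eqxx big1 ?addr0 // => k /negbTE kj.
  by rewrite E // mul0r.
have Hphi phi : test_periodic T phi ->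
    \int[m4 0 T]_z (\sum_k W k z * 'D_(dx k) phi z + g z * phi z) = 0.
  move=> tp; have cphi : continuous phi by case: tp => /smooth_continuous.
  transitivity (\int[m4 0 T]_z (u z * 'D_(dx j) phi z + g z * phi z)).
    by apply: Rint_ext => z; rewrite WE.
  rewrite Rint_add; [|exact: (intble4_mul (@test_smooth_continuous phi (dx j) tp))|exact: intble4_mul].
  by rewrite (weak_deriv_m4 Iu Ig H tp) addNr.
have Sl := slice_weak T0 IW Ig Hphi.
have Sec := ae_imp2 (intble_fub1 Iu) (intble_fub1 Ig) (fun t A B => conj A B).
apply: (ae_imp2 Sl Sec) => t Ht [Iut Igt] N a.
have ts := @e3_tsmooth R N a.
have c1 : continuous (e3 a : pt R -> R) := smooth_continuous (proj1 ts).
have c2 : continuous (fun x => 'D_(basis3 j) (e3 a : pt R -> R) x).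
  by apply: smooth_continuous; exact: smoothD (proj1 ts).
apply/eqP; rewrite -addr_eq0 -Rint_add; [|exact: intble3_mul|exact: intble3_mul].
by apply/eqP; rewrite -[RHS](Ht N a); apply: Rint_ext => x; rewrite WE.
Qed.

Lemma laplace_m4 (W : 'I_3 -> mst R -> R) (L : mst R -> R) :
  (forall k, intble (m4 0 T) (W k)) -> intble (m4 0 T) L ->
  (forall phi, test_periodic T phi ->
     int_periodic T (fun z => \sum_k W k z * 'D_(dx k) phi z) = - int_periodic T (fun z => L z * phi z)) ->
  forall phi, test_periodic T phi ->
     \int[m4 0 T]_z (\sum_k W k z * 'D_(dx k) phi z) = - \int[m4 0 T]_z (L z * phi z).
Proof.
move=> IW IL H phi tp; have cphi : continuous phi by case: tp => /smooth_continuous.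
have IS : intble (m4 0 T) (fun z => \sum_k W k z * 'D_(dx k) phi z).
  by apply: intble_sum => k; exact: (intble4_mul (@test_smooth_continuous phi (dx k) tp) (IW k)).
by rewrite -(int_periodicE IS) -(int_periodicE (intble4_mul cphi IL)) H.
Qed.

Lemma laplace_slices (W : 'I_3 -> mst R -> R) (L : mst R -> R) :
  (forall k, intble (m4 0 T) (W k)) -> intble (m4 0 T) L ->
  (forall phi, test_periodic T phi ->
     int_periodic T (fun z => \sum_k W k z * 'D_(dx k) phi z) = - int_periodic T (fun z => L z * phi z)) ->
  {ae mI 0 T, forall t, forall N (a : I3 N),
  \int[m3]_x (\sum_j W j (t, x) * 'D_(basis3 j) (e3 a : pt R -> R) x) =
  - \int[m3]_x (L (t, x) * e3 a x)}.
Proof.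
move=> IW IL H.
have Hphi phi : test_periodic T phi ->
    \int[m4 0 T]_z (\sum_k W k z * 'D_(dx k) phi z + L z * phi z) = 0.
  move=> tp; have cphi : continuous phi by case: tp => /smooth_continuous.
  rewrite Rint_add; [|by apply: intble_sum => k; exact: (intble4_mul (@test_smooth_continuous phi (dx k) tp) (IW k))|exact: intble4_mul].
  by rewrite (laplace_m4 IW IL H tp) addNr.
have Sl := slice_weak T0 IW IL Hphi.
have IWt : {ae mI 0 T, forall t, forall k, intble m3 (fun x => W k (t, x))}.
  by apply: ae_all_fin => k; exact: intble_fub1 (IW k).
have Sec := ae_imp2 IWt (intble_fub1 IL) (fun t A B => conj A B).
apply: (ae_imp2 Sl Sec) => t Ht [Iut Igt] N a.
have ts := @e3_tsmooth R N a.
have c1 : continuous (e3 a : pt R -> R) := smooth_continuous (proj1 ts).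
have c2 k : continuous (fun x => 'D_(basis3 k) (e3 a : pt R -> R) x).
  by apply: smooth_continuous; exact: smoothD (proj1 ts).
have I2 : intble m3 (fun x => L (t, x) * e3 a x) by exact: intble3_mul.
have I1 : intble m3 (fun x => \sum_j W j (t, x) * 'D_(basis3 j) (e3 a : pt R -> R) x).
  by apply: intble_sum => k; exact: (intble3_mul (c2 k) (Iut k)).
by apply/eqP; rewrite -addr_eq0 -(Rint_add I1 I2) Ht.
Qed.

End PeriodicWeakDerivatives.

(** * Forces, essential bounds and the weak formulation on a window *)

Section Forces.
Context {R : realType}.

Lemma force_continuous m (G Om : R) (FF : R -> 'I_3 -> st R -> R) : admissible_force m G FF ->
  forall i, continuous (FF Om i).
Proof.
have cCk k (f : pt R -> R) : Ck k f -> continuous f by case: k => [|k] [].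
case=> [[F [[sF _ _ _ _] ->]]|[f [[sf _ _ _] ->]]] i.
  have [_ /cCk cF] := sF i.
  move=> z; apply: (@cvg_comp _ _ _ (fun z : st R => z.2 + (Om * z.1) *: basis3 ord0) (F i) _ (nbhs (z.2 + (Om * z.1) *: basis3 ord0))); last exact: cF.
  apply: cvgD; first exact: cvg_snd.
  apply: cvgZl; apply: cvgMr; exact: cvg_fst.
have [_ /cCk cf] := sf i.
move=> z; apply: cvgM.
  by apply: (@cvg_comp _ _ _ snd (f i) _ (nbhs z.2)); [exact: cvg_snd|exact: cf].
apply: (@cvg_comp _ _ _ (fun z : st R => Om * z.1) sin _ (nbhs (Om * z.1))); last exact: continuous_sin.
by apply: cvgMr; exact: cvg_fst.
Qed.

Lemma Linfnorm_ae (v : 'I_3 -> st R -> R) (C : R) : (Linfnorm v <= C%:E)%E ->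
  forall i, {ae @leb4 R, forall z, `|v i z| <= C}.
Proof.
rewrite /Linfnorm unlock => H i; case: ifPn H => [_ /ess_supP|].
  apply: filterS => z /=; rewrite lee_fin ger0_norm ?sqrtr_ge0 //; apply: le_trans.
  rewrite -sqrtr_sqr ler_wsqrtr // (bigD1 i) //= lerDl.
  by apply: sumr_ge0 => j _; exact: sqr_ge0.
(* Degenerate branch in the definition of the essential supremum norm: if the whole space were null,
   any bound would hold almost everywhere. *)
rewrite -leNgt measure_le0 => /eqP m0 _.
by exists setT.
Qed.

Lemma vanish_derive (a b : R) (phi : st R -> R) d z :
  (forall t x, ~~ (a <= t <= b) -> phi (t, x) = 0) -> ~~ (a <= z.1 <= b) -> 'D_d phi z = 0.
Proof.
move=> H zab.
have N : \forall y \near z, cst 0 y = phi y.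
  have : \forall t \near z.1, ~~ (a <= t <= b).
    move: zab; rewrite negb_and -!ltNge => /orP[za|zb].
      by near=> t; rewrite negb_and -!ltNge; apply/orP; left; near: t; exact: lt_nbhsl.
    by near=> t; rewrite negb_and -!ltNge; apply/orP; right; near: t; exact: lt_nbhsr.
  move=> Nt; have : \forall y \near z, ~~ (a <= y.1 <= b) := cvg_fst Nt.
  move=> Q; near=> y.
  have : ~~ (a <= y.1 <= b) by near: y; exact: Q.
  by rewrite [y]surjective_pairing => /H ->.
by rewrite -(near_eq_derive d N) derive_cst.
Unshelve. all: by end_near.
Qed.

(** The weak solution is measurable on nonnegative times only; extension by 0 makes it measurable on
    all of space-time without changing the slices used. *)
Definition from0 (f : st R -> R) : mst R -> R := f \_ ([set t : measurableTypeR R | 0 <= t] `*` setT).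

Lemma from0E (f : st R -> R) t x : 0 <= t -> from0 f (t, x) = f (t, x).
Proof. by move=> t0; rewrite /from0 /patch mem_set. Qed.

Lemma from0_meas (I : Type) (u : I -> st R -> R) : evolution `[0, +oo[ u ->
  forall i, measurable_fun setT (from0 (u i)).
Proof.
move=> H i; have [mu _] := H i.
have E : `[(0 : R), +oo[%classic = [set t : measurableTypeR R | 0 <= t].
  by apply/seteqP; split => t /=; rewrite in_itv /= andbT.
rewrite E in mu.
have mD : measurable ([set t : measurableTypeR R | 0 <= t] `*` (setT : set (mpt R))).
  by apply: measurableX => //; rewrite -E; exact: measurable_itv.
exact: (proj1 (measurable_restrictT _ mD) mu).
Qed.

End Forces.

Section WeakFormulation.
Context {R : realType} (nu K : R).
Variables (F v : 'I_3 -> st R -> R) (v' : 'I_3 -> mst R -> R).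
Hypothesis vE : forall i t x, 0 < t -> v' i (t, x) = v i (t, x).
Hypotheses (SF : forall i, sqint (m4 0 K) (F i)) (Sv : forall i, sqint (m4 0 K) (v' i)).

(** The integrand vanishes off the time support of the test field, which lies in ]0, K]; the
    half-line can thus be replaced by the window and the iterated integral by one over the
    product. *)
Lemma weak_NS_window : weak_NS nu F v -> forall phi : 'I_3 -> st R -> R,
  (forall i, smooth (phi i)) -> (forall i t, periodic3 (slice phi t i)) ->
  (forall t, divergence_free (slice phi t)) ->
  (exists a b : R, [/\ 0 < a, b <= K & forall i t x, ~~ (a <= t <= b) -> phi i (t, x) = 0]) ->
  \int[m4 0 K]_z (\sum_i (v' i z * 'D_dt (phi i) z
       + \sum_j v' j z * v' i z * 'D_(dx j) (phi i) z
       + nu * v' i z * (\sum_j 'D_(dx j) (fun z => 'D_(dx j) (phi i) z) z)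
       + F i z * phi i z)) = 0.
Proof.
move=> H phi sphi pphi dphi [a [b [a0 bK van]]].
pose Psi z := \sum_i (v' i z * 'D_dt (phi i) z
       + \sum_j v' j z * v' i z * 'D_(dx j) (phi i) z
       + nu * v' i z * (\sum_j 'D_(dx j) (fun z => 'D_(dx j) (phi i) z) z)
       + F i z * phi i z).
have Iv i : intble (m4 0 K) (v' i) := sqint_intble (@m4_fin R 0 K) (Sv i).
have IF i : intble (m4 0 K) (F i) := sqint_intble (@m4_fin R 0 K) (SF i).
have Ivv i j : intble (m4 0 K) (fun z => v' i z * v' j z) := sqint_mul (Sv i) (Sv j).
have sD d i := smoothD d (sphi i).
have sDD i : smooth (fun z => \sum_j 'D_(dx j) (fun z => 'D_(dx j) (phi i) z) z).
  by apply: smooth_sum => j; exact: smoothD.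
have IPsi : intble (m4 0 K) Psi.
  apply: intble_sum => i; apply: intble_add; first apply: intble_add; first apply: intble_add.
  - exact: (intble4_mul (smooth_continuous (sD dt i)) (Iv i)).
  - apply: intble_sum => j; exact: (intble4_mul (smooth_continuous (sD (dx j) i)) (Ivv j i)).
  - exact: (intble4_mul (smooth_continuous (sDD i)) (intble_scale nu (Iv i))).
  - exact: (intble4_mul (smooth_continuous (sphi i)) (IF i)).
have Psi0 z : ~~ (a <= z.1 <= b) -> Psi z = 0.
  move=> zab; rewrite /Psi big1 // => i _.
  have D0 d y : ~~ (a <= y.1 <= b) -> 'D_d (phi i) y = 0 by apply: vanish_derive => t x; exact: van.
  rewrite D0 // mulr0 add0r big1 ?add0r => [|j _]; last by rewrite D0 // mulr0.
  rewrite big1 ?mulr0 ?add0r => [|j _]; last by apply: (@vanish_derive R a b) => // t x tab; exact: D0.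
  by case: z zab => t x /= zab; rewrite van // mulr0.
have mPsi := intble_meas IPsi.
have [_ <-] := Rint_fub1 IPsi.
rewrite -[RHS](H phi sphi pphi dphi (ex_intro _ a (ex_intro _ b (conj a0 van)))).
rewrite mI_Rint; last exact: meas_fub1 IPsi.
transitivity (\int[@lebesgue_measure R]_(t in `]0, +oo[) \int[m3]_x Psi (t, x)); last first.
  apply: eq_Rintegral => t; rewrite inE /= in_itv /= andbT => t0.
  rewrite m3_Rint; last exact: slice_meas mPsi.
  apply: eq_Rintegral => x _; rewrite /Psi; apply: eq_bigr => i _; rewrite !vE //.
  by congr (_ + _ + _ + _); apply: eq_bigr => j _; rewrite !vE.
rewrite Rintegral_mkcond [RHS]Rintegral_mkcond; congr (\int[_]_(x in _) _).
apply/funext => t; rewrite /patch.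
have [tab|tab] := boolP (a <= t <= b).
  have /andP[ta tb] := tab.
  have t0 : 0 < t := lt_le_trans a0 ta.
  rewrite mem_set; last by rewrite /= in_itv /= (ltW t0) (le_trans tb bK).
  by rewrite mem_set //= in_itv /= t0.
have Z : \int[m3]_x Psi (t, x) = 0.
  transitivity (\int[m3]_x (0 : R)); last by rewrite Rintegral_cst // mul0r.
  by apply: Rint_ext => x; rewrite Psi0.
by rewrite Z; case: ifP; case: ifP.
Qed.

End WeakFormulation.

(** * Energy balances and slice properties in real form *)

Section EnergyBalance.
Context {R : realType} (nu s t : R).
Variables (F v : 'I_3 -> mst R -> R) (Dv : 'I_3 * 'I_3 -> mst R -> R).
Hypotheses (Ss : forall i, sqint m3 (slice v s i)) (St : forall i, sqint m3 (slice v t i)).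
Hypotheses (SF : forall i, sqint (m4 s t) (F i)) (Sv : forall i, sqint (m4 s t) (v i))
  (SDv : forall ij, sqint (m4 s t) (Dv ij)).

Let lhs : R := \int[m3]_x (\sum_i v i (t, x) ^+ 2) + 2 * nu * \int[mI s t]_r \int[m3]_x (\sum_ij Dv ij (r, x) ^+ 2).
Let rhs : R := \int[m3]_x (\sum_i v i (s, x) ^+ 2) + 2 * \int[mI s t]_r \int[m3]_x (\sum_i F i (r, x) * v i (r, x)).

Lemma energy_real rel : energy_balance rel nu F v Dv s t -> rel lhs%:E rhs%:E.
Proof.
rewrite /energy_balance (L2sq_integral_real SDv) (dotL2_integral_real SF Sv).
by rewrite (L2sq_real St) (L2sq_real Ss) -EFinM -!EFinD.
Qed.

End EnergyBalance.

Section Slices.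
Context {R : realType}.

Lemma solenoidal_sol3 (a : 'I_3 -> mpt R -> R) : (forall i, measurable_fun setT (a i)) ->
  solenoidal a -> sol3 a.
Proof.
move=> ma H psi tp; rewrite m3_Rint; first by apply: H; case: tp.
apply: measurable_sum => i; apply: measurable_funM; first exact: ma.
by apply: continuous_meas3; case: (tsmoothD (basis3 i) tp) => /smooth_continuous.
Qed.

Lemma weak_gradient_wderiv (u : 'I_3 -> mpt R -> R) (Du : 'I_3 * 'I_3 -> mpt R -> R) :
  (forall i, measurable_fun setT (u i)) -> (forall ij, measurable_fun setT (Du ij)) ->
  weak_gradient u Du -> forall i j, wderiv j (u i) (Du (i, j)).
Proof.
move=> mu mD H i j N a; have ts := @e3_tsmooth R N a.
rewrite m3_Rint; last first.
  apply: measurable_funM; first exact: mu.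
  by apply: continuous_meas3; case: (tsmoothD (basis3 j) ts) => /smooth_continuous.
rewrite m3_Rint; first by apply: H; case: ts.
by apply: measurable_funM; [exact: mD|apply: continuous_meas3; case: ts => /smooth_continuous].
Qed.

Lemma ae_lebesgue_imp (P Q : R -> Prop) :
  {ae @lebesgue_measure R, forall t : measurableTypeR R, P t} -> (forall t, P t -> Q t) ->
  {ae @lebesgue_measure R, forall t : measurableTypeR R, Q t}.
Proof. by move=> [A [mA A0 PA]] PQ; exists A; split=> // t /= nQ; apply: PA => /= /PQ. Qed.

Lemma ae_mI_lebesgue (a b : R) (P : R -> Prop) :
  {ae @lebesgue_measure R, forall t : measurableTypeR R, a <= t <= b -> P t} -> {ae mI a b, forall t, P t}.
Proof.
move=> H; apply/(restr_ae (measurable_itv `[a, b]) (nu := mI a b) (fun A _ => mIE a b A)).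
by apply: filterS H => t Ht; rewrite /= in_itv.
Qed.

Lemma ae_neq0 : {ae @lebesgue_measure R, forall t : measurableTypeR R, t != 0}.
Proof.
exists [set 0]; split; [exact: measurable_set1|exact: lebesgue_measure_set1|].
by move=> t /= /negP; rewrite negbK => /eqP.
Qed.

Lemma L2_periodicP (T : R) (I : finType) (u : I -> st R -> R) : 0 < T -> L2_periodic T u ->
  [/\ forall i, measurable_fun setT (u i : mst R -> R), forall i, tperiodic T (u i)
    & forall n i, sqint (m4 0 (n%:R * T)) (u i)].
Proof.
move=> T0 [ev per foo].
have mu i : measurable_fun setT (u i : mst R -> R) by have [] := ev i; rewrite setXTT.
have pu i : tperiodic T (u i) by move=> t x; exact: per.
split=> // n i; apply: (sqint_periodic T0 n (mu i) (pu i)).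
exact: component_integral_finite.
Qed.

End Slices.

(** * Attraction by a small regular periodic solution *)

Section Attraction.
Context {R : realType} (nu T M : R).
Hypotheses (nu0 : 0 < nu) (T0 : 0 < T) (M0 : 0 <= M) (Mnu : M * (3 * (2 * pi) ^+ 2 + 1) <= nu).
Variables (F U v : 'I_3 -> st R -> R).
Hypothesis cF : forall i, continuous (F i).
Hypothesis UM : forall i, {ae @leb4 R, forall z, `|U i z| <= M}.

Variables (Ut LU gp : 'I_3 -> st R -> R) (DU : 'I_3 * 'I_3 -> st R -> R) (p : st R -> R).
Hypothesis hU : L2_periodic T U.
Hypothesis hUs : forall t, [/\ inL2 (slice U t), solenoidal (slice U t) & zero_mean (slice U t)].
Hypothesis hUc : forall s : R, L2norm (fun i x => U i (t, x) - U i (s, x)) @[t --> s] --> 0%E.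
Hypotheses (hUt : L2_periodic T Ut) (hUtd : forall i, weak_deriv T dt (U i) (Ut i)).
Hypotheses (hDU : L2_periodic T DU) (hDUd : forall i j, weak_deriv T (dx j) (U i) (DU (i, j))).
Hypotheses (hLU : L2_periodic T LU) (hLUd : forall i phi, test_periodic T phi ->
  int_periodic T (fun z => \sum_j DU (i, j) z * 'D_(dx j) phi z) =
  - int_periodic T (fun z => LU i z * phi z)).
Hypotheses (hp : L2_periodic T (fun _ : unit => p)) (hgp : L2_periodic T gp)
  (hgpd : forall i, weak_deriv T (dx i) p (gp i)).
Hypothesis hC : L2_periodic T (fun i z => \sum_j U j z * DU (i, j) z).
Hypothesis heq : forall i, {ae @leb4 R, forall z,
  Ut i z + \sum_j U j z * DU (i, j) z - nu * LU i z + gp i z = F i z}.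
Hypothesis hUe : forall s t, s <= t -> energy_balance eq nu F U DU s t.

Variable Dv : 'I_3 * 'I_3 -> st R -> R.
Hypothesis hv : evolution `[0, +oo[ v.
Hypothesis hvs : forall t, 0 <= t ->
  [/\ inL2 (slice v t), solenoidal (slice v t) & zero_mean (slice v t)].
Hypothesis hvc : forall g : 'I_3 -> pt R -> R, inL2 g ->
  {within `[0, +oo[, continuous (fun t => dotL2 (slice v t) g)}.
Hypothesis hvb : forall K, 0 < K -> exists B : R,
  {ae @lebesgue_measure R, forall t, 0 < t < K -> (L2norm (slice v t) <= B%:E)%E}.
Hypothesis hNS : weak_NS nu F v.
Hypothesis hDv : evolution `[0, +oo[ Dv.
Hypothesis hDvd : {ae @lebesgue_measure R, forall t, 0 < t -> weak_gradient (slice v t) (slice Dv t)}.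
Hypothesis hDvi : forall K, 0 < K ->
  (\int[@lebesgue_measure R]_(t in `[0%R, K]) L2sq (slice Dv t) < +oo)%E.
Hypothesis hve0 : forall t, 0 < t -> energy_balance (fun a b => (a <= b)%E) nu F v Dv 0 t.
Hypothesis hve : {ae @lebesgue_measure R, forall s, 0 < s -> forall t, s < t ->
  energy_balance (fun a b => (a <= b)%E) nu F v Dv s t}.

Let vb i := from0 (v i).
Let Db ij := from0 (Dv ij).
(** Windows are whole numbers of periods, at least one, so that periodic fields can be cut into
    periods. *)
Let K n := n.+1%:R * T.

Let K0 n : 0 < K n. Proof. by rewrite mulr_gt0 // ltr0n. Qed.

Let mU i : measurable_fun setT (U i : mst R -> R). Proof. by have [] := L2_periodicP T0 hU. Qed.
Let mvb i : measurable_fun setT (vb i). Proof. exact: from0_meas hv i. Qed.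
Let mDb ij : measurable_fun setT (Db ij). Proof. exact: from0_meas hDv ij. Qed.

Let vbE t : 0 <= t -> slice vb t = slice v t.
Proof. by move=> t0; apply/funext => i; apply/funext => x; rewrite /slice /vb from0E. Qed.
Let DbE t : 0 <= t -> slice Db t = slice Dv t.
Proof. by move=> t0; apply/funext => i; apply/funext => x; rewrite /slice /Db from0E. Qed.

Let SvL t : 0 <= t -> forall i, sqint m3 (slice vb t i).
Proof.
move=> t0 i; apply: sqint_of_L2sq => [j|]; first exact: slice_meas.
by rewrite vbE //; have [[_ ->] _ _] := hvs t0.
Qed.

Let SUL t : forall i, sqint m3 (slice U t i).
Proof.
move=> i; apply: sqint_of_L2sq => [j|]; first exact: slice_meas.
by have [[_ ->] _ _] := hUs t.
Qed.

Let L2sq_eq_int (u : 'I_3 * 'I_3 -> st R -> R) (w : 'I_3 * 'I_3 -> st R -> R) a b : 0 <= a ->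
  (forall t, 0 <= t -> slice u t = slice w t) ->
  (\int[@lebesgue_measure R]_(t in `[a, b]) L2sq (slice u t) =
   \int[@lebesgue_measure R]_(t in `[a, b]) L2sq (slice w t))%E.
Proof.
move=> a0 E; apply: eq_integral => t; rewrite inE /= in_itv /= => /andP[at_ _].
by rewrite E // (le_trans a0).
Qed.

Let SDb L : 0 < L -> forall ij, sqint (m4 0 L) (Db ij).
Proof.
move=> L0 ij; apply: sqint_of_evolution => //.
by rewrite (@L2sq_eq_int Db Dv 0 L (lexx 0) (fun t t0 => DbE t0)); exact: hDvi.
Qed.

Let Svb L : 0 < L -> forall i, sqint (m4 0 L) (vb i).
Proof.
move=> L0 i; apply: sqint_of_evolution => //.
(* The bound is given on an open interval of times; one unit more includes t = L. *)
have L1 : 0 < L + 1 by rewrite addr_gt0.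
have [B HB] := hvb L1.
rewrite -mI_integral; last exact: L2sq_slice_meas.
apply: (@le_lt_trans _ _ (\int[mI 0 L]_t (B ^+ 2)%:E)%E); last first.
  by rewrite integral_cst //= lte_mul_pinfty ?lee_fin ?sqr_ge0 //; exact: mI_fin.
apply: ae_ge0_le_integral => //.
- by move=> t _; exact: L2sq_ge0.
- exact: L2sq_slice_meas.
- by move=> t _; rewrite lee_fin sqr_ge0.
have H : {ae mI 0 L, forall t, 0 < t < L + 1 -> (L2norm (slice v t) <= B%:E)%E}.
  by apply: ae_mI_lebesgue; apply: (ae_lebesgue_imp HB) => t Ht _.
have N0 : {ae mI 0 L, forall t : R, t != 0}.
  by apply: ae_mI_lebesgue; apply: (ae_lebesgue_imp (@ae_neq0 R)) => t Ht _.
have H2 := ae_imp2 N0 (mI_ae 0 L) (fun t A B => conj A B).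
apply: (ae_imp2 H H2) => t Ht [tn /andP[t0 tL]] _.
have tp : 0 < t by rewrite lt_neqAle eq_sym tn.
have := Ht; rewrite tp (le_lt_trans tL) ?ltrDl // => /(_ isT).
rewrite -vbE // (L2norm_real (SvL t0)) (L2sq_real (SvL t0)) !lee_fin.
set I := \int[m3]_x _; have I0 : 0 <= I by apply: Rint_ge0 => x; apply: sumr_ge0 => j _; exact: sqr_ge0.
move=> sB; rewrite -(sqr_sqrtr I0); apply: lerXn2r => //; rewrite nnegrE ?sqrtr_ge0 //.
exact: le_trans (sqrtr_ge0 _) sB.
Qed.

Let periodic_window (P : R -> Prop) : (forall t, P (t + T) <-> P t) -> {ae mI 0 T, forall t, P t} ->
  forall L, {ae mI 0 L, forall t, P t}.
Proof.
move=> PT H L; apply: ae_mI_lebesgue.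
by apply: (ae_lebesgue_imp (periodic_ae T0 PT H)) => t Ht /andP[t0 _]; exact: Ht.
Qed.

Let pU := let: And3 _ h _ := L2_periodicP T0 hU in h.
Let pUt := let: And3 _ h _ := L2_periodicP T0 hUt in h.
Let pLU := let: And3 _ h _ := L2_periodicP T0 hLU in h.
Let pgp := let: And3 _ h _ := L2_periodicP T0 hgp in h.
Let pDU := let: And3 _ h _ := L2_periodicP T0 hDU in h.
Let pp : tperiodic T p. Proof. by have [_ h _] := L2_periodicP T0 hp; exact: (h tt). Qed.

Let SU n i : sqint (m4 0 (n%:R * T)) (U i). Proof. by have [_ _ h] := L2_periodicP T0 hU; exact: h. Qed.
Let SUt n i : sqint (m4 0 (n%:R * T)) (Ut i). Proof. by have [_ _ h] := L2_periodicP T0 hUt; exact: h. Qed.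
Let SLU n i : sqint (m4 0 (n%:R * T)) (LU i). Proof. by have [_ _ h] := L2_periodicP T0 hLU; exact: h. Qed.
Let Sgp n i : sqint (m4 0 (n%:R * T)) (gp i). Proof. by have [_ _ h] := L2_periodicP T0 hgp; exact: h. Qed.
Let SDU n ij : sqint (m4 0 (n%:R * T)) (DU ij). Proof. by have [_ _ h] := L2_periodicP T0 hDU; exact: h. Qed.
Let Sp n : sqint (m4 0 (n%:R * T)) p. Proof. by have [_ _ h] := L2_periodicP T0 hp; exact: (h n tt). Qed.

Let one (f : mst R -> R) : (forall n, sqint (m4 0 (n%:R * T)) f) -> intble (m4 0 T) f.
Proof. by move=> /(_ 1%N); rewrite mul1r; apply: sqint_intble; exact: m4_fin. Qed.

(** The force inherits square integrability from the equation of [U], all of whose terms are in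
    L_2. *)
Let SF n i : sqint (m4 0 (n%:R * T)) (F i).
Proof.
split; first exact: (continuous_meas4 (@cF i)).
have SC : sqint (m4 0 (n%:R * T)) (fun z => \sum_j U j z * DU (i, j) z).
  by have [_ _ h] := L2_periodicP T0 hC; exact: h.
have [_ S] : sqint (m4 0 (n%:R * T)) (fun z => Ut i z + \sum_j U j z * DU (i, j) z - nu * LU i z + gp i z).
  by apply: sqint_add => //; apply: sqint_sub; [exact: sqint_add|exact: sqint_scale].
apply: intble_ae_le S; first by apply: measurable_funX; exact: (continuous_meas4 (@cF i)).
by apply: (ae_imp (m4_ae 0 (n%:R * T) (heq i))) => z ->; rewrite ger0_norm // sqr_ge0.
Qed.

Let wdU L : {ae mI 0 L, forall t, forall i j, wderiv j (slice U t i) (fun x => DU (i, j) (t, x))}.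
Proof.
apply: periodic_window => [t|].
  have E i : slice U (t + T) i = slice U t i by apply/funext => x; exact: pU.
  have E' ij : (fun x => DU ij (t + T, x)) = (fun x => DU ij (t, x)) by apply/funext => x; exact: pDU.
  by split=> H i j; have := H i j; rewrite E E'.
apply: ae_all_fin => i; apply: ae_all_fin => j.
exact: (weak_deriv_slices T0 (one (fun n => SU n i)) (one (fun n => SDU n (i, j))) (hDUd i j)).
Qed.

Let wdp L : {ae mI 0 L, forall t, forall i, wderiv i (fun x => p (t, x)) (slice gp t i)}.
Proof.
apply: periodic_window => [t|].
  have E i : slice gp (t + T) i = slice gp t i by apply/funext => x; exact: pgp.
  have E' : (fun x => p (t + T, x)) = (fun x => p (t, x)) by apply/funext => x; exact: pp.
  by split=> H i; have := H i; rewrite E E'.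
apply: ae_all_fin => i.
exact: (weak_deriv_slices T0 (one Sp) (one (fun n => Sgp n i)) (hgpd i)).
Qed.

Let lap3 L : {ae mI 0 L, forall t, forall i N (a : I3 N),
  \int[m3]_x (\sum_j DU (i, j) (t, x) * 'D_(basis3 j) (e3 a : pt R -> R) x) =
  - \int[m3]_x (slice LU t i x * e3 a x)}.
Proof.
apply: periodic_window => [t|].
  have E i : slice LU (t + T) i = slice LU t i by apply/funext => x; exact: pLU.
  have E' i N (a : I3 N) : (fun x => \sum_j DU (i, j) (t + T, x) * 'D_(basis3 j) (e3 a : pt R -> R) x) =
     (fun x => \sum_j DU (i, j) (t, x) * 'D_(basis3 j) (e3 a : pt R -> R) x).
    by apply/funext => x; apply: eq_bigr => j _; rewrite pDU.
  by split=> H i N a; have := H i N a; rewrite E E'.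
apply: ae_all_fin => i.
exact: (laplace_slices T0 (fun k => one (fun n => SDU n (i, k))) (one (fun n => SLU n i)) (hLUd i)).
Qed.

Let solU t : sol3 (slice U t).
Proof. by apply: solenoidal_sol3 => [i|]; [exact: slice_meas|have [] := hUs t]. Qed.

Let solv t : 0 <= t -> sol3 (slice vb t).
Proof.
move=> t0; apply: solenoidal_sol3 => [i|]; first exact: slice_meas.
by rewrite vbE //; have [] := hvs t0.
Qed.

Let solvL L : {ae mI 0 L, forall t, sol3 (slice vb t)}.
Proof. by apply: (ae_imp (mI_ae 0 L)) => t /andP[t0 _]; exact: solv. Qed.

Let wdv L : {ae mI 0 L, forall t, forall i j, wderiv j (slice vb t i) (fun x => Db (i, j) (t, x))}.
Proof.
have H : {ae mI 0 L, forall t, 0 < t -> weak_gradient (slice v t) (slice Dv t)}.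
  by apply: ae_mI_lebesgue; apply: (ae_lebesgue_imp hDvd) => t Ht _.
have N0 : {ae mI 0 L, forall t : R, t != 0}.
  by apply: ae_mI_lebesgue; apply: (ae_lebesgue_imp (@ae_neq0 R)) => t Ht _.
have H2 := ae_imp2 N0 (mI_ae 0 L) (fun t A B => conj A B).
apply: (ae_imp2 H H2) => t Ht [tn /andP[t0 tL]].
have tp : 0 < t by rewrite lt_neqAle eq_sym tn.
have := Ht tp; rewrite -vbE // -DbE //; apply: weak_gradient_wderiv => [i|ij]; exact: slice_meas.
Qed.

Let UML n i : {ae m4 0 (n%:R * T), forall z, `|U i z| <= M}.
Proof. exact: m4_ae. Qed.

Let DU2 i j := DU (i, j).
Let Db2 i j := Db (i, j).
Let h (t : measurableTypeR R) : R := \int[m3]_x pairing U vb (t, x).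
Let g (t : measurableTypeR R) : R := \int[m3]_x pairing_rate nu U F vb DU2 Db2 (t, x).

Let Ih n : intble (mI 0 (K n)) h.
Proof. by have [] := Rint_fub1 (pairing_intble (SU n.+1) (Svb (K0 n))). Qed.

Let Ipr n : intble (m4 0 (K n)) (pairing_rate nu U F vb DU2 Db2).
Proof.
exact: (pairing_rate_intble nu (SU n.+1) (SF n.+1) (Svb (K0 n)) (fun i j => SDU n.+1 (i, j))
  (fun i j => SDb (K0 n) (i, j)) (UML n.+1)).
Qed.

Let Ig n : intble (mI 0 (K n)) g.
Proof. by have [] := Rint_fub1 (Ipr n). Qed.

Let weak_pairing n (chi : R -> R) : smooth chi ->
  (exists a b, [/\ 0 < a, b <= K n & forall r, ~~ (a <= r <= b) -> chi r = 0]) ->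
  \int[mI 0 (K n)]_r ('D_1 chi r * h r) + \int[mI 0 (K n)]_r (chi r * g r) = 0.
Proof.
move=> sc supp.
have wdt i := weak_deriv_wderiv4 T0 (one (fun n => SU n i)) (one (fun n => SUt n i)) (hUtd i).
have wdx i j := weak_deriv_wderiv4 T0 (one (fun n => SU n i)) (one (fun n => SDU n (i, j))) (hDUd i j).
have lap4 i N (a : I4 N) : \int[m4 0 T]_z (\sum_j DU2 i j z * 'D_(dx j) (e4 T a : st R -> R) z) =
  - \int[m4 0 T]_z (LU i z * e4 T a z).
  exact: (laplace_m4 (fun k => one (fun n => SDU n (i, k))) (one (fun n => SLU n i)) (hLUd i) (e4_test a T0)).
have vbE' i t x : 0 < t -> vb i (t, x) = v i (t, x) by move=> /ltW t0; rewrite /vb from0E.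
exact: (duality T0 (SU n.+1) (SUt n.+1) (SLU n.+1) (Sgp n.+1) (SF n.+1) (Svb (K0 n))
  (fun i j => SDU n.+1 (i, j)) (fun i j => SDb (K0 n) (i, j)) (Sp n.+1) pU pUt pLU (UML n.+1)
  wdt wdx lap4 solU (solvL (K n)) (wdv (K n)) (wdp (K n)) (lap3 (K n))
  (fun i => m4_ae 0 (K n) (heq i)) (weak_NS_window vbE' (SF n.+1) (Svb (K0 n)) hNS) sc supp).
Qed.

Let balance_vb rel s t : 0 <= s -> s <= t ->
  energy_balance rel nu F v Dv s t -> energy_balance rel nu F vb Db s t.
Proof.
move=> s0 slt; rewrite /energy_balance -(vbE s0) -(vbE (le_trans s0 slt)).
rewrite -(L2sq_eq_int t s0 (fun t t0 => DbE t0)).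
rewrite (_ : \int[@lebesgue_measure R]_(r in `[s, t]) dotL2 (slice F r) (slice v r) =
  \int[@lebesgue_measure R]_(r in `[s, t]) dotL2 (slice F r) (slice vb r)) //.
apply: eq_Rintegral => r; rewrite inE /= in_itv /= => /andP[sr _].
by rewrite vbE // (le_trans s0).
Qed.

Let V (t : measurableTypeR R) : R := \int[m3]_x (\sum_i vb i (t, x) ^+ 2).
Let VU (t : measurableTypeR R) : R := \int[m3]_x (\sum_i U i (t, x) ^+ 2).
Let A (t : measurableTypeR R) : R := \int[m3]_x (\sum_ij Db ij (t, x) ^+ 2).
Let B (t : measurableTypeR R) : R := \int[m3]_x (\sum_ij DU ij (t, x) ^+ 2).
Let f1 (t : measurableTypeR R) : R := \int[m3]_x (\sum_i F i (t, x) * vb i (t, x)).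
Let f2 (t : measurableTypeR R) : R := \int[m3]_x (\sum_i F i (t, x) * U i (t, x)).

Let exK (t : R) : exists n, t < K n.
Proof.
exists (Num.truncn (t / T)); rewrite /K -ltr_pdivrMr //.
exact: truncnS_gt.
Qed.

Let sub n s t (f : mst R -> R) : 0 <= s -> t < K n -> sqint (m4 0 (K n)) f -> sqint (m4 s t) f.
Proof. by move=> s0 /ltW tK; exact: sqint_m4_sub. Qed.

Let energy_v s t : 0 <= s -> s <= t -> energy_balance (fun a b => (a <= b)%E) nu F v Dv s t ->
  V t + 2 * nu * \int[mI s t]_r A r <= V s + 2 * \int[mI s t]_r f1 r.
Proof.
move=> s0 slt /(balance_vb s0 slt) H; have [n tn] := exK t.
have := energy_real (SvL s0) (SvL (le_trans s0 slt)) (fun i => sub s0 tn (SF n.+1 i))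
  (fun i => sub s0 tn (Svb (K0 n) i)) (fun ij => sub s0 tn (SDb (K0 n) ij)) H.
by rewrite lee_fin.
Qed.

Let energy_U s t : 0 <= s -> s <= t ->
  VU t + 2 * nu * \int[mI s t]_r B r = VU s + 2 * \int[mI s t]_r f2 r.
Proof.
move=> s0 slt; have [n tn] := exK t.
have [] := energy_real (SUL s) (SUL t) (fun i => sub s0 tn (SF n.+1 i))
  (fun i => sub s0 tn (SU n.+1 i)) (fun ij => sub s0 tn (SDU n.+1 ij)) (hUe slt).
exact.
Qed.

Let If1 n : intble (mI 0 (K n)) f1.
Proof.
have I1 : intble (m4 0 (K n)) (fun z => \sum_i F i z * vb i z).
  by apply: intble_sum => i; exact: (sqint_mul (SF n.+1 i) (Svb (K0 n) i)).
by have [] := Rint_fub1 I1.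
Qed.

Let If2 n : intble (mI 0 (K n)) f2.
Proof.
have I1 : intble (m4 0 (K n)) (fun z => \sum_i F i z * U i z).
  by apply: intble_sum => i; exact: (sqint_mul (SF n.+1 i) (SU n.+1 i)).
by have [] := Rint_fub1 I1.
Qed.

Let IA n : intble (mI 0 (K n)) A.
Proof. by have [] := Rint_fub1 (sumsq4_intble (SDb (K0 n))). Qed.

Let IB n : intble (mI 0 (K n)) B.
Proof. by have [] := Rint_fub1 (sumsq4_intble (SDU n.+1)). Qed.

(** The energy inequality started at s = 0 holds at every t > 0. This gives a bound at every time,
    which the continuity argument for [h] requires, and not merely at almost every one. *)
Let V_bounded n : exists2 C, 0 <= C & forall t, 0 < t -> t < K n -> V t <= C.
Proof.
have V0 t : 0 <= V t by apply: Rint_ge0 => x; apply: sumr_ge0 => i _; exact: sqr_ge0.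
have A0 t : 0 <= A t by apply: Rint_ge0 => x; apply: sumr_ge0 => i _; exact: sqr_ge0.
exists (V 0 + 2 * \int[mI 0 (K n)]_r `|f1 r|).
  by rewrite addr_ge0 // mulr_ge0 // Rint_ge0.
move=> t t0 tK.
have arith (a b b' c c' x y : R) : x + 2 * nu * a <= y + 2 * b -> 0 <= nu * a -> b <= b' -> b' <= c ->
    c <= c' -> x <= y + 2 * c'.
  by move=> *; lra.
have I1 : intble (mI 0 t) f1 := intble_mI_sub (lexx 0) (ltW tK) (If1 n).
apply: (arith _ _ _ _ _ _ _ (energy_v (lexx 0) (ltW t0) (hve0 t0)) _ (ler_norm _) (Rint_abs I1)
  (Rint_mI_sub (lexx 0) (ltW tK) (fun x => normr_ge0 (f1 x)) (intble_abs (If1 n)))).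
by rewrite mulr_ge0 ?(ltW nu0) // Rint_ge0.
Qed.

Let inL2U t : inL2 (slice U t).
Proof. by have [] := hUs t. Qed.

(** Split (v(s), U(s)) into (v(s), U(s) - U(t)) and (v(s), U(t)). The first is small by strong
    continuity of [U] and boundedness of v, the second converges by weak continuity of v. *)
Let h_continuous (t : R) : 0 < t -> {for t, continuous (h : R -> R)}.
Proof.
move=> t0; have [n tK] := exK t; have [C C0 VC] := V_bounded n.
pose d s := \int[m3]_x (\sum_i vb i (s, x) * U i (t, x)).
have dE s : 0 <= s -> dotL2 (slice v s) (slice U t) = d s.
  move=> s0; rewrite -(vbE s0).
  exact: (@dotL2E _ _ (slice vb s) (slice U t) (fun i => slice_meas s (mvb i)) (fun i => slice_meas t (mU i))).
have cd : (fun s => dotL2 (slice v s) (slice U t)) s @[s --> t] --> dotL2 (slice v t) (slice U t).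
  have sub0 : `]0, +oo[%classic `<=` (`[0, +oo[%classic : set R).
    by move=> x /=; rewrite !in_itv /= !andbT => /ltW.
  have := continuous_subspaceW sub0 (hvc (inL2U t)).
  rewrite continuous_open_subspace; last exact: interval_open.
  by apply; rewrite inE /= in_itv /= t0.
pose D s := \int[m3]_x (\sum_i (U i (s, x) - U i (t, x)) ^+ 2).
have SD s i : sqint m3 (fun x => U i (s, x) - U i (t, x)) := sqint_sub (SUL s i) (SUL t i).
have cD : Num.sqrt (D s) @[s --> t] --> (0 : R).
  have E s : L2norm (fun i x => U i (s, x) - U i (t, x)) = (Num.sqrt (D s))%:E := L2norm_real (SD s).
  have -> : (fun s => Num.sqrt (D s)) = fine \o (fun s => L2norm (fun i x => U i (s, x) - U i (t, x))).
    by apply/funext => s /=; rewrite E.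
  exact: (fine_cvg (hUc t)).
apply/cvgrPdist_le => e e0.
(* Half of e is shared among three components, each bounded by the square root of C times the
   distance of U(s) to U(t). *)
have e1 : 0 < e / (2 * 3 * (Num.sqrt C + 1)) by rewrite divr_gt0 // mulr_gt0 // ltr_wpDl ?sqrtr_ge0.
have e2 : 0 < e / 2 by rewrite divr_gt0.
near=> s.
have s0 : 0 < s by near: s; exact: lt_nbhsr.
have sK : s < K n by near: s; exact: lt_nbhsl.
have N1 : `|dotL2 (slice v t) (slice U t) - dotL2 (slice v s) (slice U t)| <= e / 2.
  by near: s; move/cvgrPdist_le : cd; apply.
have N2 : `|0 - Num.sqrt (D s)| <= e / (2 * 3 * (Num.sqrt C + 1)).
  by near: s; move/cvgrPdist_le : cD; apply.
rewrite (dE _ (ltW t0)) (dE _ (ltW s0)) in N1.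
rewrite sub0r normrN (ger0_norm (sqrtr_ge0 (D s))) in N2.
have D0 : 0 <= D s by apply: Rint_ge0 => x; apply: sumr_ge0 => i _; exact: sqr_ge0.
have Iv i : intble m3 (fun x => vb i (s, x) * (U i (s, x) - U i (t, x))) := sqint_mul (SvL (ltW s0) i) (SD s i).
have I1 i : intble m3 (fun x => vb i (s, x) * U i (t, x)) := sqint_mul (SvL (ltW s0) i) (SUL t i).
have E : h s = \sum_i \int[m3]_x (vb i (s, x) * (U i (s, x) - U i (t, x))) + d s.
  rewrite -Rint_sum // /d -(Rint_add (intble_sum (index_enum _) Iv) (intble_sum (index_enum _) I1)).
  by apply: Rint_ext => x; rewrite -big_split /=; apply: eq_bigr => i _; ring.
have ht : h t = d t by [].
have B1 i : `|\int[m3]_x (vb i (s, x) * (U i (s, x) - U i (t, x)))| <= Num.sqrt C * Num.sqrt (D s).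
  rewrite -sqrtrM // -sqrtr_sqr; apply: ler_wsqrtr.
  apply: le_trans (cauchy_schwarz (SvL (ltW s0) i) (SD s i)) _.
  have comp (u : 'I_3 -> mpt R -> R) : (forall i, sqint m3 (u i)) -> \int[m3]_x (u i x ^+ 2) <= \int[m3]_x (\sum_i u i x ^+ 2).
    move=> Su; apply: Rint_le; [by case: (Su i)|exact: sumsq_intble|move=> x].
    by rewrite (bigD1 i) //= lerDl; apply: sumr_ge0 => j _; exact: sqr_ge0.
  apply: ler_pM; [by apply: Rint_ge0 => x; exact: sqr_ge0|by apply: Rint_ge0 => x; exact: sqr_ge0| |].
    by apply: le_trans (VC s s0 sK); exact: (comp (slice vb s) (SvL (ltW s0))).
  exact: (comp (fun i x => U i (s, x) - U i (t, x)) (SD s)).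
have B2 : `|\sum_i \int[m3]_x (vb i (s, x) * (U i (s, x) - U i (t, x)))| <= 3 * (Num.sqrt C * Num.sqrt (D s)).
  apply: le_trans (ler_norm_sum _ _ _) _.
  apply: le_trans (ler_sum _ (fun i _ => B1 i)) _.
  by rewrite sum3; lra.
have B3 : 3 * (Num.sqrt C * Num.sqrt (D s)) <= e / 2.
  have q : Num.sqrt C * Num.sqrt (D s) <= (Num.sqrt C + 1) * (e / (2 * 3 * (Num.sqrt C + 1))).
    by apply: ler_pM; rewrite ?sqrtr_ge0 // lerDl.
  have E3 : (Num.sqrt C + 1) * (e / (2 * 3 * (Num.sqrt C + 1))) = e / 6.
    by field; rewrite gt_eqF // ltr_wpDl ?sqrtr_ge0.
  by rewrite E3 in q; lra.
rewrite ht E opprD addrA addrAC.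
apply: le_trans (ler_normB _ _) _; lra.
Unshelve. all: by end_near.
Qed.

Let pairing_increment n s t : 0 < s -> s <= t -> t < K n -> h t - h s = \int[mI s t]_r g r.
Proof.
move=> s0 slt tK.
exact: (weak_ode (K0 n) (Ih n) (Ig n) (@weak_pairing n) s0 slt tK (h_continuous s0) (h_continuous (lt_le_trans s0 slt))).
Qed.

Let y (t : measurableTypeR R) : R := \int[m3]_x (\sum_i (vb i (t, x) - U i (t, x)) ^+ 2).

Let y_ge0 t : 0 <= y t.
Proof. by apply: Rint_ge0 => x; apply: sumr_ge0 => i _; exact: sqr_ge0. Qed.

Let Iy L : intble (mI 0 L) y.
Proof.
have [n Ln] := exK L; apply: (intble_mI_sub (lexx 0) (ltW Ln)).
by have [] := Rint_fub1 (sumsq4_intble (fun i => sqint_sub (Svb (K0 n) i) (SU n.+1 i))).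
Qed.

Let yE t : 0 <= t -> y t = V t + VU t - 2 * h t.
Proof.
move=> t0; have I1 := sumsq_intble (SvL t0); have I2 := sumsq_intble (SUL t).
have I3 : intble m3 (fun x => pairing U vb (t, x)).
  by apply: intble_sum => i; exact: (sqint_mul (SvL t0 i) (SUL t i)).
rewrite /V /VU /h -(Rint_add I1 I2) -(Rint_scale 2 I3) -(Rint_sub (intble_add I1 I2) (intble_scale 2 I3)).
by apply: Rint_ext => x; rewrite /pairing /slice !sum3; ring.
Qed.

Let c : R := nu / (2 * pi) ^+ 2.

Let pairE (f : 'I_3 * 'I_3 -> R) : \sum_ij f ij = \sum_i \sum_j f (i, j).
Proof. by rewrite pair_bigA; apply: eq_bigr => -[]. Qed.

Let rate n : {ae mI 0 (K n), forall t,
  c * y t <= 2 * nu * A t + 2 * nu * B t - 2 * f1 t - 2 * f2 t + 2 * g t}.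
Proof.
have H1 : {ae mI 0 (K n), forall t, forall i, sqint m3 (fun x => F i (t, x))}.
  by apply: ae_all_fin => i; exact: (sqint_slice1 (SF n.+1 i)).
have H2 : {ae mI 0 (K n), forall t, forall ij, sqint m3 (fun x => DU ij (t, x))}.
  by apply: ae_all_fin => i; exact: (sqint_slice1 (SDU n.+1 i)).
have H3 : {ae mI 0 (K n), forall t, forall ij, sqint m3 (fun x => Db ij (t, x))}.
  by apply: ae_all_fin => i; exact: (sqint_slice1 (SDb (K0 n) i)).
have H4 : {ae mI 0 (K n), forall t, forall i, {ae m3, forall x, `|U i (t, x)| <= M}}.
  by apply: ae_all_fin => i; exact: (ae_section1 (UML n.+1 i)).
have H12 := ae_imp2 H1 H2 (fun t a b => conj a b).
have H34 := ae_imp2 H3 H4 (fun t a b => conj a b).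
have H56 := ae_imp2 (wdU (K n)) (wdv (K n)) (fun t a b => conj a b).
have H7 := ae_imp2 H12 H34 (fun t a b => conj a b).
have H8 := ae_imp2 H7 H56 (fun t a b => conj a b).
apply: (ae_imp2 H8 (mI_ae 0 (K n))) => t [[[SFt SDUt] [SDbt UMt]] [wdUt wdvt]] /andP[t0 _].
have mean (u : 'I_3 -> mpt R -> R) i : (forall i, measurable_fun setT (u i)) -> zero_mean u ->
    \int[m3]_x u i x = 0.
  by move=> mu zm; rewrite m3_Rint // zm.
have mU0 i : \int[m3]_x U i (t, x) = 0.
  by apply: (mean (slice U t)) => [j|]; [exact: slice_meas|have [] := hUs t].
have mv0 i : \int[m3]_x vb i (t, x) = 0.
  apply: (mean (slice vb t)) => [j|]; first exact: slice_meas.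
  by rewrite (vbE t0); have [] := hvs t0.
have AE : A t = \int[m3]_x (\sum_i \sum_j Db (i, j) (t, x) ^+ 2).
  by apply: Rint_ext => x; exact: (pairE (fun ij => Db ij (t, x) ^+ 2)).
have BE : B t = \int[m3]_x (\sum_i \sum_j DU (i, j) (t, x) ^+ 2).
  by apply: Rint_ext => x; exact: (pairE (fun ij => DU ij (t, x) ^+ 2)).
rewrite AE BE.
exact: (energy_rate (SUL t) SFt (SvL t0) (fun i j => SDUt (i, j)) (fun i j => SDbt (i, j))
  (solU t) (solv t0) mU0 mv0 wdUt wdvt M0 UMt Mnu).
Qed.

(** By [yE], y is the energy of v plus that of [U] minus twice [h]. The energy inequality, the
    energy equality and [pairing_increment] express its increment through exactly the integrand that
    [rate] bounds below by c y. *)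
Let decrease : {ae @lebesgue_measure R, forall s : measurableTypeR R, 0 < s -> forall t, s < t ->
  y t + c * \int[mI s t]_r y r <= y s}.
Proof.
apply: (ae_lebesgue_imp hve) => s Hs s0 t slt.
have s0' := ltW s0; have slt' := ltW slt.
have [n tK] := exK t; have tK' := ltW tK.
have Ev := energy_v s0' slt' (Hs s0 t slt).
have EU := energy_U s0' slt'.
have Eh := pairing_increment s0 slt' tK.
have JA := intble_mI_sub s0' tK' (IA n); have JB := intble_mI_sub s0' tK' (IB n).
have J1 := intble_mI_sub s0' tK' (If1 n); have J2 := intble_mI_sub s0' tK' (If2 n).
have Jg := intble_mI_sub s0' tK' (Ig n); have Jy := intble_mI_sub s0' tK' (Iy (K n)).
have LA := intble_scale (2 * nu) JA; have LB := intble_scale (2 * nu) JB.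
have L1 := intble_scale 2 J1; have L2 := intble_scale 2 J2; have Lg := intble_scale 2 Jg.
have P1 := intble_add LA LB; have P2 := intble_sub P1 L1; have P3 := intble_sub P2 L2.
have P4 := intble_add P3 Lg.
have rate' : {ae mI s t, forall r, c * y r <= 2 * nu * A r + 2 * nu * B r - 2 * f1 r - 2 * f2 r + 2 * g r}.
  have /(restr_ae (measurable_itv `[0, K n]) (nu := mI 0 (K n)) (fun A _ => mIE 0 (K n) A)) H := @rate n.
  apply: ae_mI_lebesgue; apply: (ae_lebesgue_imp H) => r Hr /andP[sr rt]; apply: Hr.
  by rewrite /= in_itv /= (le_trans s0' sr) (le_trans rt tK').
have := Rint_le_ae (intble_scale c Jy) P4 rate'.
rewrite (Rint_scale c Jy) (Rint_add P3 Lg) (Rint_sub P2 L2) (Rint_sub P1 L1) (Rint_add LA LB).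
rewrite (Rint_scale (2 * nu) JA) (Rint_scale (2 * nu) JB) (Rint_scale 2 J1) (Rint_scale 2 J2) (Rint_scale 2 Jg).
rewrite -Eh (yE s0') (yE (le_trans s0' slt')).
have arith (a b k q Vt Vs VUt VUs ht hs z : R) : Vt + 2 * nu * a <= Vs + 2 * k -> VUt + 2 * nu * b = VUs + 2 * q ->
  z <= 2 * nu * a + 2 * nu * b - 2 * k - 2 * q + 2 * (ht - hs) -> Vt + VUt - 2 * ht + z <= Vs + VUs - 2 * hs.
  by move=> *; lra.
exact: (arith _ _ _ _ _ _ _ _ _ _ _ Ev EU).
Qed.

Lemma attraction : L2norm (fun i x => v i (t, x) - U i (t, x)) @[t --> +oo%R] --> 0%E.
Proof.
have c0 : 0 < c by rewrite divr_gt0 // exprn_gt0 // mulr_gt0 // pi_gt0.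
have D := decay c0 y_ge0 Iy decrease.
have cy : Num.sqrt (y t) @[t --> +oo%R] --> (0 : R).
  apply/cvgrPdist_le => e e0.
  (* y is the square of the norm, so decay is invoked at level e^2. *)
  have [s Hs] := D _ (exprn_gt0 2 e0).
  near=> t; rewrite sub0r normrN ger0_norm ?sqrtr_ge0 //.
  rewrite -[e]gtr0_norm // -sqrtr_sqr; apply: ler_wsqrtr; apply: Hs.
  by near: t; apply: nbhs_pinfty_gt; exact: num_real.
have E : \forall t \near +oo%R, (Num.sqrt (y t))%:E = L2norm (fun i x => v i (t, x) - U i (t, x)).
  near=> t; have t0 : 0 <= t by near: t; apply: nbhs_pinfty_ge; exact: num_real.
  have := L2norm_real (fun i => sqint_sub (SvL t0 i) (SUL t i)).
  rewrite -[RHS]/((Num.sqrt (y t))%:E) => <-; congr L2norm.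
  by apply/funext => i; apply/funext => x; rewrite /slice /vb from0E.
apply: cvg_trans (near_eq_cvg E) _.
by apply: cvg_EFin => //; exact: nearW.
Unshelve. all: by end_near.
Qed.

End Attraction.

Theorem theorem4 (R : realType) :
  exists m : nat, (0 < m)%N /\
  forall nu Cstar G : R, 0 < nu ->
  exists Omega0 : R, 0 < Omega0 /\
  forall FF : R -> 'I_3 -> st R -> R, admissible_force m G FF ->
  forall Omega : R, Omega0 <= Omega ->
  forall vper : 'I_3 -> st R -> R,
    regular_periodic_solution nu (2 * pi / Omega) (FF Omega) vper ->
    (Linfnorm vper <= (Cstar * (1 + nu) * G / Omega)%:E)%E ->
  forall (v0 : 'I_3 -> pt R -> R) (v : 'I_3 -> st R -> R),
    inL2 v0 -> solenoidal v0 -> zero_mean v0 ->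
    leray_hopf nu (FF Omega) v0 v ->
  L2norm (fun i x => v i (t, x) - vper i (t, x)) @[t --> +oo%R] --> 0%E.
Proof.
(* The regularity of the force enters through its continuity, which class C^1 contains. *)
exists 1%N; split=> // nu Cstar G nu0.
pose L : R := 3 * (2 * pi) ^+ 2 + 1.
pose C : R := `|Cstar * (1 + nu) * G|.
have L0 : 0 <= L by rewrite addr_ge0 // mulr_ge0 // sqr_ge0.
have C0 : 0 <= C by exact: normr_ge0.
have Om0 : 0 < C * L / nu + 1 by rewrite ltr_wpDl // divr_ge0 // ?mulr_ge0 // ltW.
(* [C / Om] bounds the periodic solution, and Omega >= C L / nu is the smallness condition of
   [energy_rate]; adding 1 keeps the threshold positive even when C = 0. The absolute value in [C]
   keeps the bound nonnegative for any sign of [Cstar * (1 + nu) * G]. *)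
exists (C * L / nu + 1); split=> // FF adm Om OmL U.
have Omp : 0 < Om := lt_le_trans Om0 OmL.
move=> [hU hUs hUc [Ut [LU [gp [DU [p]]]]]].
move=> [[hUt hUtd] [hDU hDUd] [hLU hLUd] [hp hgp hgpd] [hC heq hUe]] Uoo v0 v _ _ _.
move=> [hv [hvs _] hvc hvb [hNS [Dv [hDv hDvd hDvi hve0 hve]]]].
have T0 : 0 < 2 * pi / Om by rewrite divr_gt0 // mulr_gt0 // pi_gt0.
have M0 : 0 <= C / Om by rewrite divr_ge0 // ltW.
have Mnu : C / Om * L <= nu.
  rewrite mulrAC ler_pdivrMr // (mulrC nu) -ler_pdivrMr //.
  by apply: le_trans OmL; rewrite lerDl.
have UM i : {ae @leb4 R, forall z, `|U i z| <= C / Om}.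
  apply: Linfnorm_ae; apply: le_trans Uoo _; rewrite lee_fin ler_wpM2r ?invr_ge0 ?(ltW Omp) //.
  exact: ler_norm.
exact: (attraction nu0 T0 M0 Mnu (@force_continuous R 1 G Om FF adm) UM hU hUs hUc hUt hUtd hDU hDUd
  hLU hLUd hp hgp hgpd hC heq hUe hv hvs hvc hvb hNS hDv hDvd hDvi hve0 hve).
Qed.
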